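(* Let $s,r,t$ be positive integers with $2\le s\le r$ and $t\ge 2$. Let $F_1,F_2,\dots,F_t$ be $t$ (vertex-)disjoint color-critical graphs, each with chromatic number $r+1$. Then for all sufficiently large $n$ (in terms of $s,r,t,F_1,\dots,F_t$), the graph $K_{t-1}+T_r(n-t+1)$ is, up to isomorphism, the unique graph attaining the maximum $s$-clique spectral radius among all $n$-vertex graphs that are $\bigcup_{i=1}^t F_i$-free.
   Context: All graphs are finite and simple. A graph is $F$-free if it does not contain $F$ as a (not necessarily induced) subgraph. $\chi(G)$ is the chromatic number; a graph $G$ is color-critical if there is an edge $e$ of $G$ with $\chi(G-e)<\chi(G)$. $\bigcup_{i=1}^t F_i$ is the disjoint union of the $F_i$. $T_r(m)$ is the $r$-partite Turán graph: the complete $r$-partite graph on $m$ vertices whose part sizes differ pairwise by at most $1$. The join $G_1+G_2$ of two disjoint graphs is obtained from $G_1\cup G_2$ by adding all edges between vertices of $G_1$ and vertices of $G_2$. An $s$-clique of $G$ is a set of $s$ vertices inducing a complete subgraph; $C_s(G)$ is the set of all $s$-cliques of $G$. For a graph $G$ on vertex set $\{1,\dots,n\}$, the $s$-clique tensor $\mathcal{A}_s(G)=(a_{i_1\cdots i_s})$ is the order-$s$, dimension-$n$ tensor with $a_{i_1\cdots i_s}=\frac{1}{(s-1)!}$ if $\{i_1,\dots,i_s\}\in C_s(G)$ and $0$ otherwise. For an order-$k$, dimension-$n$ tensor $\mathcal{A}$ and $x\in\mathbb{C}^n$, $(\mathcal{A}x^{k-1})_i=\sum_{i_2,\dots,i_k=1}^n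 a_{ii_2\cdots i_k}x_{i_2}\cdots x_{i_k}$; a number $\lambda\in\mathbb{C}$ is an eigenvalue of $\mathcal{A}$ if there is a nonzero $x$ with $(\mathcal{A}x^{k-1})_i=\lambda x_i^{k-1}$ for all $i$. The spectral radius of $\mathcal{A}$ is the maximum modulus of its eigenvalues. The $s$-clique spectral radius $\rho_s(G)$ is the spectral radius of $\mathcal{A}_s(G)$. *)

(* Defs.v *)
From HB Require Import structures.
From mathcomp Require Import all_boot all_order all_algebra.
From mathcomp Require Import classical_sets reals.
From mathcomp Require Import complex.

Set Implicit Arguments.
Unset Strict Implicit.
Unset Printing Implicit Defensive.

Import Order.TTheory GRing.Theory Num.Theory.

(* Finite simple graphs *)

Record sgraph := SGraph {
  svertex :> finType;
  sedge : rel svertex;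
  sedge_sym : symmetric sedge;
  sedge_irrefl : irreflexive sedge }.

Arguments sedge {s} u v.

Definition sg_contains (G F : sgraph) : Prop :=
  exists2 f : F -> G, injective f & forall u v, sedge u v -> sedge (f u) (f v).

Definition sg_free (F G : sgraph) : Prop := ~ sg_contains G F.

Definition sg_iso (G H : sgraph) : Prop :=
  exists2 f : G -> H, bijective f & forall u v, sedge (f u) (f v) = sedge u v.

Definition colorable (G : sgraph) (k : nat) : bool :=
  [exists f : {ffun G -> 'I_k},
    [forall u, forall v, sedge u v ==> (f u != f v)]].

Lemma colorable_exists (G : sgraph) : exists k, colorable G k.
Proof.
exists #|G|; apply/existsP; exists [ffun u => enum_rank u].
apply/forallP=> u; apply/forallP=> v; apply/implyP=> uv.
rewrite !ffunE; apply: contraTneq uv => /enum_rank_inj ->.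
by rewrite sedge_irrefl.
Qed.

Definition chi (G : sgraph) : nat := ex_minn (colorable_exists G).

Section DelEdge.
Variables (G : sgraph) (x y : G).

Definition del_edge_rel : rel G :=
  [rel u v | sedge u v && ([set u; v] != [set x; y])].

Lemma del_edge_sym : symmetric del_edge_rel.
Proof. by move=> u v; rewrite /del_edge_rel /= sedge_sym finset.setUC. Qed.

Lemma del_edge_irrefl : irreflexive del_edge_rel.
Proof. by move=> u; rewrite /del_edge_rel /= sedge_irrefl. Qed.

Definition del_edge : sgraph := SGraph del_edge_sym del_edge_irrefl.
End DelEdge.

Definition color_critical (G : sgraph) : Prop :=
  exists x y : G, sedge x y /\ chi (del_edge x y) < chi G.

Section DisjointUnion.
Variables (t : nat) (F : 'I_t -> sgraph).

Definition disjoint_union_rel : rel {i : 'I_t & F i} :=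
  fun u v => (tag u == tag v) && sedge (tagged u) (tagged_as u v).

Lemma disjoint_union_sym : symmetric disjoint_union_rel.
Proof.
move=> [i u] [j v]; rewrite /disjoint_union_rel /= [j == i]eq_sym.
by case: eqP v => //= eij; case: _ / eij => v; rewrite !tagged_asE sedge_sym.
Qed.

Lemma disjoint_union_irrefl : irreflexive disjoint_union_rel.
Proof.
by move=> [i u]; rewrite /disjoint_union_rel /= tagged_asE sedge_irrefl andbF.
Qed.

Definition disjoint_union : sgraph :=
  SGraph disjoint_union_sym disjoint_union_irrefl.
End DisjointUnion.

Section Join.
Variables G1 G2 : sgraph.

Definition join_rel : rel (G1 + G2) := fun u v =>
  match u, v with
  | inl u1, inl v1 => sedge u1 v1
  | inr u2, inr v2 => sedge u2 v2
  | _, _ => true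
  end.

Lemma join_sym : symmetric join_rel.
Proof. by move=> [u|u] [v|v] //=; rewrite sedge_sym. Qed.

Lemma join_irrefl : irreflexive join_rel.
Proof. by move=> [u|u] /=; rewrite sedge_irrefl. Qed.

Definition join : sgraph := SGraph join_sym join_irrefl.
End Join.

Section Complete.
Variable m : nat.

Lemma complete_sym : symmetric [rel u v : 'I_m | u != v].
Proof. by move=> u v; rewrite /= eq_sym. Qed.

Lemma complete_irrefl : irreflexive [rel u v : 'I_m | u != v].
Proof. by move=> u; rewrite /= eqxx. Qed.

Definition complete : sgraph := SGraph complete_sym complete_irrefl.
End Complete.

(* The parts of T_r(m) are the residue classes mod r in {0, ..., m-1}: for
   r > 0 there are r of them, each of size floor(m/r) or ceil(m/r). *)
Section Turan.
Variables r m : nat.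

Lemma turan_sym : symmetric [rel u v : 'I_m | u %% r != v %% r].
Proof. by move=> u v; rewrite /= eq_sym. Qed.

Lemma turan_irrefl : irreflexive [rel u v : 'I_m | u %% r != v %% r].
Proof. by move=> u; rewrite /= eqxx. Qed.

Definition turan : sgraph := SGraph turan_sym turan_irrefl.
End Turan.

Definition cliques (s : nat) (G : sgraph) : {set {set G}} :=
  [set S : {set G} | (#|S| == s) &&
    [forall u in S, forall v in S, (u != v) ==> sedge u v]].

Local Open Scope ring_scope.
Local Open Scope classical_set_scope.

(* The entry a_{i i_2 ... i_k} of an order-k tensor (k >= 1), with indices in
   the finite set T, is A i [tuple i_2; ...; i_k]. *)
Definition tensor (C : Type) (k : nat) (T : finType) : Type :=
  T -> k.-1.-tuple T -> C.

Definition tensor_apply (C : pzSemiRingType) (k : nat) (T : finType)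
    (A : tensor C k T) (x : T -> C) (i : T) : C :=
  \sum_(w : k.-1.-tuple T) A i w * \prod_(j <- w) x j.

Definition tensor_eigenvalue (C : pzSemiRingType) (k : nat) (T : finType)
    (A : tensor C k T) (l : C) : Prop :=
  exists x : T -> C, (exists i, x i != 0) /\
    forall i, tensor_apply A x i = l * x i ^+ k.-1.

(* On R[i] the norm `|l| is a (real) element of R[i]; Re brings it back to R. *)
Definition spectral_radius (R : realType) (k : nat) (T : finType)
    (A : tensor R[i] k T) : R :=
  sup [set complex.Re `|l| | l in [set l | tensor_eigenvalue A l]].

Lemma spectral_radius_max (R : realType) (k : nat) (T : finType)
    (A : tensor R[i] k T) (l : R[i]) :
  tensor_eigenvalue A l ->
  (forall l', tensor_eigenvalue A l' ->
    complex.Re `|l'| <= complex.Re `|l|) ->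
  spectral_radius A = complex.Re `|l|.
Proof.
move=> Al lmax; have lE : [set complex.Re `|l| | l in
    [set l | tensor_eigenvalue A l]] (complex.Re `|l|) by exists l.
have ubE : ubound [set complex.Re `|l| | l in
    [set l | tensor_eigenvalue A l]] (complex.Re `|l|).
  by move=> _ [l' Al' <-]; exact: lmax.
apply/eqP; rewrite eq_le; apply/andP; split.
  by apply: ge_sup => //; exists (complex.Re `|l|).
by apply: ub_le_sup => //; exists (complex.Re `|l|).
Qed.

Definition clique_tensor (C : unitRingType) (s : nat) (G : sgraph) :
    tensor C s G :=
  fun i w => if [set j in i :: w]%SET \in cliques s G
             then (s.-1)`!%:R^-1 else 0.

Definition clique_spectral_radius (R : realType) (s : nat) (G : sgraph) : R :=
  spectral_radius (@clique_tensor R[i] s G).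

(* Main.v *)
Require Import Defs.
From mathcomp Require Import boolp classical_sets reals topology normedtype derive.
From mathcomp Require realfun.
From mathcomp Require Import complex perm.
From mathcomp Require Import all_boot all_order all_algebra.
From mathcomp Require Import ring lra zify.

(** The [s]-clique spectral radius of a graph is the maximum, over the nonzero
    nonnegative weights [y] on its vertices, of [s] times the sum over the [s]-cliques
    of the products of the weights, divided by the sum of the [y v ^+ s]; the optimal
    weights, its Perron weights, satisfy the eigenvalue equations
    ([clique_radius_exists], [perron_exists]).  Two graphs are compared by testing the
    Perron weights of one of them on the other.

    Let [k = t - 1], and let [G0] be the join in the theorem.  Call a graph near-partite
    if it becomes [r]-colourable after the deletion of [k] vertices.  Among the
    near-partite graphs of a given order, [G0] has the largest radius and is the only one
    that reaches it: new edges between the parts, or at the deleted vertices, can only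
    help, and moving a vertex from a part to another one that is smaller by at least 2
    increases the clique sum ([mp_move], [near_partite_radius]).  As [G0] does not
    contain the union of the [F i] ([turan_join_free]), it remains to show that an
    extremal graph [G] of large order [n] is near-partite ([extremal_near_partite]).

    Suppose first that the Perron weights of [G] are nearly uniform.  Many
    [(r+1)]-cliques would yield a blow-up containing the union of the [F i], so there are
    few of them ([few_cliques]).  Call a set of at most two vertices a gadget if every
    [F i] can be embedded through it, robustly; then [G] has no [t] disjoint gadgets.
    Colour-criticality makes gadgets abundant: a vertex seeing a substantial share of
    each of [r] almost completely joined parts is one, and so is an edge inside such a
    part ([apex_gadget], [edge_gadget]).  By the eigenvalue equation, each neighbourhood
    has almost the clique sum of a neighbourhood in a Turan graph, which forces degrees
    of about [1 - 1 / r] at the vertices that are no gadgets ([degree_lower], by the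
    Moon-Moser inequalities).  Around an [r]-clique with few extensions this produces [r]
    parts of weight about [1 / r], outside of a set [A] of at most [k] vertices, with
    inner edges only at boundedly many vertices ([near_uniform_structure]).  If [A] has
    fewer than [k] vertices, joining one more vertex to everything gains more than the
    inner edges are worth, and contradicts extremality; if it has [k] vertices, an inner
    edge would be a gadget too many, so [G] is near-partite ([near_uniform_partite]).

    If on the other hand some vertex has a weight well below the average, its deletion
    costs less than the radius of [G0] loses when the order decreases by 1; the latter is
    estimated by cloning an average vertex of a smaller [G0] ([phi_growth]).  The ratio of
    the two radii increases by a factor [1 + ga / n] ([descent_step]).  If [G] is not
    near-partite, the ratio is then larger than 1, and the smaller graph is not
    near-partite either; so this can be repeated until half of the vertices are deleted.
    By then the ratio exceeds 1 by a constant, although both radii are asymptotic to the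
    same multiple of the power [s - 1] of the order ([radius_upper],
    [turan_radius_lower]). *)

Set Implicit Arguments.
Unset Strict Implicit.
Unset Printing Implicit Defensive.

Import Order.TTheory GRing.Theory Num.Theory.

Local Open Scope ring_scope.

(** * Weighted clique sums *)

Section CliqueSums.
Variables (R : realFieldType) (T : finType) (e : rel T) (y : T -> R).
Hypotheses (e_sym : symmetric e) (e_irr : irreflexive e).
Implicit Types (S U Q K : {set T}) (k : nat).

Definition is_clique S := [forall u in S, forall v in S, (u != v) ==> e u v].

Lemma is_cliqueP S :
  reflect {in S &, forall u v, u != v -> e u v} (is_clique S).
Proof.
apply: (iffP forall_inP) => [cS u v uS vS uv|cS u uS].
  by move/forall_inP: (cS u uS) => /(_ v vS); rewrite uv.
by apply/forall_inP=> v vS; apply/implyP; exact: cS.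
Qed.

Definition clique_in k U S := [&& S \subset U, #|S| == k & is_clique S].

Definition cl k U := \sum_(S | clique_in k U S) \prod_(v in S) y v.

Definition wt U := \sum_(v in U) y v.

Definition nb v : {set T} := [set u | e v u].

Definition cnb S : {set T} := [set u | [forall v in S, e v u]].

Lemma in_nb u v : (u \in nb v) = e v u. Proof. by rewrite inE. Qed.

Lemma cnbP S u : reflect {in S, forall v, e v u} (u \in cnb S).
Proof. by rewrite inE; exact: forall_inP. Qed.

Lemma cnb_notin S u : u \in cnb S -> u \notin S.
Proof. by move/cnbP=> h; apply/negP=> /h; rewrite e_irr. Qed.

Lemma is_cliqueS S K : S \subset K -> is_clique K -> is_clique S.
Proof.
move=> sSK /is_cliqueP cK; apply/is_cliqueP=> u v uS vS.
by apply: cK; apply: (subsetP sSK).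
Qed.

Lemma is_clique_setU1 u Q :
  u \notin Q -> is_clique (u |: Q) = is_clique Q && (u \in cnb Q).
Proof.
move=> uQ; apply/idP/andP=> [cK|[/is_cliqueP cQ /cnbP uN]].
  split; first by apply: is_cliqueS cK; exact: subsetUr.
  apply/cnbP=> v vQ; move/is_cliqueP: cK; apply; rewrite ?setU11 //.
    by rewrite setU1r.
  by apply: contraNneq uQ => <-.
apply/is_cliqueP=> a b /setU1P[->|aQ] /setU1P[->|bQ] ab.
- by rewrite eqxx in ab.
- by rewrite e_sym uN.
- by rewrite uN.
- exact: cQ.
Qed.

Lemma clique_in_setU1 k U u Q : u \notin Q ->
  clique_in k.+1 U (u |: Q) = (u \in U) && clique_in k (U :&: nb u) Q.
Proof.
move=> uQ; rewrite /clique_in subUset sub1set cardsU1 uQ add1n eqSS.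
rewrite is_clique_setU1 // subsetI.
case: (u \in U) => //=; case: (Q \subset U) => //=; rewrite andbCA.
case: (#|Q| == k) => //=; rewrite ?andbF //=; rewrite andbC; congr (_ && _).
apply/cnbP/subsetP=> h v /h; by rewrite in_nb e_sym.
Qed.

(** Removing [u] is a bijection onto the cliques of the neighbourhood of [u]. *)
Lemma link_sum k U u (F : {set T} -> R) : u \in U ->
  \sum_(K | clique_in k.+1 U K && (u \in K)) F K
  = \sum_(Q | clique_in k (U :&: nb u) Q) F (u |: Q).
Proof.
move=> uU; rewrite (reindex_onto (fun Q => u |: Q) (fun K => K :\ u)) /=.
  apply: eq_bigl => Q; rewrite setU11 andbT.
  case: (boolP (u \in Q)) => uQ.
    have -> : (u |: Q) :\ u == Q = false.
      by apply/eqP=> h; move: uQ; rewrite -h setD11.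
    rewrite andbF; apply/esym/negbTE; apply: contraL uQ.
    case/and3P=> /subsetP sQ _ _; apply/negP=> /sQ.
    by rewrite in_setI in_nb e_irr andbF.
  by rewrite setU1K // eqxx andbT clique_in_setU1 // uU.
by move=> K /andP[_ uK]; rewrite setD1K.
Qed.

Lemma clique_in_notin k U u Q : clique_in k (U :&: nb u) Q -> u \notin Q.
Proof.
by case/and3P=> /subsetP s _ _; apply/negP=> /s; rewrite in_setI in_nb e_irr andbF.
Qed.

Lemma prod_setU1 u Q : u \notin Q ->
  \prod_(v in u |: Q) y v = y u * \prod_(v in Q) y v.
Proof. by move=> uQ; rewrite big_setU1. Qed.

(** Both sides run over the pairs of a clique [Q] and a vertex [u] adjacent to all of
    it; the right one groups them by the clique [u |: Q]. *)
Lemma flag_sum k U (H : {set T} -> T -> R) :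
  \sum_(Q | clique_in k U Q) (\prod_(v in Q) y v)
     * \sum_(u in U :&: cnb Q) y u * H Q u
  = \sum_(K | clique_in k.+1 U K) (\prod_(v in K) y v)
     * \sum_(u in K) H (K :\ u) u.
Proof.
under eq_bigr do rewrite big_distrr /=.
under [RHS]eq_bigr do rewrite big_distrr /=.
rewrite (exchange_big_dep (mem U)) /=; last by move=> Q u _ /setIP[].
rewrite (exchange_big_dep (mem U)) /=; last first.
  by move=> K u /and3P[/subsetP s _ _]; exact: s.
apply: eq_bigr => u uU; rewrite link_sum //.
apply: eq_big => [Q|Q /andP[cQ]].
  rewrite in_setI uU /=; apply/andP/idP=> [[]|].
    case/and3P=> sQ kQ cQ /cnbP uN; apply/and3P; split=> //.
    apply/subsetP=> v vQ; rewrite in_setI in_nb (subsetP sQ) //= e_sym.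
    exact: uN.
  case/and3P; rewrite subsetI => /andP[sQ sN] kQ cQ; split; first exact/and3P.
  by apply/cnbP=> v vQ; rewrite e_sym -in_nb (subsetP sN).
case/setIP=> _ uN; have uQ := cnb_notin uN.
by rewrite prod_setU1 // setU1K //; ring.
Qed.

Lemma clE_rem k U u : u \in U ->
  cl k.+1 U = cl k.+1 (U :\ u) + y u * cl k (U :&: nb u).
Proof.
move=> uU; rewrite /cl (bigID (fun K : {set T} => u \in K)) /= addrC; congr (_ + _).
  apply: eq_bigl => K; rewrite /clique_in subsetD1.
  by case: (K \subset U); case: (u \in K); rewrite ?andbF ?andbT.
rewrite link_sum // big_distrr; apply: eq_bigr => Q /clique_in_notin uQ.
by rewrite prod_setU1.
Qed.

Lemma cl0 U : cl 0 U = 1.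
Proof.
rewrite /cl (big_pred1 set0) ?big_set0 // => S /=.
rewrite /clique_in cards_eq0; case: eqP => [->|]; last by rewrite andbF.
by rewrite sub0set /=; apply/is_cliqueP=> u v; rewrite inE.
Qed.

Lemma clSE k U :
  k.+1%:R * cl k.+1 U = \sum_(u in U) y u * cl k (U :&: nb u).
Proof.
have := flag_sum k U (fun _ _ => 1).
under [RHS]eq_bigr => K /and3P[_ /eqP kK _] do rewrite sumr_const kK mulrC.
rewrite -big_distrr => /= <-.
under eq_bigr do rewrite big_distrr /=.
rewrite (exchange_big_dep (mem U)) /=; last by move=> Q u _ /setIP[].
apply: eq_bigr => u uU; rewrite big_distrr.
apply: eq_big => [Q|Q _]; last by rewrite mulr1 mulrC.
rewrite in_setI uU /= /clique_in subsetI.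
case: (Q \subset U) => //=; rewrite [in RHS]andbC; congr (_ && _).
by apply/cnbP/subsetP=> h v /h; rewrite in_nb e_sym.
Qed.

Lemma cl1 U : cl 1 U = wt U.
Proof.
rewrite -[LHS]mul1r (clSE 0); apply: eq_bigr => u _; by rewrite cl0 mulr1.
Qed.

Section Nonneg.
Hypothesis y0 : forall v, 0 <= y v.

Lemma wt_ge0 U : 0 <= wt U. Proof. exact: sumr_ge0. Qed.

Lemma prod_ge0 Q : 0 <= \prod_(v in Q) y v.
Proof. exact: prodr_ge0. Qed.

Lemma cl_ge0 k U : 0 <= cl k U.
Proof. by apply: sumr_ge0 => S _; exact: prod_ge0. Qed.

Lemma ler_sum_subset (I : finType) (P P' : pred I) (F : I -> R) :
  (forall i, P i -> P' i) -> (forall i, P' i -> 0 <= F i) ->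
  \sum_(i | P i) F i <= \sum_(i | P' i) F i.
Proof.
move=> sP F0; rewrite [leRHS](bigID P) /=.
rewrite (eq_bigl P) => [|i]; last by case: (boolP (P i)) => [/sP->|]; rewrite ?andbF.
by rewrite lerDl; apply: sumr_ge0 => i /andP[/F0].
Qed.

Lemma cl_sub k U U' : U \subset U' -> cl k U <= cl k U'.
Proof.
move=> s; apply: ler_sum_subset => [S /and3P[sS kS cS]|S _]; last exact: prod_ge0.
by apply/and3P; split=> //; exact: subset_trans s.
Qed.

Lemma wt_sub U U' : U \subset U' -> wt U <= wt U'.
Proof. by move=> s; apply: ler_sum_subset => // i; exact: (subsetP s). Qed.

Lemma wtI U A : wt U = wt (U :&: A) + wt (U :\: A).
Proof. by rewrite /wt (big_setID A). Qed.

Lemma wtU U A : wt (U :|: A) <= wt U + wt A.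
Proof.
rewrite (wtI (U :|: A) U) setUK; apply: lerD => //.
by apply: wt_sub; rewrite setDUl setDv set0U subsetDl.
Qed.

Lemma wt_card_le U c : (forall v, y v <= c) -> wt U <= c *+ #|U|.
Proof. by move=> h; rewrite -sumr_const; apply: ler_sum. Qed.

(** Counting ordered cliques removes the factor of [clSE], and makes the clique sums of
    large balanced multipartite graphs close to [turan_density] times a power of the
    weight. *)
Definition ocl k U := k`!%:R * cl k U.

Lemma ocl0 U : ocl 0 U = 1. Proof. by rewrite /ocl cl0 mulr1. Qed.

Lemma oclSE k U : ocl k.+1 U = \sum_(u in U) y u * ocl k (U :&: nb u).
Proof.
rewrite /ocl factS mulnC natrM -mulrA clSE big_distrr; apply: eq_bigr => u _ /=.
by rewrite mulrCA.
Qed.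

Lemma ocl1 U : ocl 1 U = wt U. Proof. by rewrite /ocl cl1 mul1r. Qed.

Lemma ocl_ge0 k U : 0 <= ocl k U.
Proof. by rewrite mulr_ge0 ?cl_ge0. Qed.

Lemma ocl_sub k U U' : U \subset U' -> ocl k U <= ocl k U'.
Proof. by move=> s; rewrite ler_wpM2l ?cl_sub. Qed.

Lemma ocl_le_step k U : ocl k.+1 U <= wt U * ocl k U.
Proof.
rewrite oclSE /wt big_distrl; apply: ler_sum => u _.
by rewrite ler_wpM2l // ocl_sub // subsetIl.
Qed.

Lemma ocl_le k U : ocl k U <= wt U ^+ k.
Proof.
elim: k => [|k IH]; first by rewrite ocl0 expr0.
by apply: le_trans (ocl_le_step _ _) _; rewrite exprS ler_wpM2l ?wt_ge0.
Qed.

Lemma cl_le_ocl k U : cl k U <= ocl k U.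
Proof. by rewrite /ocl ler_peMl ?cl_ge0 // ler1n fact_gt0. Qed.

(** A clique is chosen greedily: each new vertex removes at most [eta] from the weight
    of the candidates. *)
Lemma ocl_greedy k eta U : 0 <= eta ->
  (forall u, u \in U -> wt (U :\: nb u) <= eta) ->
  (forall i, (i < k)%N -> 0 <= wt U - i%:R * eta) ->
  \prod_(i < k) (wt U - i%:R * eta) <= ocl k U.
Proof.
move=> eta0; elim: k U => [|k IH] U hU hw; first by rewrite big_ord0 ocl0.
rewrite oclSE big_ord_recl mul0r subr0 {1}/wt big_distrl.
apply: ler_sum => u uU; rewrite ler_wpM2l //.
have hwu : wt U - eta <= wt (U :&: nb u).
  by rewrite (wtI U (nb u)) lerBlDr lerD2l hU.
apply: (le_trans _ (IH (U :&: nb u) _ _)).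
- apply: ler_prod => i _; rewrite lift0.
  have -> : 0 <= wt U - i.+1%:R * eta by apply: hw; rewrite ltnS.
  rewrite -natr1 /=; lra.
- move=> v /setIP[vU _]; apply: le_trans (hU _ vU); apply: wt_sub.
  by apply: setSD; exact: subsetIl.
- move=> i ik; have := hw i.+1; rewrite ltnS => /(_ ik); rewrite -natr1; lra.
Qed.

End Nonneg.
End CliqueSums.

(** * The Moon-Moser inequality *)

Section MoonMoser.
Variable R : realFieldType.

Lemma weighted_cauchy_schwarz (I : finType) (P : pred I) (a b : I -> R) :
  (forall i, P i -> 0 <= a i) ->
  (\sum_(i | P i) a i * b i) ^+ 2
  <= (\sum_(i | P i) a i) * (\sum_(i | P i) a i * b i ^+ 2).
Proof.
move=> a0; set A := \sum_(i | P i) a i; set B := \sum_(i | P i) a i * b i.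
set C := \sum_(i | P i) _ * _ ^+ 2.
have A0 : 0 <= A by exact: sumr_ge0.
have C0 : 0 <= C by apply: sumr_ge0 => i Pi; rewrite mulr_ge0 ?a0 ?sqr_ge0.
have : 0 <= \sum_(i | P i) a i * (b i * A - B) ^+ 2.
  by apply: sumr_ge0 => i Pi; rewrite mulr_ge0 ?a0 ?sqr_ge0.
have -> : \sum_(i | P i) a i * (b i * A - B) ^+ 2
    = (\sum_(i | P i) a i * b i ^+ 2) * A ^+ 2
      - (\sum_(i | P i) a i * b i) * (2 * A * B) + (\sum_(i | P i) a i) * B ^+ 2.
  by rewrite !big_distrl -sumrB -big_split /=; apply: eq_bigr => i _; ring.
rewrite -/A -/B -/C.
have -> : C * A ^+ 2 - B * (2 * A * B) + A * B ^+ 2 = A * (A * C - B ^+ 2) by ring.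
have [A1|A1 _] := ltP 0 A; first by rewrite pmulr_rge0 // subr_ge0.
have AE : A = 0 by apply/le_anti; rewrite A1.
suff -> : B = 0 by rewrite expr0n mulr_ge0.
have /allP h : all (fun i => P i ==> (a i == 0)) (index_enum I).
  by rewrite -psumr_eq0 //; apply/eqP.
apply: big1 => i Pi; have := h i (mem_index_enum i); rewrite Pi => /eqP ->.
by rewrite mul0r.
Qed.

Variables (T : finType) (e : rel T) (y : T -> R).
Hypotheses (e_sym : symmetric e) (e_irr : irreflexive e).
Hypothesis (y0 : forall v, 0 <= y v).
Implicit Types (S U Q K : {set T}) (k : nat).

Lemma sum_ext k U :
  \sum_(Q | clique_in e k U Q) (\prod_(v in Q) y v) * wt y (U :&: cnb e Q)
  = k.+1%:R * cl e y k.+1 U.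
Proof.
transitivity (\sum_(Q | clique_in e k U Q) (\prod_(v in Q) y v) *
    \sum_(u in U :&: cnb e Q) y u * 1).
  by apply: eq_bigr => Q _; congr (_ * _); apply: eq_bigr => v _; rewrite mulr1.
rewrite (flag_sum y e_sym e_irr k U (fun _ _ => 1)) /cl big_distrr /=.
by apply: eq_bigr => K /and3P[_ /eqP kK _]; rewrite sumr_const kK mulrC.
Qed.

(** A vertex [w] outside [cnb K] can be adjacent to all of [K :\ u] for at most
    one [u] in [K]: two such sets [K :\ u] already cover [K]. *)
Lemma sum_cnb_setD1 K w :
  (\sum_(u in K) (w \in cnb e (K :\ u)) <= 1 + #|K|.-1 * (w \in cnb e K))%N.
Proof.
case: (boolP (w \in cnb e K)) => wK.
  rewrite muln1; apply: leq_trans (_ : #|K| <= _)%N; last by lia.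
  by rewrite -sum1_card; apply: leq_sum => u _; case: (_ \in _).
rewrite muln0 addn0; case: (pickP [pred u in K | w \in cnb e (K :\ u)]) => [u|h].
  case/andP=> uK wu; rewrite (bigD1 u) //= big1 ?addn0 ?leq_b1 // => v /andP[vK vu].
  case: (boolP (w \in _)) => // wv; case/negP: wK; apply/cnbP=> z zK.
  have [zu|zu] := eqVneq z u.
    by move/cnbP: wv; apply; rewrite zu !inE eq_sym vu.
  by move/cnbP: wu; apply; rewrite !inE zu.
by rewrite big1 // => u uK; have := h u; rewrite /= uK /= => ->.
Qed.

Lemma wtIE U A : wt y (U :&: A) = \sum_(w in U) y w * (w \in A)%:R.
Proof.
rewrite /wt (eq_bigl (fun w => (w \in U) && (w \in A))) => [|w]; last first.
  by rewrite in_setI.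
by rewrite big_mkcondr; apply: eq_bigr => w _; case: (_ \in _); rewrite ?mulr1 ?mulr0.
Qed.

(** Cauchy-Schwarz over the [k]-cliques [Q] for the weight [d Q] of the vertices
    extending [Q]. The weighted sum of the [d Q ^+ 2] is a sum over the [k+1]-cliques
    [K] of the numbers [d (K :\ u)] for [u] in [K], and these add up to at most
    [wt y U + k * d K] by [sum_cnb_setD1]. *)
Lemma moon_moser k U :
  k.+1%:R * ocl e y k.+1 U ^+ 2
  <= ocl e y k U * (wt y U * ocl e y k.+1 U + k%:R * ocl e y k.+2 U).
Proof.
have key : (k.+1%:R * cl e y k.+1 U) ^+ 2 <=
   cl e y k U * (wt y U * cl e y k.+1 U + k%:R * (k.+2%:R * cl e y k.+2 U)).
  rewrite -!sum_ext; apply: le_trans (weighted_cauchy_schwarz _ _) _ => [Q _|].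
    exact: prod_ge0.
  rewrite ler_wpM2l ?cl_ge0 //.
  have -> : \sum_(Q | clique_in e k U Q)
      (\prod_(v in Q) y v) * wt y (U :&: cnb e Q) ^+ 2 =
    \sum_(Q | clique_in e k U Q) (\prod_(v in Q) y v) *
       \sum_(u in U :&: cnb e Q) y u * wt y (U :&: cnb e Q).
    by apply: eq_bigr => Q _; rewrite -big_distrl.
  rewrite (flag_sum y e_sym e_irr k U (fun Q _ => wt y (U :&: cnb e Q))).
  rewrite /cl !big_distrr -big_split /=; apply: ler_sum => K /and3P[_ /eqP kK _].
  rewrite [leRHS](_ : _ = (\prod_(v in K) y v) *
     (wt y U + k%:R * wt y (U :&: cnb e K))); last by ring.
  rewrite ler_wpM2l ?prod_ge0 //.
  have -> : \sum_(u in K) wt y (U :&: cnb e (K :\ u)) =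
     \sum_(w in U) y w * (\sum_(u in K) (w \in cnb e (K :\ u)))%:R.
    under [RHS]eq_bigr do rewrite natr_sum big_distrr.
    by rewrite exchange_big; apply: eq_bigr => u _ /=; rewrite wtIE.
  rewrite wtIE {1}/wt big_distrr -big_split /=; apply: ler_sum => w _.
  rewrite [leRHS](_ : _ = y w * (1 + k%:R * (w \in cnb e K)%:R)); last by ring.
  by rewrite ler_wpM2l // -natrM -(natrD _ 1) ler_nat; have := sum_cnb_setD1 K w; rewrite kK.
rewrite /ocl !factS !natrM; set a := (_`!)%:R.
have a0 : 0 <= a by [].
have := ler_wpM2l (mulr_ge0 (mulr_ge0 a0 a0) (ler0n R k.+1)) key.
set c0 := cl e y k U; set c1 := cl e y k.+1 U; set c2 := cl e y k.+2 U.
by move=> h; lra.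
Qed.
End MoonMoser.

(** * Clique densities *)

Section Density.
Variable R : realFieldType.

Definition turan_density (r k : nat) : R := \prod_(i < k) (1 - i%:R / r%:R).

Lemma turan_density_gt0 r k : (k <= r)%N -> 0 < turan_density r k.
Proof.
move=> kr; apply: prodr_gt0 => i _; rewrite subr_gt0.
have ir : (i < r)%N by exact: leq_trans kr.
by rewrite ltr_pdivrMr ?mul1r ?ltr_nat // ltr0n; case: (r) ir.
Qed.

Lemma ler_prod_perturb (a b : nat -> R) k :
  (forall i, (i < k)%N -> [/\ 0 <= a i, a i <= b i & b i <= 1]) ->
  \prod_(i < k) b i <= \prod_(i < k) a i + \sum_(i < k) (b i - a i).
Proof.
elim: k => [|k IH] h; first by rewrite !big_ord0 addr0.
rewrite !big_ord_recr /=.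
have [a0 ab b1] := h k (ltnSn k).
have {}h i : (i < k)%N -> [/\ 0 <= a i, a i <= b i & b i <= 1].
  by move=> ik; apply: h; rewrite ltnS ltnW.
have {}IH := IH h.
have B1 : \prod_(i < k) b i <= 1.
  by apply: prodr_ile1 => i _; have [? ? ->] := h i (ltn_ord i); rewrite andbT; lra.
have B0 : 0 <= \prod_(i < k) b i.
  by apply: prodr_ge0 => i _; have [? ? _] := h i (ltn_ord i); lra.
set A := \prod_(i < k) a i in IH *; set B := \prod_(i < k) b i in IH B0 B1 *.
set s := \sum_(i < k) _ in IH *.
have s0 : 0 <= s by apply: sumr_ge0 => i _; have [? ? _] := h i (ltn_ord i); lra.
have : B * (b k - a k) <= b k - a k by rewrite ler_piMl // subr_ge0.
have : a k * B <= a k * (A + s) by rewrite ler_wpM2l.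
have : a k * s <= s by rewrite ler_piMl //; lra.
by lra.
Qed.

Section OneGraph.
Variables (T : finType) (e : rel T) (y : T -> R).
Hypotheses (e_sym : symmetric e) (e_irr : irreflexive e).
Hypothesis (y0 : forall v, 0 <= y v).
Variable U : {set T}.
Let W := wt y U.
Let o k := ocl e y k U.

Let W0 : 0 <= W. Proof. exact: wt_ge0. Qed.
Let o0 k : 0 <= o k. Proof. exact: ocl_ge0. Qed.
Let o_step k : o k.+1 <= W * o k. Proof. exact: ocl_le_step. Qed.

(** If the ratio of consecutive clique sums is written as [W * (1 - k * t)], then by
    [moon_moser] the number [t] never increases with [k]; in a large Turan graph with
    uniform weights it is constantly close to [1 / r]. *)
Lemma ratio_step k sg : (0 < k)%N ->
  (1 - k%:R * sg) * (W * o k) <= o k.+1 ->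
  (1 - k.+1%:R * sg) * (W * o k.+1) <= o k.+2.
Proof.
move=> k0 h; have [o1|o1] := leP (o k.+1) 0.
  have -> : o k.+1 = 0 by apply/le_anti; rewrite o1 o0.
  by rewrite !mulr0 o0.
have ok : 0 < o k.
  rewrite lt_neqAle o0 andbT; apply/eqP=> ok; have := o_step k.
  by rewrite -ok mulr0 leNgt o1.
have kR : 0 < k%:R :> R by rewrite ltr0n.
have mm := moon_moser e_sym e_irr y0 k U; rewrite -/W -/(o _) -/(o _) -/(o _) in mm.
rewrite -(ler_pM2l (mulr_gt0 kR ok)).
have := ler_wpM2l (mulr_ge0 (ler0n R k.+1) (o0 k.+1)) h.
move: mm; rewrite -natr1 => mm h2; lra.
Qed.

Lemma ratio_run k i sg : (0 < i)%N -> (i <= k)%N ->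
  (1 - i%:R * sg) * (W * o i) <= o i.+1 ->
  (1 - k%:R * sg) * (W * o k) <= o k.+1.
Proof.
move=> i0 ik h; rewrite -(subnKC ik); elim: (k - i)%N => [|d IH].
  by rewrite addn0.
by rewrite addnS; apply: ratio_step => //; rewrite addn_gt0 i0.
Qed.

Lemma ratio_chain k i c : 0 <= c -> (i <= k)%N ->
  (forall j, (i <= j < k)%N -> c * o j <= o j.+1) -> c ^+ (k - i) * o i <= o k.
Proof.
move=> c0 ik; rewrite -{1 3}(subnKC ik); elim: (k - i)%N => [|d IH] h.
  by rewrite expr0 mul1r addn0.
rewrite addnS exprS -mulrA; apply: le_trans (h (i + d)%N _); last by lia.
by rewrite ler_wpM2l // IH // => j jd; apply: h; lia.
Qed.

Lemma ratio_prod k sg : (forall i, (i < k)%N -> 0 <= 1 - i%:R * sg) ->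
  (forall i, (0 < i < k)%N -> o i.+1 <= (1 - i%:R * sg) * (W * o i)) ->
  o k <= \prod_(i < k) (1 - i%:R * sg) * W ^+ k.
Proof.
elim: k => [|k IH] sg0 h; first by rewrite big_ord0 /o ocl0 ?mulr1.
rewrite big_ord_recr exprS /=.
have {}IH : o k <= \prod_(i < k) (1 - i%:R * sg) * W ^+ k.
  by apply: IH => i ik; [apply: sg0|apply: h]; lia.
apply: le_trans (_ : (1 - k%:R * sg) * (W * o k) <= _).
  case: k h {sg0 IH} => [_|k h]; last by apply: h; lia.
  by rewrite /o mul0r subr0 mul1r ocl0 ?ocl1 // mulr1.
set p := \prod_(i < k) _ in IH *.
have := ler_wpM2l (mulr_ge0 (sg0 k (ltnSn k)) W0) IH; lra.
Qed.

Lemma ocl_decr i j : W <= 1 -> (i <= j)%N -> o j <= o i.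
Proof.
move=> W1 ij; rewrite -(subnKC ij); elim: (j - i)%N => [|d IH]; first by rewrite addn0.
rewrite addnS; apply: le_trans (o_step _) _; apply: le_trans IH.
by rewrite ler_piMl.
Qed.
End OneGraph.

(** Take [sg] slightly below [1 / r]. If some ratio of consecutive clique sums below [j]
    were at least [(1 - i * sg) * W], all the later ones would stay bounded below by
    [ratio_run], and their product would give many [(r+1)]-cliques. So the ratios up to
    [j] are small, and their product is the bound. *)
Lemma clique_density_upper r j (eps : R) : (0 < r)%N -> (j <= r)%N -> 0 < eps ->
  exists2 del, 0 < del & forall (T : finType) (e : rel T) (y : T -> R) (U : {set T}),
    symmetric e -> irreflexive e -> (forall v, 0 <= y v) -> wt y U <= 1 ->
    ocl e y r.+1 U <= del ->
    ocl e y j U <= turan_density r j * wt y U ^+ j + eps.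
Proof.
move=> r0 jr eps0.
have rR : 0 < r%:R :> R by rewrite ltr0n.
pose eta : R := Num.min (r%:R^-1) (eps / (j ^ 2).+1%:R).
have eta0 : 0 < eta by rewrite lt_min invr_gt0 rR divr_gt0.
have eta_r : r%:R * eta <= 1.
  apply: le_trans (_ : r%:R * r%:R^-1 <= 1); last by rewrite mulfV // lt0r_neq0.
  by rewrite ler_pM2l // /eta ge_min lexx.
have eta_j : (j ^ 2)%:R * eta <= eps.
  have : eta <= eps / (j ^ 2).+1%:R by rewrite /eta ge_min lexx orbT.
  rewrite ler_pdivlMr // => h; apply: le_trans h.
  by rewrite mulrC ler_pM2l // ler_nat.
(* This makes [1 - r * sg = r * eta], so that the lower bounds for the ratios stay
   positive up to [k = r]. *)
pose sg := r%:R^-1 - eta.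
have sg_r : 1 - r%:R * sg = r%:R * eta.
  by rewrite /sg mulrBr mulfV ?lt0r_neq0 //; lra.
have sg0 : 0 <= sg.
  by rewrite /sg subr_ge0 /eta ge_min lexx.
have sgk k : (k <= r)%N -> r%:R * eta <= 1 - k%:R * sg.
  by move=> kr; rewrite -sg_r lerD2l lerN2 ler_wpM2r // ler_nat.
exists ((r%:R * eta * eps) ^+ r.+1 * eps / 2).
  by rewrite divr_gt0 // mulr_gt0 // exprn_gt0 // !mulr_gt0.
move=> T e y U e_sym e_irr y0 W1 hr; rewrite leNgt; apply/negP=> hj.
have W0 := wt_ge0 y0 U.
have oj : eps < ocl e y j U.
  apply: le_lt_trans hj; rewrite lerDr mulr_ge0 ?exprn_ge0 //.
  exact/ltW/turan_density_gt0.
have oW := ocl_le e_sym e_irr y0 j U.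
case: (posnP j) => [j_eq|j_gt].
  by move: hj; rewrite j_eq ocl0 ?ltNge // expr0 mulr1 /turan_density big_ord0; lra.
have epsW : eps < wt y U.
  apply: lt_le_trans oj _; apply: le_trans oW _.
  by rewrite -(prednK j_gt) exprS ler_piMr // exprn_ile1.
have eps1 : eps < 1 by exact: lt_le_trans epsW W1.
pose P i := (0 < i < j)%N && ((1 - i%:R * sg) * (wt y U * ocl e y i U) <= ocl e y i.+1 U).
have [/existsP[i /andP[/andP[i0 ij] hi]]|/existsPn hP] := boolP [exists i : 'I_j, P i].
  have hk k : (i <= k < r.+1)%N -> r%:R * eta * eps * ocl e y k U <= ocl e y k.+1 U.
    case/andP=> ik kr; have := ratio_run e_sym e_irr y0 i0 ik hi.
    apply: le_trans; rewrite [leRHS]mulrA; apply: ler_wpM2r; first exact: ocl_ge0.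
    by apply: ler_pM; rewrite ?mulr_ge0 ?(ltW eta0) ?(ltW eps0) ?(ltW epsW) ?sgk.
  have c0 : 0 <= r%:R * eta * eps by rewrite !mulr_ge0 // ltW.
  have := ratio_chain y0 c0 _ hk; rewrite leqW 1?(leq_trans (ltnW ij)) // => /(_ isT).
  apply/negP; rewrite -ltNge; apply: le_lt_trans hr _.
  apply: lt_le_trans (_ : (r%:R * eta * eps) ^+ r.+1 * eps <= _).
    by rewrite gtr_pMr ?invf_lt1 ?ltr1n // mulr_gt0 ?exprn_gt0 // !mulr_gt0.
  apply: ler_pM; rewrite ?exprn_ge0 ?(ltW eps0) //.
    apply: ler_wiXn2l => //; last exact: leq_subr.
    by apply: mulr_ile1 => //; rewrite ?mulr_ge0 // ltW.
  by apply: le_trans (ltW oj) _; apply: ocl_decr => //; exact: ltnW.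
have h i : (0 < i < j)%N ->
    ocl e y i.+1 U <= (1 - i%:R * sg) * (wt y U * ocl e y i U).
  move=> hij; have /andP[_ ij] := hij; have := hP (Ordinal ij).
  by rewrite /P /= hij /= -ltNge => /ltW.
have sgj i : (i < j)%N -> 0 <= 1 - i%:R * sg.
  move=> ij; apply: le_trans (mulr_ge0 (ltW rR) (ltW eta0)) _.
  by apply: sgk; exact: leq_trans (ltnW ij) jr.
have := ratio_prod e_sym e_irr y0 sgj h; apply/negP; rewrite -ltNge.
apply: le_lt_trans hj.
have pert : \prod_(i < j) (1 - i%:R * sg) <= turan_density r j + eps.
  apply: le_trans (ler_prod_perturb (a := fun i => 1 - i%:R / r%:R)
    (b := fun i => 1 - i%:R * sg) _) _.
    move=> i ij; have ir : (i <= r)%N by exact: leq_trans (ltnW ij) jr.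
    split; last by rewrite lerBlDr lerDl mulr_ge0.
      by rewrite subr_ge0 ler_pdivrMr // mul1r ler_nat.
    by rewrite lerD2l lerN2 ler_wpM2l // /sg lerBlDr lerDl ltW.
  rewrite lerD2l; apply: le_trans eta_j.
  have -> : (j ^ 2)%:R * eta = \sum_(i < j) j%:R * eta.
    by rewrite sumr_const card_ord -[RHS]mulr_natl mulrA -natrM.
  apply: ler_sum => i _; rewrite [leLHS](_ : _ = i%:R * eta).
    by rewrite ler_wpM2r ?ler_nat ?ltW // ltnW.
  by rewrite /sg; ring.
have Wj : 0 <= wt y U ^+ j <= 1 by rewrite exprn_ge0 // exprn_ile1.
case/andP: Wj => Wj0 Wj1.
have := ler_wpM2r Wj0 pert; rewrite mulrDl => /le_trans; apply.
by rewrite lerD2l ler_piMr // ltW.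
Qed.

(** Take [sg] slightly above [1 / r]. Either all the ratios of consecutive clique sums
    below [s] are at most [1 - i * sg], and then their product [p] is below the density
    of the Turan graph; or one of them is larger, and then by [ratio_run] all the later
    ones up to [r] are at least [c]. *)
Lemma clique_density_lower r s : (2 <= s)%N -> (s <= r)%N ->
  exists kap eps : R, [/\ 0 < kap, 0 < eps &
  forall (T : finType) (e : rel T) (y : T -> R) (U : {set T}),
    symmetric e -> irreflexive e -> (forall v, 0 <= y v) -> wt y U = 1 ->
    turan_density r s - eps <= ocl e y s U -> kap <= ocl e y r U].
Proof.
move=> s2 sr; have r0 : (0 < r)%N by lia.
have rR : 0 < r%:R :> R by rewrite ltr0n.
pose c : R := (2 * r%:R)^-1; pose sg : R := r%:R^-1 + c / r%:R.
have c0 : 0 < c by rewrite invr_gt0 mulr_gt0.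
have rc : r%:R * c = 2^-1 by rewrite /c invfM mulrCA mulfV ?mulr1 // lt0r_neq0.
have sgk k : (k < r)%N -> c <= 1 - k%:R * sg.
  move=> kr; rewrite -(ler_pM2l rR) mulrBr mulrCA.
  have -> : r%:R * sg = 1 + c.
    by rewrite /sg mulrDr mulfV ?lt0r_neq0 // mulrCA mulfV ?lt0r_neq0 // mulr1.
  have : k%:R + 1 <= r%:R :> R by rewrite natr1 ler_nat.
  have : k%:R * c <= r%:R * c by rewrite ler_wpM2r ?(ltW c0) ?ler_nat ?(ltnW kr).
  rewrite rc; lra.
pose p := \prod_(i < s) (1 - i%:R * sg).
have p0 : 0 < p.
  by apply: prodr_gt0 => i _; apply: lt_le_trans c0 (sgk _ _); exact: leq_trans sr.
have pt : p < turan_density r s.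
  rewrite /p /turan_density; case: s s2 sr {p p0} => [|[|s]] // _ sr.
  have split2 (F : nat -> R) :
      \prod_(i < s.+2) F i = F 0%N * (F 1%N * \prod_(i < s) F i.+2).
    by rewrite -(big_mkord xpredT) !big_nat_recl // big_mkord.
  rewrite (split2 (fun i => 1 - i%:R * sg)) (split2 (fun i => 1 - i%:R / r%:R)).
  rewrite !mul0r subr0 !mul1r.
  have ds : 0 < c / r%:R by rewrite divr_gt0.
  have sg_lt : 1 - sg < 1 - r%:R^-1 by rewrite /sg; lra.
  have sg1 : c <= 1 - sg by have := sgk 1%N; rewrite mul1r; apply; lia.
  apply: (@lt_le_trans _ _ ((1 - r%:R^-1) * \prod_(i < s) (1 - i.+2%:R * sg))).
    rewrite ltr_pM2r //; apply: prodr_gt0 => i _; apply: (lt_le_trans c0); apply: sgk.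
    by have := ltn_ord i; lia.
  apply: ler_wpM2l; first by lra.
  apply: ler_prod => i _; have hi := ltn_ord i; apply/andP; split.
    by apply: (le_trans (ltW c0)); apply: sgk; lia.
  by rewrite lerD2l lerN2 ler_wpM2l // lerDl ltW.
exists (c ^+ r * p), ((turan_density r s - p) / 2); split.
- by rewrite mulr_gt0 ?exprn_gt0.
- by rewrite divr_gt0 ?subr_gt0.
move=> T e y U e_sym e_irr y0 W1 hs.
have hs' : p < ocl e y s U by apply: lt_le_trans hs; lra.
have W1' : wt y U <= 1 by rewrite W1.
pose P i := (0 < i < s)%N && ((1 - i%:R * sg) * (wt y U * ocl e y i U) <= ocl e y i.+1 U).
have [/existsP[i /andP[/andP[i0 ij] hi]]|/existsPn hP] := boolP [exists i : 'I_s, P i].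
  have hk k : (i <= k < r)%N -> c * ocl e y k U <= ocl e y k.+1 U.
    case/andP=> ik kr; have := ratio_run e_sym e_irr y0 i0 ik hi.
    rewrite W1 mul1r; apply: le_trans; apply: ler_wpM2r; first exact: ocl_ge0.
    exact: sgk.
  have := ratio_chain y0 (ltW c0) _ hk; rewrite (leq_trans (ltnW ij)) // => /(_ isT).
  apply: le_trans; apply: ler_pM; rewrite ?exprn_ge0 ?(ltW c0) ?(ltW p0) //.
    apply: ler_wiXn2l; rewrite ?(ltW c0) ?leq_subr //.
    have : 1 * c <= r%:R * c by rewrite ler_wpM2r ?(ltW c0) // ler1n.
    rewrite rc; lra.
  by apply: le_trans (ltW hs') _; apply: ocl_decr => //; exact: ltnW.
have h i : (0 < i < s)%N ->
    ocl e y i.+1 U <= (1 - i%:R * sg) * (wt y U * ocl e y i U).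
  move=> hij; have /andP[_ ij] := hij; have := hP (Ordinal ij).
  by rewrite /P /= hij /= -ltNge => /ltW.
have sgj i : (i < s)%N -> 0 <= 1 - i%:R * sg.
  by move=> ij; apply: le_trans (ltW c0) (sgk i _); lia.
have := ratio_prod e_sym e_irr y0 sgj h.
by rewrite W1 expr1n mulr1 -/p leNgt hs'.
Qed.
End Density.

(** * Blow-ups of complete graphs *)

Section Blowup.
Variable R : realFieldType.

Lemma exprn_tangent (b c : R) m : 0 <= b -> 0 <= c ->
  c ^+ m.+1 + m.+1%:R * c ^+ m * (b - c) <= b ^+ m.+1.
Proof.
move=> b0 c0; elim: m => [|m IH]; first by rewrite !expr1 expr0; lra.
rewrite [leRHS]exprS; apply: le_trans (ler_wpM2l b0 IH).
have cm : 0 <= c ^+ m by exact: exprn_ge0.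
rewrite -subr_ge0 (_ : _ - _ = m.+1%:R * (c ^+ m * (b - c) ^+ 2)).
  by apply: mulr_ge0 => //; rewrite mulr_ge0 ?sqr_ge0.
by rewrite !exprS -(natr1 m.+1); ring.
Qed.

Lemma power_mean (I : finType) (P : pred I) (a b : I -> R) m :
  (forall i, P i -> 0 <= a i) -> (forall i, P i -> 0 <= b i) ->
  \sum_(i | P i) a i <= 1 ->
  (\sum_(i | P i) a i * b i) ^+ m.+1 <= \sum_(i | P i) a i * b i ^+ m.+1.
Proof.
move=> a0 b0 a1; set c := \sum_(i | P i) a i * b i.
have c0 : 0 <= c by apply: sumr_ge0 => i Pi; rewrite mulr_ge0 ?a0 ?b0.
have cm : 0 <= c ^+ m.+1 by exact: exprn_ge0.
apply: le_trans (_ : \sum_(i | P i)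
    a i * (c ^+ m.+1 + m.+1%:R * c ^+ m * (b i - c)) <= _); last first.
  by apply: ler_sum => i Pi; rewrite ler_wpM2l ?a0 // exprn_tangent ?b0.
set A := \sum_(i | P i) a i in a1.
have -> : \sum_(i | P i) a i * (c ^+ m.+1 + m.+1%:R * c ^+ m * (b i - c))
    = (\sum_(i | P i) a i) * (c ^+ m.+1 - m.+1%:R * c ^+ m * c)
      + (\sum_(i | P i) a i * b i) * (m.+1%:R * c ^+ m).
  by rewrite !big_distrl -big_split /=; apply: eq_bigr => i _; ring.
rewrite -/A -/c; have : 0 <= (1 - A) * (m%:R * c ^+ m.+1).
  by rewrite !mulr_ge0 ?subr_ge0.
by rewrite -natr1 !exprS; lra.
Qed.

Definition has_blowup (T : finType) (e : rel T) (U : {set T}) (k M : nat) :=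
  exists W : 'I_k -> {set T}, [/\ forall i, #|W i| = M, forall i, W i \subset U &
    forall i j, i != j -> {in W i & W j, forall u v, e u v}].

Section OneGraph.
Variables (T : finType) (e : rel T) (y : T -> R) (kap : R).
Hypotheses (e_sym : symmetric e) (e_irr : irreflexive e).
Hypotheses (y0 : forall v, 0 <= y v) (kap0 : 0 < kap).
Hypothesis (yk : forall v, y v <= kap).
Variables (U : {set T}) (k : nat).
Hypothesis U1 : wt y U <= 1.

Let d Q := wt y (U :&: cnb e Q).
(** The expected density of the [k]-cliques of [S] that remain in the common
    neighbourhood when [m] more random vertices are chosen in [U]. *)
Let Phi m S := \sum_(Q | clique_in e k S Q) k`!%:R * (\prod_(v in Q) y v) * d Q ^+ m.

Let d0 Q : 0 <= d Q. Proof. exact: wt_ge0. Qed.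
Let d1 Q : d Q <= 1. Proof. by apply: le_trans (wt_sub _ _) U1 => //; exact: subsetIl. Qed.
Let a0 (Q : {set T}) : 0 <= k`!%:R * (\prod_(v in Q) y v).
Proof. by rewrite mulr_ge0 ?prodr_ge0. Qed.

Let Phi_le1 m (S : {set T}) : S \subset U -> Phi m S <= 1.
Proof.
move=> sS; apply: le_trans (_ : ocl e y k S <= _).
  rewrite /ocl /cl big_distrr; apply: ler_sum => Q _ /=.
  by rewrite ler_piMr ?exprn_ile1.
apply: le_trans (ocl_le e_sym e_irr y0 _ _) _; rewrite exprn_ile1 ?wt_ge0 //.
exact: le_trans (wt_sub _ _) U1.
Qed.

(** Averaging over the new vertex [v]; the term [kap *+ #|X|] pays for choosing it
    outside [X]. *)
Let Phi_step m (X : {set T}) c : X \subset U -> 0 < c - kap ->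
  c + kap *+ #|X| <= Phi m.+1 (U :&: cnb e X) ->
  exists2 v, v \in U :\: X & c - kap <= Phi m (U :&: cnb e (v |: X)).
Proof.
move=> sX c0 hc; apply/exists_inP; apply: contraT => /exists_inPn h; exfalso.
have cnbU v : U :&: cnb e (v |: X) = U :&: cnb e X :&: nb e v.
  rewrite -setIA; congr (_ :&: _); apply/setP=> z; rewrite in_setI in_nb.
  apply/cnbP/andP=> [hz|[/cnbP hz vz] w /setU1P[->|/hz]//].
  by split; [apply/cnbP=> w wX; apply: hz; rewrite setU1r|apply: hz; rewrite setU11].
have up : \sum_(v in U :\: X) y v * Phi m (U :&: cnb e (v |: X)) <= c - kap.
  apply: le_trans (_ : \sum_(v in U :\: X) y v * (c - kap) <= _).
    by apply: ler_sum => v vU; rewrite ler_wpM2l // ltW // ltNge h.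
  rewrite -big_distrl /= ler_piMl ?(ltW c0) //; apply: le_trans U1.
  by apply: wt_sub => //; exact: subsetDl.
have : c <= \sum_(v in U :\: X) y v * Phi m (U :&: cnb e (v |: X)).
  have -> : \sum_(v in U :\: X) y v * Phi m (U :&: cnb e (v |: X)) =
     \sum_(Q | clique_in e k (U :&: cnb e X) Q)
       k`!%:R * (\prod_(v in Q) y v) * d Q ^+ m * wt y (U :&: cnb e Q :\: X).
    under eq_bigr => v _ do rewrite cnbU /Phi big_distrr /=.
    rewrite (exchange_big_dep (clique_in e k (U :&: cnb e X))) /=; last first.
      by move=> v Q _ /and3P[+ kQ cQ]; rewrite subsetI => /andP[sQ _]; apply/and3P.
    apply: eq_bigr => Q /and3P[sQ kQ cQ].
    rewrite /wt big_distrr /=; apply: eq_big => [v|v _]; last by rewrite mulrC.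
    rewrite !inE /clique_in kQ cQ !andbT subsetI sQ /=.
    case: (v \in X); case: (v \in U) => //=.
    by apply/subsetP/forall_inP=> hv z zQ; have := hv z zQ; rewrite in_nb e_sym.
  have hd Q : d Q - kap *+ #|X| <= wt y (U :&: cnb e Q :\: X).
    rewrite lerBlDr /d (wtI y _ X) addrC lerD2l.
    apply: le_trans (wt_card_le _ yk) _; apply: ler_wpMn2l; first exact: ltW.
    by apply: subset_leq_card; exact: subsetIr.
  apply: le_trans (_ : Phi m.+1 (U :&: cnb e X)
     - (kap *+ #|X|) * Phi m (U :&: cnb e X) <= _).
    have : kap *+ #|X| * Phi m (U :&: cnb e X) <= kap *+ #|X|.
      by rewrite ler_piMr ?Phi_le1 ?subsetIl // mulrn_wge0 // ltW.
    by lra.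
  rewrite /Phi big_distrr -sumrB /=; apply: ler_sum => Q _.
  rewrite [leLHS](_ : _ = k`!%:R * (\prod_(v in Q) y v) * d Q ^+ m *
     (d Q - kap *+ #|X|)); last by rewrite exprS; ring.
  by rewrite ler_wpM2l // mulr_ge0 ?exprn_ge0.
by move=> /le_trans /(_ up); rewrite lerBrDr gerDl leNgt kap0.
Qed.

(** Averaging over [M]-tuples of vertices: by convexity, [M] vertices have on average at
    least the density [ocl e y k.+1 U ^+ M] of [k]-cliques in their common
    neighbourhood. The error term makes the vertices distinct. *)
Lemma common_link M : (0 < M)%N ->
  kap *+ (M * M.+1) < ocl e y k.+1 U ^+ M ->
  exists X : {set T}, [/\ X \subset U, #|X| = M &
    ocl e y k.+1 U ^+ M - kap *+ (M * M.+1) <= ocl e y k (U :&: cnb e X)].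
Proof.
move=> M0 hM; set D := ocl e y k.+1 U ^+ M in hM *.
have base : D <= Phi M U.
  rewrite /D; case: M M0 {hM D} => // M _.
  have -> : ocl e y k.+1 U = \sum_(Q | clique_in e k U Q) k`!%:R * (\prod_(v in Q) y v) * d Q.
    rewrite /ocl factS mulnC natrM -mulrA -(sum_ext y e_sym e_irr) big_distrr.
    by apply: eq_bigr => Q _; rewrite /= mulrA.
  apply: power_mean => //.
  by have := Phi_le1 0 (subxx U); rewrite /Phi; under eq_bigr do rewrite expr0 mulr1.
have steps j : (j <= M)%N -> exists X : {set T}, [/\ X \subset U, #|X| = j &
    D - kap *+ (j * M.+1) <= Phi (M - j) (U :&: cnb e X)].
  elim: j => [_|j IH jM].
    exists set0; rewrite sub0set cards0 mul0n mulr0n !subr0 subn0; split=> //.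
    suff -> : U :&: cnb e set0 = U by [].
    by apply/setIidPl/subsetP=> v _; apply/cnbP=> z; rewrite inE.
  have [X [sX cX hX]] := IH (ltnW jM).
  have hc : D - kap *+ (j.+1 * M.+1) <= D - kap *+ (j * M.+1) - kap *+ #|X| - kap.
    have -> : D - kap *+ (j * M.+1) - kap *+ #|X| - kap = D - kap *+ (j * M.+1 + j.+1).
      by rewrite cX mulrnDr mulrSr; ring.
    by rewrite lerD2l lerN2 ler_wpMn2l ?(ltW kap0) // mulSn; lia.
  have c0 : 0 < D - kap *+ (j * M.+1) - kap *+ #|X| - kap.
    apply: lt_le_trans hc; rewrite subr_gt0; apply: le_lt_trans hM.
    by apply: ler_wpMn2l; [exact: ltW|rewrite leq_mul2r jM orbT].
  have [|v /setDP[vU vX] hv] := @Phi_step (M - j.+1) X _ sX c0.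
    by rewrite subrK -subSn.
  exists (v |: X); split; last exact: le_trans hv.
    by rewrite subUset sub1set vU.
  by rewrite cardsU1 vX cX add1n.
have [X [sX cX hX]] := steps M (leqnn M); exists X; split=> //.
apply: le_trans hX _; rewrite subnn /Phi /ocl /cl big_distrr /=.
by apply: ler_sum => Q _; rewrite expr0 mulr1.
Qed.
End OneGraph.

(** By induction on [k]: [common_link] provides one class of the blow-up and leaves a
    positive density of [k]-cliques in its common neighbourhood. *)
Lemma blowup_exists k M (del : R) : (0 < M)%N -> 0 < del ->
  exists2 kap, 0 < kap & forall (T : finType) (e : rel T) (y : T -> R) (U : {set T}),
    symmetric e -> irreflexive e -> (forall v, 0 <= y v) ->
    (forall v, y v <= kap) -> wt y U <= 1 -> del <= ocl e y k U ->
    has_blowup e U k M.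
Proof.
move=> M0; elim: k del => [|k IH] del del0.
  exists 1 => // T e y U _ _ _ _ _ _.
  by exists (fun _ => set0); split=> - [].
have dM : 0 < del ^+ M by exact: exprn_gt0.
have [kap1 kap1_0 {}IH] := IH (del ^+ M / 2) (divr_gt0 dM (ltr0Sn _ _)).
pose kap := Num.min kap1 (del ^+ M / 2 / (M * M.+1)%:R).
have MM : 0 < (M * M.+1)%:R :> R by rewrite ltr0n muln_gt0 M0.
have kap0 : 0 < kap by rewrite lt_min kap1_0 !divr_gt0.
exists kap => // T e y U e_sym e_irr y0 yk U1 hU.
have kM : kap *+ (M * M.+1) <= del ^+ M / 2.
  by rewrite -[leLHS]mulr_natr -ler_pdivlMr // /kap ge_min lexx orbT.
have hM : del ^+ M <= ocl e y k.+1 U ^+ M.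
  by rewrite lerXn2r // ?nnegrE ?ocl_ge0 // ltW.
have [|X [sX cX hX]] := common_link e_sym e_irr y0 kap0 yk U1 M0 (k := k); first by lra.
have [||||||W [cW sW eW]] := IH T e y (U :&: cnb e X) => //.
- by move=> v; apply: le_trans (yk v) _; rewrite /kap ge_min lexx.
- by apply: le_trans (wt_sub y0 _) U1; exact: subsetIl.
- by apply: le_trans hX; lra.
have WX j : {in X & W j, forall u v, e u v}.
  by move=> u v uX /(subsetP (sW j)) /setIP[_ /cnbP]; apply.
exists (fun i => if unlift ord0 i is Some j then W j else X); split.
- by move=> i; case: unliftP.
- by move=> i; case: unliftP => // j _; apply: subset_trans (sW j) _; exact: subsetIl.
- move=> i j; case: unliftP => [i' ->|->]; case: unliftP => [j' ->|->] //.
  + by move=> ij; apply: eW; apply: contraNneq ij => ->.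
  + by move=> _ u v uW vX; rewrite e_sym (WX i').
Qed.
End Blowup.

(** * Good cliques and greedy embeddings *)

Section GoodClique.
Variable R : realFieldType.
Variables (T : finType) (e : rel T) (y : T -> R).
Hypotheses (e_sym : symmetric e) (e_irr : irreflexive e).
Hypotheses (y0 : forall v, 0 <= y v) (y1 : wt y [set: T] <= 1).

(** The (ordered) weight of the edges inside the common neighbourhood of [Q]. *)
Definition edge_ext (Q : {set T}) :=
  \sum_(z in cnb e Q) y z * wt y (cnb e Q :&: nb e z).

Let p k := cl e y k [set: T].

Let p_ge0 k : 0 <= p k. Proof. exact: cl_ge0. Qed.

Lemma wt_le1 (U : {set T}) : wt y U <= 1.
Proof. by apply: le_trans (wt_sub y0 (subsetT U)) y1. Qed.

Lemma cl_le1 k U : cl e y k U <= 1.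
Proof.
apply: le_trans (cl_le_ocl e y0 k U) _; apply: le_trans (ocl_le e_sym e_irr y0 k U) _.
by rewrite exprn_ile1 ?wt_ge0 ?wt_le1.
Qed.

Let sum_ext1 k :
  \sum_(K | clique_in e k [set: T] K) (\prod_(v in K) y v) * wt y (cnb e K)
  = k.+1%:R * p k.+1.
Proof. by rewrite -(sum_ext y e_sym e_irr); apply: eq_bigr => K _; rewrite setTI. Qed.

Let sum_edge_ext k :
  \sum_(K | clique_in e k.+1 [set: T] K) (\prod_(v in K) y v)
     * \sum_(v in K) edge_ext (K :\ v)
  <= k.+1%:R * (k.+2%:R * p k.+2).
Proof.
rewrite -(flag_sum y e_sym e_irr k [set: T] (fun Q _ => edge_ext Q)).
apply: le_trans (_ : \sum_(Q | clique_in e k [set: T] Q)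
   (\prod_(v in Q) y v) * edge_ext Q <= _).
  apply: ler_sum => Q _; apply: ler_wpM2l; first exact: prodr_ge0.
  rewrite -big_distrl /= ler_piMl ?wt_le1 //.
  by apply: sumr_ge0 => z _; rewrite mulr_ge0 ?wt_ge0.
rewrite -(sum_ext1 k.+1) big_distrr /=.
have -> : \sum_(Q | clique_in e k [set: T] Q) (\prod_(v in Q) y v) * edge_ext Q =
  \sum_(Q | clique_in e k [set: T] Q) (\prod_(v in Q) y v) *
    \sum_(u in [set: T] :&: cnb e Q) y u * wt y (cnb e (u |: Q)).
  apply: eq_bigr => Q _; congr (_ * _); rewrite /edge_ext setTI.
  apply: eq_bigr => z _; congr (_ * wt y _); apply/setP=> w.
  rewrite in_setI in_nb; apply/andP/cnbP=> [[/cnbP wQ zw] v /setU1P[->|/wQ]//|h].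
  by split; [apply/cnbP=> v vQ; apply: h; rewrite setU1r|apply: h; rewrite setU11].
rewrite (flag_sum y e_sym e_irr k [set: T] (fun Q u => wt y (cnb e (u |: Q)))).
apply: ler_sum => K /and3P[_ /eqP cK _]; rewrite [leRHS]mulrCA ler_wpM2l ?prodr_ge0 //.
rewrite (eq_bigr (fun=> wt y (cnb e K))) => [|u uK]; last by rewrite setD1K.
by rewrite sumr_const cK mulr_natl.
Qed.

(** Averaging over the [r+1]-cliques: their extensions, and the edges extending their
    faces, are counted by the far fewer [r+2]-cliques, while the [r+1]-cliques meeting
    [A] weigh at most [wt y A]. *)
Lemma good_clique r (A : {set T}) beta : 0 < beta ->
  r.+2%:R ^+ 2 * p r.+2 < beta * (p r.+1 - wt y A) ->
  exists S : {set T}, [/\ clique_in e r.+1 [set: T] S, [disjoint S & A],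
    wt y (cnb e S) <= beta & {in S, forall v, edge_ext (S :\ v) <= beta}].
Proof.
move=> beta0 hp; pose b (S : {set T}) := wt y (cnb e S) + \sum_(v in S) edge_ext (S :\ v).
have ee0 Q : 0 <= edge_ext Q by apply: sumr_ge0 => z _; rewrite mulr_ge0 ?wt_ge0.
have [/existsP[S /and3P[cS dS bS]]|/existsPn h] :=
    boolP [exists S, [&& clique_in e r.+1 [set: T] S, [disjoint S & A] & b S <= beta]].
  exists S; split=> // [|v vS]; apply: le_trans bS; rewrite /b.
    by rewrite lerDl sumr_ge0.
  by rewrite (bigD1 v) //= addrCA lerDl addr_ge0 ?wt_ge0 ?sumr_ge0.
exfalso; move: hp; apply/negP; rewrite -leNgt.
apply: le_trans (_ : \sum_(S | clique_in e r.+1 [set: T] S) (\prod_(v in S) y v) * b S <= _);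
  last first.
  under eq_bigr do rewrite mulrDr; rewrite big_split /= sum_ext1.
  apply: le_trans (lerD (lexx _) (sum_edge_ext r)) _.
  have : 0 <= r.+2%:R * p r.+2 by rewrite mulr_ge0.
  by rewrite -(natr1 r.+1); lra.
apply: le_trans (_ : \sum_(S | clique_in e r.+1 [set: T] S && [disjoint S & A])
     (\prod_(v in S) y v) * beta <= _); last first.
  apply: le_trans (_ : \sum_(S | clique_in e r.+1 [set: T] S && [disjoint S & A])
     (\prod_(v in S) y v) * b S <= _).
    apply: ler_sum => S /andP[cS dS]; rewrite ler_wpM2l ?prodr_ge0 //.
    by have := h S; rewrite cS dS /= -ltNge => /ltW.
  apply: ler_sum_subset => [S /andP[]//|S _].
  by rewrite mulr_ge0 ?prodr_ge0 // addr_ge0 ?wt_ge0 ?sumr_ge0.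
rewrite -big_distrl mulrC ler_wpM2r ?(ltW beta0) //= lerBlDr.
rewrite /p /cl (bigID (fun S : {set T} => [disjoint S & A])) /= lerD2l.
apply: le_trans (_ : \sum_(a in A) \sum_(S | clique_in e r.+1 [set: T] S && (a \in S))
    \prod_(v in S) y v <= _).
  rewrite (exchange_big_dep (clique_in e r.+1 [set: T])) /=; last by move=> a S _ /andP[].
  rewrite big_mkcondr; apply: ler_sum => S cS; case: ifP => [|_]; last first.
    by apply: sumr_ge0 => a _; exact: prodr_ge0.
  rewrite -setI_eq0 => /set0Pn[a /setIP[aS aA]].
  rewrite [leRHS](bigD1 a) /=; last by rewrite aA cS.
  by rewrite lerDl sumr_ge0 // => a' _; exact: prodr_ge0.
apply: ler_sum => a _; rewrite (link_sum e_sym e_irr) ?inE //.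
apply: le_trans (_ : y a * cl e y r ([set: T] :&: nb e a) <= _).
  rewrite /cl big_distrr; apply: ler_sum => Q cQ /=.
  by rewrite prod_setU1 // (clique_in_notin e_irr cQ).
by rewrite ler_piMr ?cl_le1.
Qed.
End GoodClique.

Section Greedy.
Variable R : realFieldType.
Variables (A T : finType) (a : rel A) (e : rel T).
Hypotheses (a_sym : symmetric a) (a_irr : irreflexive a) (e_sym : symmetric e).

Definition emb_on (X : {set A}) (f : A -> T) :=
  {in X &, forall p q, p != q -> f p != f q /\ (a p q -> e (f p) (f q))}.

Lemma emb_onT f : emb_on [set: A] f ->
  injective f /\ forall p q, a p q -> e (f p) (f q).
Proof.
move=> h; split=> [p q pq|p q apq].
  by apply/eqP/negPn/negP=> /(h p q (in_setT _) (in_setT _))[]; rewrite pq eqxx.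
have pq : p != q by apply: contraTneq apq => ->; rewrite a_irr.
by case: (h p q (in_setT _) (in_setT _) pq) => _; apply.
Qed.

Lemma greedy_extend (Good : A -> {set T}) (X0 : {set A}) (f0 : A -> T) :
  emb_on X0 f0 ->
  (forall (X : {set A}) f z, X0 \subset X -> z \notin X -> {in X0, f =1 f0} ->
     {in X :\: X0, forall p, f p \in Good p} ->
     exists2 c, c \in Good z & {in X, forall p, c != f p /\ (a p z -> e (f p) c)}) ->
  exists f, [/\ emb_on [set: A] f, {in X0, f =1 f0} &
    {in ~: X0, forall p, f p \in Good p}].
Proof.
move=> emb0 cand.
suff ext n (X : {set A}) f : #|~: X| = n -> X0 \subset X -> emb_on X f ->
    {in X0, f =1 f0} -> {in X :\: X0, forall p, f p \in Good p} ->
    exists f', [/\ emb_on [set: A] f', {in X0, f' =1 f0} &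
    {in ~: X0, forall p, f' p \in Good p}].
  by apply: (ext _ X0 f0 erefl) => // p; rewrite setDv inE.
elim: n X f => [|n IH] X f cX sX emb eq0 good.
  move/cards0_eq/(congr1 (@setC _)): cX; rewrite setCK setC0 => XT.
  by exists f; rewrite XT in emb good; split=> // p; rewrite inE => pX; apply: good; rewrite !inE pX.
have [z] : exists z, z \in ~: X by apply/set0Pn; rewrite -card_gt0 cX.
rewrite inE => zX; have [c cG cP] := cand X f z sX zX eq0 good.
have zX0 : z \notin X0 by apply: contra zX => /(subsetP sX).
have fE p : p \in X -> (if p == z then c else f p) = f p.
  by case: eqP => // -> zX'; rewrite zX' in zX.
apply: (IH (z |: X) (fun p => if p == z then c else f p)).
- by apply: succn_inj; rewrite -cX (cardsD1 z (~: X)) inE zX setCU setIC -setDE.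
- by apply: subset_trans sX _; exact: subsetUr.
- move=> p q /setU1P[->|pX] /setU1P[->|qX]; rewrite ?eqxx ?fE // => pq.
  + have [cq h] := cP q qX; split=> //.
    by rewrite a_sym e_sym.
  + by have [cq h] := cP p pX; rewrite eq_sym.
  + exact: emb.
- by move=> p pX; rewrite fE ?eq0 // (subsetP sX).
- move=> p; rewrite !inE => /andP[pX0 /orP[/eqP->|pX]]; first by rewrite eqxx.
  by rewrite fE // good // !inE pX0.
Qed.

Lemma wt_bigcup (y : T -> R) (I : finType) (P : pred I) (B : I -> {set T}) :
  (forall v, 0 <= y v) -> wt y (\bigcup_(i | P i) B i) <= \sum_(i | P i) wt y (B i).
Proof.
move=> y0; elim/big_rec2: _ => [|i s U _ IH]; first by rewrite /wt big_set0.
by apply: le_trans (wtU y0 _ _) _; rewrite lerD2l.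
Qed.

(** The vertices outside [X0] are placed one at a time. Those already placed exclude
    from [U (g z)] at most [eta] for each neighbour of [z], and [Z] and the used
    vertices at most [kap] each; the weight of [U (g z)] exceeds the total. *)
Lemma greedy_embed (y : T -> R) (kap eta : R) k (g : A -> 'I_k) (U : 'I_k -> {set T})
    (Z : {set T}) (X0 : {set A}) (f0 : A -> T) :
  (forall v, 0 <= y v) -> (forall v, y v <= kap) -> 0 <= eta ->
  emb_on X0 f0 ->
  {in ~: X0 &, forall p q, a p q -> g p != g q} ->
  (forall i j u, i != j -> u \in U i -> wt y (U j :\: nb e u) <= eta) ->
  {in X0 & ~: X0, forall p z, a p z -> wt y (U (g z) :\: nb e (f0 p)) <= eta} ->
  (forall j, eta *+ #|A| + kap *+ (#|Z| + #|A|) < wt y (U j)) ->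
  exists f, [/\ injective f, forall p q, a p q -> e (f p) (f q), {in X0, f =1 f0} &
    {in ~: X0, forall p, f p \in U (g p) :\: Z}].
Proof.
move=> y0 yk eta0 emb0 col missU miss0 big.
have [|f [/emb_onT[finj fhom] f_0 fU]] := @greedy_extend (fun p => U (g p) :\: Z) X0 f0 emb0;
  last by exists f.
move=> X f z sX zX f_0 good.
have zX0 : z \notin X0 by apply: contra zX => /(subsetP sX).
pose B := \bigcup_(p in X | a p z) (U (g z) :\: nb e (f p)).
have [sub|/subsetPn[c cU]] := boolP (U (g z) \subset (Z :|: f @: X) :|: B); last first.
  rewrite 2!in_setU !negb_or => /andP[/andP[cZ cX] cB].
  exists c; first by rewrite in_setD cZ.
  move=> p pX; split; first by apply: contraNneq cX => ->; exact: imset_f.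
  move=> apz; apply: contraNT cB => nec.
  by apply/bigcupP; exists p; rewrite ?pX // in_setD in_nb nec.
exfalso.
have := wt_sub y0 sub; apply/negP; rewrite -ltNge.
apply: le_lt_trans (big (g z)); apply: le_trans (wtU y0 _ _) _; rewrite addrC.
have kap0 : 0 <= kap by apply: le_trans (y0 (f z)) (yk _).
apply: lerD; last first.
  apply: le_trans (wt_card_le _ yk) _; apply: ler_wpMn2l => //.
  apply: leq_trans (leq_card_setU _ _) _; rewrite leq_add2l.
  by apply: leq_trans (leq_imset_card _ _) (max_card _).
apply: le_trans (wt_bigcup _ _ y0) _.
apply: le_trans (_ : \sum_(p in X | a p z) eta <= _).
  apply: ler_sum => p /andP[pX apz]; case: (boolP (p \in X0)) => pX0.
    by rewrite f_0 // miss0 // inE.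
  have /setDP[fU _] : f p \in U (g p) :\: Z by apply: good; rewrite inE pX0.
  apply: missU fU; by apply: col => //; rewrite inE.
by rewrite sumr_const; apply: ler_wpMn2l => //; exact: max_card.
Qed.
End Greedy.

(** * The maximum of the clique quotient *)

Section SumMax.
Import numFieldNormedType.Exports.
Local Open Scope classical_set_scope.
Variables (R : realType) (T : finType) (e : rel T) (m : nat).
Local Notation s := m.+1.
Hypothesis e_irr : irreflexive e.
Hypothesis e_sym : symmetric e.
Implicit Types x z : T -> R.

Definition psum k x := \sum_v x v ^+ k.

Lemma psum_ge0 k x : (forall v, 0 <= x v) -> 0 <= psum k x.
Proof. by move=> x0; apply: sumr_ge0 => v _; exact: exprn_ge0. Qed.

Lemma psum_gt0 k x u : (forall v, 0 <= x v) -> 0 < x u -> 0 < psum k x.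
Proof.
move=> x0 xu; rewrite /psum (bigD1 u) //=; apply: ltr_pwDl; first exact: exprn_gt0.
by apply: sumr_ge0 => v _; exact: exprn_ge0.
Qed.

Lemma continuous_at_big (U : topologicalType) (I : Type) (op : R -> R -> R) idx
   (r : seq I) (P : pred I) (F : I -> U -> R) :
  continuous (fun w : R * R => op w.1 w.2) ->
  (forall i, continuous (F i)) -> continuous (fun w => \big[op/idx]_(i <- r | P i) F i w).
Proof. by move=> cop cF; apply: continuous_big. Qed.

(** The quotient of the clique sum by the power sum is homogeneous of degree 0, so
    its maximum over the simplex is its maximum over all nonnegative vectors. *)
Lemma clique_quotient_max : (0 < #|T|)%N ->
  exists2 x : T -> R, (forall v, 0 <= x v) /\ wt x [set: T]%SET = 1 &
    forall z, (forall v, 0 <= z v) ->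
      cl e z s [set: T]%SET * psum s x <= cl e x s [set: T]%SET * psum s z.
Proof.
move=> T0; pose n := #|T|.
pose V (M : 'rV[R]_n) (v : T) := M ord0 (enum_rank v).
have cV v : continuous (V ^~ v) by exact: coord_continuous.
pose A := [set M : 'rV[R]_n | forall i, `[0, 1]%classic (M ord0 i)] `&`
          [set M : 'rV[R]_n | wt (V M) [set: T]%SET = 1].
have cwt : continuous (fun M => wt (V M) [set: T]%SET).
  by apply: continuous_at_big => //; exact: add_continuous.
have cA : compact A.
  apply: compact_closedI.
    by apply: (@rV_compact R n (fun=> `[0 : R, 1]%classic)) => _; exact: segment_compact.
  apply: (@closed_comp _ _ (fun M => wt (V M) [set: T]%SET) [set 1]); last first.
    exact: closed_eq.
  by move=> M _; exact: cwt.
have AP M : A M -> (forall v, 0 <= V M v) /\ wt (V M) [set: T]%SET = 1.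
  by case=> h1 h2; split=> // v; have := h1 (enum_rank v); rewrite /= in_itv /= => /andP[].
have D0 M : A M -> 0 < psum s (V M).
  move=> /AP[M0 M1]; have [u Mu] : exists u, 0 < V M u.
    apply/existsP; apply: contraT => /existsPn h.
    have : wt (V M) [set: T]%SET <= 0 by apply: sumr_le0 => v _; rewrite leNgt h.
    by rewrite M1 ler10.
  exact: psum_gt0 Mu.
pose vec z : 'rV[R]_n := \row_i z (enum_val i).
have Vvec z : V (vec z) = z by apply/funext=> v; rewrite /V /vec mxE enum_rankK.
have vecA z : (forall v, 0 <= z v) -> wt z [set: T]%SET = 1 -> A (vec z).
  move=> z0 z1; split; last by rewrite /= Vvec.
  move=> i /=; rewrite mxE in_itv /= z0 -z1 /wt (bigD1 (enum_val i)) ?inE //=.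
  by rewrite lerDl sumr_ge0.
have [t0] : exists t0 : T, t0 \in T by apply/card_gt0P.
move=> _.
have A0 : A !=set0.
  exists (vec (fun v => (v == t0)%:R)); apply: vecA => [v //|].
  by rewrite /wt (bigD1 t0) ?inE //= eqxx big1 ?addr0 // => v /andP[_ /negbTE ->].
pose f M := cl e (V M) s [set: T]%SET / psum s (V M).
have cf : {within A, continuous f}.
  have cN : continuous (fun M => cl e (V M) s [set: T]%SET).
    apply: continuous_at_big; first exact: add_continuous.
    by move=> S; apply: continuous_at_big => //; exact: mul_continuous.
  have cD : continuous (fun M => psum s (V M)).
    apply: continuous_at_big; first exact: add_continuous.
    move=> v N; apply: (@continuous_comp _ _ _ (V ^~ v) (fun t => t ^+ s)); first exact: cV.
    exact: realfun.exprn_continuous.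
  apply: continuous_in_subspaceT => M /set_mem AM.
  exact: (cvgM (cN M) (cvgV (lt0r_neq0 (D0 M AM)) (cD M))).
have [c /set_mem cinA cmax] := compact_EVT_max A0 cA cf.
exists (V c); first exact: AP.
move=> z z0; have [u zu|z_eq0] := pickP [pred u | 0 < z u]; last first.
  have zE v : z v = 0 by apply/le_anti; rewrite z0 leNgt; have /= -> := z_eq0 v.
  have -> : cl e z s [set: T]%SET = 0.
    rewrite /cl big1 // => S /and3P[_ /eqP cS _].
    have [w wS] : exists w, w \in S by apply/set0Pn; rewrite -card_gt0 cS.
    by rewrite (bigD1 w) //= zE mul0r.
  by rewrite mul0r mulr_ge0 ?cl_ge0 ?psum_ge0 //; have [] := AP _ cinA.
pose W := wt z [set: T]%SET.
have W0 : 0 < W.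
  by rewrite /W /wt (bigD1 u) ?inE //=; apply: ltr_pwDl => //; apply: sumr_ge0.
pose z' v := z v / W.
have z'0 v : 0 <= z' v by rewrite divr_ge0 // ltW.
have z'1 : wt z' [set: T]%SET = 1 by rewrite /wt -big_distrl /= divff // gt_eqF.
have clz : cl e z' s [set: T]%SET = cl e z s [set: T]%SET / W ^+ s.
  rewrite /cl big_distrl; apply: eq_bigr => S /and3P[_ /eqP cS _].
  by rewrite /z' prodf_div prodr_const cS.
have psz : psum s z' = psum s z / W ^+ s.
  by rewrite /psum big_distrl; apply: eq_bigr => v _; rewrite /z' expr_div_n.
have := cmax _ (mem_set (vecA _ z'0 z'1)).
rewrite /f Vvec ler_pdivrMr; last by rewrite psz divr_gt0 ?exprn_gt0 // (psum_gt0 _ z0 zu).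
rewrite clz psz mulrA ler_pM2r ?invr_gt0 ?exprn_gt0 // mulrAC ler_pdivlMr //.
exact: D0.
Qed.

Lemma cl_eq_in k (U : {set T}) x z : {in U, x =1 z} -> cl e x k U = cl e z k U.
Proof.
move=> xz; apply: eq_bigr => S /and3P[/fintype.subsetP sS _ _].
by apply: eq_bigr => v vS; rewrite xz ?sS.
Qed.

Lemma le_of_right (a c b : R) k :
  (forall h, 0 < h -> a <= c * (b + h) ^+ k) -> a <= c * b ^+ k.
Proof.
move=> h.
have cont : continuous (fun t : R => c * (b + t) ^+ k).
  move=> t; apply: cvgM; first exact: cvg_cst.
  apply: (@continuous_comp _ _ _ (fun t => b + t) (fun u => u ^+ k)).
    by apply: cvgD; [exact: cvg_cst|exact: cvg_id].
  exact: realfun.exprn_continuous.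
have := cvg_at_right_filter (cont 0); rewrite addr0 => cvg0.
apply: (cvgr_to_ge cvg0); near=> t; apply: h; near: t; exact: nbhs_right_gt.
Unshelve. all: by end_near. Qed.

Lemma le_of_left (a c b : R) k : 0 < b ->
  (forall h, 0 < h -> h < b -> c * (b - h) ^+ k <= a) -> c * b ^+ k <= a.
Proof.
move=> b0 h.
have cont : continuous (fun t : R => c * (b - t) ^+ k).
  move=> t; apply: cvgM; first exact: cvg_cst.
  apply: (@continuous_comp _ _ _ (fun t => b - t) (fun u => u ^+ k)).
    by apply: cvgB; [exact: cvg_cst|exact: cvg_id].
  exact: realfun.exprn_continuous.
have := cvg_at_right_filter (cont 0); rewrite subr0 => cvg0.
apply: (cvgr_to_le cvg0); near=> t; apply: h; near: t; first exact: nbhs_right_gt.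
exact: nbhs_right_lt.
Unshelve. all: by end_near. Qed.

Definition bump x v (h : R) w := if w == v then x v + h else x w.

Lemma cl_bump x v h :
  cl e (bump x v h) s [set: T]%SET = cl e x s [set: T]%SET + h * cl e x m (nb e v).
Proof.
have away k (U : {set T}) : v \notin U -> cl e (bump x v h) k U = cl e x k U.
  move=> vU; apply: cl_eq_in => w wU; rewrite /bump; case: eqP => // wv.
  by rewrite wv (negbTE vU) in wU.
rewrite !(clE_rem _ e_sym e_irr _ (finset.in_setT v)) finset.setTI !away ?inE ?eqxx ?e_irr //.
by rewrite {1}/bump eqxx; ring.
Qed.

Lemma psum_bump x v h k : psum k (bump x v h) = psum k x + ((x v + h) ^+ k - x v ^+ k).
Proof.
rewrite /psum !(bigD1 v (P := predT)) //= {1}/bump eqxx.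
under eq_bigr => w /negbTE wv do rewrite /bump wv.
by ring.
Qed.

(** First-order optimality at the vertex [v]. Increasing [x v] by a small [h] gives one
    inequality and, when [x v] is positive, decreasing it gives the other; bounding
    differences of powers by tangents leaves only the limit of a power as [h] tends to
    0. *)
Lemma optimal_eigen (M : R) x : (0 < m)%N -> (forall v, 0 <= x v) ->
  (forall z, (forall v, 0 <= z v) -> s%:R * cl e z s [set: T]%SET <= M * psum s z) ->
  s%:R * cl e x s [set: T]%SET = M * psum s x ->
  0 <= M -> forall v, cl e x m (nb e v) = M * x v ^+ m.
Proof.
move=> m0 x0 ub eqx M0 v; set D := cl e x m (nb e v); set b := x v.
have b0 : 0 <= b by exact: x0.
have key h : 0 <= b + h -> s%:R * (h * D) <= M * ((b + h) ^+ s - b ^+ s).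
  move=> bh; have := ub (bump x v h); rewrite cl_bump psum_bump -/b -/D !mulrDr eqx.
  rewrite lerD2l; apply=> w; rewrite /bump; case: eqP => // _; exact: bh.
have sR : 0 < s%:R :> R by [].
apply/le_anti/andP; split.
  apply: le_of_right => h h0; have bh : 0 <= b + h by rewrite addr_ge0 // ltW.
  rewrite -(ler_pM2l (mulr_gt0 sR h0)) -mulrA; apply: le_trans (key h bh) _.
  have := ler_wpM2l M0 (exprn_tangent m b0 bh); rewrite !exprS; lra.
have [b_gt|b_le] := ltP 0 b; last first.
  have -> : b = 0 by apply/le_anti; rewrite b_le.
  by rewrite expr0n gtn_eqF // mulr0 cl_ge0.
apply: le_of_left => // h h0 hb; have bh : 0 <= b - h by rewrite subr_ge0 ltW.
rewrite -(ler_pM2l (mulr_gt0 sR h0)); have := key (- h) bh.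
have := ler_wpM2l M0 (exprn_tangent m b0 bh); rewrite !exprS; lra.
Qed.

End SumMax.

(** * The spectral radius as a maximum *)

Section TensorLink.
Local Open Scope complex_scope.
Variables (C : numFieldType) (m : nat) (G : sgraph).

Lemma mem_cliques k (S : {set G}) :
  (S \in cliques k G) = clique_in (@sedge G) k [set: G] S.
Proof. by rewrite inE /clique_in finset.subsetT. Qed.

Lemma clique_tuple (i : G) (w : m.-tuple G) :
  ([set j in i :: w] \in cliques m.+1 G) =
  uniq w && clique_in (@sedge G) m (nb (@sedge G) i) [set j in w].
Proof.
have wE : [set j in i :: w] = i |: [set j in w] by apply/setP=> j; rewrite !inE.
rewrite mem_cliques wE.
have cw : (#|[set j in w]| == m) = uniq w.
  rewrite cardsE -[X in _ == X](size_tuple w); apply/eqP/idP=> [h|/card_uniqP//].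
  exact/card_uniqP.
case: (boolP (i \in [set j in w])) => iw; last first.
  rewrite (clique_in_setU1 (@sedge_sym G)) // inE /= finset.setTI.
  case: (boolP (uniq w)) => // uw; rewrite /clique_in cw (negbTE uw) andbF //.
rewrite (setUidPr _) ?sub1set //; apply/idP/idP.
  case/and3P=> _ /eqP cS _; exfalso; have := card_size w.
  by rewrite size_tuple -cardsE cS ltnn.
by case/andP=> _ /and3P[/fintype.subsetP/(_ i iw)]; rewrite in_nb sedge_irrefl.
Qed.

(** Each clique is listed by [m`!] tuples, which cancels the normalisation of the
    tensor. *)
Lemma tensor_applyE (x : G -> C) (i : G) :
  tensor_apply (@clique_tensor C m.+1 G) x i =
  \sum_(Q | clique_in (@sedge G) m (nb (@sedge G) i) Q) \prod_(v in Q) x v.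
Proof.
rewrite /tensor_apply /clique_tensor.
under eq_bigr => w _ do rewrite clique_tuple.
rewrite (bigID (fun w : m.-tuple G =>
  uniq w && clique_in (@sedge G) m (nb (@sedge G) i) [set j in w])) /=.
rewrite [X in _ + X]big1 ?addr0 => [|w /negbTE ->]; last by rewrite mul0r.
rewrite (partition_big (fun w : m.-tuple G => [set j in w])
  (clique_in (@sedge G) m (nb (@sedge G) i))) /=; last by move=> w /andP[].
apply: eq_bigr => Q cQ.
transitivity (\sum_(w : m.-tuple G | all (mem Q) w && uniq w)
   (m`!%:R^-1 * \prod_(v in Q) x v) : C).
  apply: eq_big => [w|w /andP[/andP[uw ->] /eqP <-]].
    apply/andP/andP=> [[/andP[uw _] /eqP <-]|[/allP wQ uw]].
      by split=> //; apply/allP=> j; rewrite /= inE.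
    have -> : [set j in w] = Q.
      apply/eqP; rewrite eqEcard; apply/andP; split.
        by apply/fintype.subsetP=> j; rewrite inE => /wQ.
      case/and3P: cQ => _ /eqP -> _.
      by rewrite cardsE (card_uniqP uw) size_tuple.
    by rewrite uw cQ.
  rewrite uw /=; congr (_ * _); rewrite big_uniq //=.
  by apply: eq_bigl => j; rewrite inE.
rewrite sumr_const -[X in _ *+ X]cardsE.
have -> : #|[set w : m.-tuple G | all (mem Q) w && uniq w]| = m`!.
  by rewrite card_uniq_tuples; case/and3P: cQ => _ /eqP -> _; rewrite ffactnn.
rewrite -[LHS]mulr_natl mulrA mulfV ?mul1r // pnatr_eq0 -lt0n; exact: fact_gt0.
Qed.
End TensorLink.

Section Radius.
Local Open Scope complex_scope.
Variables (R : realType) (m : nat) (G : sgraph).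
Local Notation s := m.+1.
Local Notation e := (@sedge G).
Local Notation rho := (clique_spectral_radius R s G).
Hypotheses (m0 : (0 < m)%N) (G0 : (0 < #|G|)%N).

(** The moduli [a] of an eigenvector satisfy the eigenvalue equations as inequalities;
    multiplying them by [a v] and summing compares the eigenvalue with the quotient at
    [a]. *)
Lemma eigenvalue_le (M : R) (l : R[i]) :
  (forall z : G -> R, (forall v, 0 <= z v) -> s%:R * cl e z s [set: G] <= M * psum s z) ->
  tensor_eigenvalue (@clique_tensor R[i] s G) l -> complex.Re `|l| <= M.
Proof.
move=> ub [x [[i xi] eig]].
pose a v := complex.Re `|x v|.
have aE v : `|x v| = (a v)%:C by rewrite /a normc_def.
pose L := complex.Re `|l|; have lE : `|l| = L%:C by rewrite /L normc_def.
have a0 v : 0 <= a v by rewrite -(lecR 0) -aE normr_ge0.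
have ai : 0 < a i by rewrite -ltcR -aE normr_gt0.
have step v : L * a v ^+ m <= cl e a m (nb e v).
  rewrite -lecR rmorphM rmorphXn /= -lE -aE -normrX -normrM -eig tensor_applyE.
  apply: le_trans (ler_norm_sum _ _ _) _; rewrite /cl rmorph_sum.
  apply: ler_sum => Q _; rewrite normr_prod rmorph_prod /=.
  by rewrite (eq_bigr (fun v => (a v)%:C)).
have := ub a a0; rewrite (clSE _ (@sedge_sym G) (@sedge_irrefl G)) => h.
have : L * psum s a <= M * psum s a.
  apply: le_trans h; rewrite /psum big_distrr /=.
  rewrite [leRHS](eq_bigl predT) => [|v]; last by rewrite inE.
  by apply: ler_sum => v _; rewrite exprS mulrCA ler_wpM2l // finset.setTI.
by rewrite ler_pM2r // (psum_gt0 s a0 ai).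
Qed.

(** The maximum [M] of the clique quotient is an eigenvalue by [optimal_eigen], and no
    eigenvalue has a larger modulus by [eigenvalue_le]. *)
Lemma clique_radius_exists : exists y : G -> R,
  [/\ forall v, 0 <= y v, wt y [set: G] = 1,
      0 <= rho,
      forall z : G -> R, (forall v, 0 <= z v) ->
        s%:R * cl e z s [set: G] <= rho * psum s z &
      s%:R * cl e y s [set: G] = rho * psum s y].
Proof.
have [y [y0 y1] ymax] := clique_quotient_max R e m G0.
have [u yu] : exists u, 0 < y u.
  apply/existsP; apply: contraT => /existsPn h.
  have : wt y [set: G] <= 0 by apply: sumr_le0 => v _; rewrite leNgt h.
  by rewrite y1 ler10.
have p0 : 0 < psum s y := psum_gt0 s y0 yu.
pose M := s%:R * cl e y s [set: G] / psum s y.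
have M0 : 0 <= M by rewrite divr_ge0 ?mulr_ge0 ?cl_ge0 // ltW.
have eqy : s%:R * cl e y s [set: G] = M * psum s y by rewrite divfK // gt_eqF.
have ub z : (forall v, 0 <= z v) -> s%:R * cl e z s [set: G] <= M * psum s z.
  move=> z0; rewrite mulrAC ler_pdivlMr // -!mulrA ler_wpM2l //; exact: ymax.
have eig := optimal_eigen (@sedge_irrefl G) (@sedge_sym G) m0 y0 ub eqy M0.
suff rE : rho = M by exists y; rewrite rE.
have MC : complex.Re `|M%:C| = M by rewrite normc_def /= expr0n addr0 sqrtr_sqr ger0_norm.
rewrite -[RHS]MC; apply: spectral_radius_max.
  exists (fun v => (y v)%:C); split.
    by exists u; rewrite -(rmorph0 (real_complex R)) (inj_eq (@complexI _)) gt_eqF.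
  move=> v; rewrite tensor_applyE -rmorphXn -rmorphM -eig /cl rmorph_sum.
  by apply: eq_bigr => Q _; rewrite rmorph_prod.
by move=> l' /(eigenvalue_le ub); rewrite MC.
Qed.

Lemma clique_radius_ge0 : 0 <= rho.
Proof. by have [y []] := clique_radius_exists. Qed.

Lemma clique_radius_ub (z : G -> R) : (forall v, 0 <= z v) ->
  s%:R * cl e z s [set: G] <= rho * psum s z.
Proof. by have [y [_ _ _ h _]] := clique_radius_exists; exact: h. Qed.

Lemma clique_radius_eigen (x : G -> R) : (forall v, 0 <= x v) ->
  s%:R * cl e x s [set: G] = rho * psum s x ->
  forall v, cl e x m (nb e v) = rho * x v ^+ m.
Proof.
move=> x0 eqx; exact: (optimal_eigen (@sedge_irrefl G) (@sedge_sym G) m0 x0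
  clique_radius_ub eqx clique_radius_ge0).
Qed.

End Radius.

(** * Perron weights and modified graphs *)

Section Transfer.
Variables (R : realFieldType) (T T' : finType) (e : rel T) (e' : rel T').
Variables (f : T -> T') (z : T' -> R).
Hypotheses (f_inj : injective f) (z0 : forall v, 0 <= z v).

Lemma is_clique_imset (S : {set T}) : (forall u v, e u v -> e' (f u) (f v)) ->
  is_clique e S -> is_clique e' (f @: S).
Proof.
move=> hom /is_cliqueP cS; apply/is_cliqueP=> _ _ /imsetP[u uS ->] /imsetP[v vS ->] uv.
by apply/hom/cS => //; apply: contraNneq uv => ->.
Qed.

Let cl_imset k U : cl e (z \o f) k U =
    \sum_(S in [set f @: (S : {set T}) | S in [set S | clique_in e k U S]])
       \prod_(v in S) z v.
Proof.
rewrite big_imset /=; last by move=> S S' _ _; exact: imset_inj.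
rewrite [RHS](eq_bigl (clique_in e k U)) => [|S]; last by rewrite inE.
by apply: eq_bigr => S _; rewrite big_imset //= => u v _ _; exact: f_inj.
Qed.

Lemma cl_hom k U : (forall u v, e u v -> e' (f u) (f v)) ->
  cl e (z \o f) k U <= cl e' z k (f @: U).
Proof.
move=> hom; rewrite cl_imset /cl.
apply: ler_sum_subset => [_ /imsetP[S +] ->|S _]; last exact: prod_ge0.
rewrite inE => /and3P[sS /eqP kS cS]; apply/and3P; split.
- exact: imsetS.
- by rewrite card_imset // kS.
- exact: is_clique_imset.
Qed.

Lemma cl_iso k U : (forall u v, e u v = e' (f u) (f v)) ->
  cl e (z \o f) k U = cl e' z k (f @: U).
Proof.
move=> iso; apply/le_anti/andP; split; first by apply: cl_hom => u v; rewrite iso.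
rewrite cl_imset; apply: ler_sum_subset => [S' /and3P[sS /eqP kS cS]|S _]; last exact: prod_ge0.
apply/imsetP; exists (f @^-1: S'); last first.
  apply/setP=> w; apply/idP/imsetP=> [wS|[v]]; last by rewrite inE => vS ->.
  have /imsetP[v _ wE] := subsetP sS _ wS.
  by exists v => //; rewrite inE -wE.
have fE : S' = f @: (f @^-1: S').
  apply/setP=> w; apply/idP/imsetP=> [wS|[v]]; last by rewrite inE => vS ->.
  have /imsetP[v _ wE] := subsetP sS _ wS.
  by exists v => //; rewrite inE -wE.
rewrite inE; apply/and3P; split.
- apply/subsetP=> v; rewrite inE => /(subsetP sS) /imsetP[u uU /f_inj ->].
  exact: uU.
- by rewrite -(card_imset _ f_inj) -fE kS.
- apply/is_cliqueP=> u v; rewrite !inE => uS vS uv; rewrite iso.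
  by move/is_cliqueP: cS; apply; rewrite // (inj_eq f_inj).
Qed.
End Transfer.

Section GraphOps.
Variables (G : sgraph) (v : G).

Definition del_vertex_rel : rel {u : G | u != v} := fun a b => sedge (val a) (val b).
Lemma del_vertex_sym : symmetric del_vertex_rel.
Proof. by move=> a b; exact: sedge_sym. Qed.
Lemma del_vertex_irr : irreflexive del_vertex_rel.
Proof. by move=> a; exact: sedge_irrefl. Qed.
Definition del_vertex : sgraph := SGraph del_vertex_sym del_vertex_irr.

Lemma card_del_vertex : #|del_vertex| = #|G|.-1.
Proof. by rewrite /= card_sig -(cardC1 v); apply: eq_card => u; rewrite !inE. Qed.

Definition clone_rel : rel (option G) := fun a b =>
  match a, b with
  | Some a, Some b => sedge a b
  | None, Some b => sedge v b
  | Some a, None => sedge v a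
  | None, None => false
  end.
Lemma clone_sym : symmetric clone_rel.
Proof. by move=> [a|] [b|] //=; exact: sedge_sym. Qed.
Lemma clone_irr : irreflexive clone_rel.
Proof. by move=> [a|] //=; exact: sedge_irrefl. Qed.
Definition clone : sgraph := SGraph clone_sym clone_irr.

Lemma card_clone : #|clone| = #|G|.+1. Proof. by rewrite /= card_option. Qed.
End GraphOps.

Section RadiusOps.
Variables (R : realType) (m : nat).
Hypothesis m0 : (0 < m)%N.
Local Notation s := m.+1.
Local Notation rho G := (clique_spectral_radius R s G).

Definition perron (G : sgraph) (y : G -> R) :=
  [/\ forall v, 0 <= y v, wt y [set: G] = 1,
      s%:R * cl (@sedge G) y s [set: G] = rho G * psum s y &
      forall v, cl (@sedge G) y m (nb (@sedge G) v) = rho G * y v ^+ m].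

Lemma perron_exists (G : sgraph) : (0 < #|G|)%N -> exists y, @perron G y.
Proof.
move=> G0; have [y [y0 y1 _ _ eqy]] := clique_radius_exists R m0 G0.
by exists y; split=> // v; exact: clique_radius_eigen.
Qed.

(** The power mean inequality over the uniform distribution on the vertices. *)
Lemma perron_psum (G : sgraph) y : @perron G y ->
  1 <= #|G|%:R ^+ m * psum s y /\ 0 < psum s y.
Proof.
case=> y0 y1 _ _.
have n0 : 0 < #|G|%:R :> R.
  rewrite ltr0n lt0n; apply/eqP=> /card0_eq h; move: y1; rewrite /wt big1 ?(eqP (oner_neq0 R)) //.
    by move/esym/eqP; rewrite oner_eq0.
  by move=> v _; have := h v; rewrite inE.
have inv0 : 0 <= #|G|%:R^-1 :> R by rewrite invr_ge0.
have sum1 : \sum_(i : G) #|G|%:R^-1 <= 1 :> R.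
  by rewrite sumr_const -[leLHS]mulr_natl mulfV ?gt_eqF.
have h := power_mean (P := predT) m (fun _ _ => inv0) (fun i _ => y0 i) sum1.
have ysum : \sum_(i : G) y i = 1 by rewrite -y1; apply: eq_bigl => v; rewrite inE.
rewrite -!mulr_sumr ysum mulr1 -/(psum s y) in h.
suff h1 : 1 <= #|G|%:R ^+ m * psum s y.
  by split=> //; rewrite -(pmulr_rgt0 _ (exprn_gt0 m n0)); apply: lt_le_trans h1.
have := ler_wpM2l (ltW (exprn_gt0 s n0)) h.
by rewrite -exprMn mulfV ?gt_eqF // expr1n exprSr mulrA mulfK ?gt_eqF.
Qed.

Lemma radius_hom (G H : sgraph) (f : G -> H) : (0 < #|G|)%N -> injective f ->
  (forall u v, sedge u v -> sedge (f u) (f v)) -> rho G <= rho H.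
Proof.
move=> G0 f_inj hom; have [y py] := perron_exists G0.
have [_ p0] := perron_psum py; case: py => y0 y1 eqy _.
have H0 : (0 < #|H|)%N by apply: leq_trans G0 _; rewrite -(card_imset predT f_inj) max_card.
pose z w := \sum_(v | f v == w) y v.
have zf v : z (f v) = y v.
  by rewrite /z (big_pred1 v) // => u /=; rewrite (inj_eq f_inj).
have z0 w : 0 <= z w by exact: sumr_ge0.
have psz : psum s z = psum s y.
  rewrite /psum (bigID (mem (f @: [set: G]))) /= [X in _ + X]big1 ?addr0.
    rewrite big_imset /=; last by move=> u v _ _; exact: f_inj.
    by apply: eq_big => [v|v _]; rewrite ?inE ?zf.
  move=> w wf; rewrite /z big_pred0 ?expr0n // => v; apply: contraNF wf => /eqP <-.
  by apply: imset_f; rewrite inE.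
rewrite -(ler_pM2r p0) -eqy.
have := clique_radius_ub m0 H0 z0; rewrite psz; apply: le_trans.
rewrite ler_wpM2l //; apply: le_trans (cl_sub _ z0 _ (subsetT (f @: [set: G]))).
apply: le_trans (cl_hom f_inj z0 _ _ hom); rewrite le_eqVlt; apply/orP; left; apply/eqP.
by apply: cl_eq_in => v _ /=; rewrite zf.
Qed.

Lemma radius_iso (G H : sgraph) : (0 < #|G|)%N -> sg_iso G H -> rho G = rho H.
Proof.
move=> G0 [f [g fg gf] iso]; have H0 : (0 < #|H|)%N.
  by have /card_gt0P[v _] := G0; apply/card_gt0P; exists (f v).
apply/le_anti/andP; split; first by apply: (@radius_hom _ _ f); [|exact: can_inj fg|move=> u v; rewrite iso].
by apply: (@radius_hom _ _ g) => //; [exact: can_inj gf|move=> u v; rewrite -iso !gf].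
Qed.

(** The restriction of [y] is tested on [del_vertex v]; by the eigenvalue equation, the
    lost cliques, those through [v], weigh [rho G * y v ^+ s]. *)
Lemma radius_delete (G : sgraph) y (v : G) : (1 < #|G|)%N -> perron y ->
  rho G * (psum s y - s%:R * y v ^+ s) <=
  rho (del_vertex v) * (psum s y - y v ^+ s).
Proof.
move=> G1 py; have [y0 y1 eqy eigy] := py.
have D0 : (0 < #|del_vertex v|)%N by rewrite card_del_vertex; lia.
have z0 (a : del_vertex v) : 0 <= (y \o val) a by exact: y0.
have imT : [set val a | a in [set: del_vertex v]] = [set: G] :\ v.
  apply/setP=> u; rewrite !inE andbT; apply/imsetP/idP=> [[a _ ->]|uv]; first exact: (valP a).
  by exists (exist _ u uv).
have := clique_radius_ub m0 D0 z0.
rewrite (cl_iso (e' := @sedge G) val_inj y0 _ _ (fun _ _ => erefl)) imT.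
have -> : psum s (y \o val : del_vertex v -> R) = psum s y - y v ^+ s.
  rewrite /psum [in RHS](bigD1 v) //= [RHS]addrC addKr.
  rewrite [RHS](eq_bigl (mem ([set: G] :\ v))) => [|u]; last by rewrite !inE andbT.
  rewrite -imT big_imset /=; last by move=> a b _ _; exact: val_inj.
  by apply: eq_bigl => a; rewrite inE.
apply: le_trans; rewrite mulrBr -eqy (clE_rem y (@sedge_sym G) (@sedge_irrefl G) m (in_setT v)).
rewrite setTI eigy exprS; lra.
Qed.

(** [y] is tested on [clone v], the new vertex having weight [y v]: the new cliques are
    copies of those through [v]. *)
Lemma radius_clone (G : sgraph) y (v : G) : perron y ->
  rho G * (psum s y + s%:R * y v ^+ s) <=
  rho (clone v) * (psum s y + y v ^+ s).
Proof.
move=> py; have [y0 y1 eqy eigy] := py.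
have D0 : (0 < #|clone v|)%N by rewrite card_clone.
pose z (a : clone v) := if a is Some u then y u else y v.
have z0 a : 0 <= z a by case: a => [u|]; exact: y0.
have SI : injective (Some : G -> clone v) by move=> a b [].
have imT : [set Some u | u in [set: G]] = [set: clone v] :\ None.
  apply/setP=> [[u|]]; rewrite !inE /=; last by apply/imsetP=> -[].
  by apply/imsetP; exists u.
have := clique_radius_ub m0 D0 z0.
have -> : psum s z = psum s y + y v ^+ s.
  rewrite /psum (bigD1 None) //= addrC; congr (_ + _).
  rewrite (eq_bigl (mem ([set: clone v] :\ None))) => [|u]; last by rewrite !inE andbT.
  rewrite -imT big_imset /=; last by move=> a b _ _; exact: SI.
  by apply: eq_bigl => a; rewrite inE.
apply: le_trans.
rewrite (clE_rem z (@sedge_sym (clone v)) (@sedge_irrefl (clone v)) m (in_setT None)).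
rewrite -imT -(cl_iso (e := @sedge G) SI z0 _ _ (fun _ _ => erefl)).
have -> : [set: clone v] :&: nb (@sedge (clone v)) None = [set Some u | u in nb (@sedge G) v].
  rewrite setTI; apply/setP=> [[u|]]; rewrite !inE /=; last by apply/esym/imsetP=> -[].
  by rewrite (mem_imset _ _ SI) inE.
rewrite -(cl_iso (e := @sedge G) SI z0 _ _ (fun _ _ => erefl)).
rewrite [cl _ _ m _]eigy mulrDr -eqy exprS.
by rewrite /comp /= ; lra.
Qed.
End RadiusOps.

(** * Complete multipartite graphs with apexes *)

Section CliqueSumExtra.
Variables (R : realFieldType) (T : finType) (y : T -> R).
Implicit Types (U I O : {set T}).

Lemma cl_eq_rel (e e' : rel T) k U : {in U &, e =2 e'} -> cl e y k U = cl e' y k U.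
Proof.
move=> ee; apply: eq_bigl => S; rewrite /clique_in.
case: (boolP (S \subset U)) => //= sS; case: (_ == _) => //=.
have H (e1 e2 : rel T) : {in U &, e1 =2 e2} -> is_clique e1 S -> is_clique e2 S.
  move=> h /is_cliqueP cS; apply/is_cliqueP=> u v uS vS uv.
  by rewrite -h ?(subsetP sS) // cS.
by apply/idP/idP; apply: H => // u v uU vU; rewrite ee.
Qed.

Variables (e : rel T).
Hypotheses (e_sym : symmetric e) (e_irr : irreflexive e).

(** A clique takes at most one vertex from [I]. *)
Lemma cl_join_indep k O I : [disjoint O & I] ->
  {in I &, forall u v, ~~ e u v} -> {in I & O, forall u v, e u v} ->
  cl e y k.+1 (O :|: I) = cl e y k.+1 O + wt y I * cl e y k O.
Proof.
have [n] := ubnP #|I|; elim: n I => // n IH I cI dOI ind joined.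
have [->|[u uI]] := set_0Vmem I; first by rewrite setU0 /wt big_set0 mul0r addr0.
have uO : u \notin O by rewrite (disjointFl dOI).
have sub : I :\ u \subset I := subsetDl _ _.
rewrite (clE_rem y e_sym e_irr k (u := u)); last by rewrite inE uI orbT.
have -> : (O :|: I) :\ u = O :|: (I :\ u).
  by apply/setP=> w; rewrite !inE; case: eqP => // ->; rewrite (negbTE uO).
have -> : (O :|: I) :&: nb e u = O.
  apply/setP=> w; rewrite !inE; apply/andP/idP=> [[/orP[//|wI]]|wO]; last by rewrite wO joined.
  by rewrite (negbTE (ind _ _ uI wI)).
rewrite IH.
- by rewrite [wt y I](big_setD1 u) //= -/(wt y _); ring.
- by rewrite (cardsD1 u I) uI add1n in cI.
- by apply: disjointWr dOI; exact: sub.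
- by move=> a b /(subsetP sub) aI /(subsetP sub); exact: ind.
- by move=> a b /(subsetP sub); exact: joined.
Qed.
End CliqueSumExtra.

Section Multipartite.
Variables (V : finType) (r : nat).
Implicit Types (c : V -> option 'I_r) (S : {set V}).

(** The complete multipartite graph with parts [c u = Some i], joined to a clique on
    the vertices with [c u = None]. *)
Definition mp_rel c : rel V := fun u v => (u != v) && ((c u == None) || (c u != c v)).
Lemma mp_sym c : symmetric (mp_rel c).
Proof.
move=> u v; rewrite /mp_rel eq_sym; congr (_ && _).
by rewrite [c v == c u]eq_sym; have [->|] := eqVneq (c u) (c v); rewrite ?orbT.
Qed.
Lemma mp_irr c : irreflexive (mp_rel c). Proof. by move=> u; rewrite /mp_rel eqxx. Qed.
Definition mp c : sgraph := SGraph (mp_sym c) (mp_irr c).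

Lemma mp_relE c u i w : c u = Some i -> mp_rel c u w = (c w != Some i).
Proof.
move=> ui; rewrite /mp_rel ui /= eq_sym [Some i == _]eq_sym.
by have [->|] := eqVneq w u; rewrite ?ui ?eqxx ?andbT.
Qed.

Definition part c i := [set u | c u == Some i].
Definition apexes c := [set u | c u == None].

(** A vertex [v] can replace the vertex of the clique that lies in its part, or any
    vertex if there is none. *)
Lemma mp_swap c S v w0 : is_clique (mp_rel c) S -> v \notin S -> w0 \in S ->
  exists w, [/\ w \in S, w = w0 \/ ~~ mp_rel c w v & is_clique (mp_rel c) (v |: S :\ w)].
Proof.
move=> /is_cliqueP cS vS w0S.
have vSw w : v \notin S :\ w by rewrite inE negb_and vS orbT.
have [/existsP[w /andP[wS nwv]]|/existsPn h] := boolP [exists w, (w \in S) && ~~ mp_rel c w v].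
  exists w; split=> //; first by right.
  rewrite (is_clique_setU1 (mp_sym c)) //; apply/andP; split.
    by apply/is_cliqueP=> a b /setD1P[_ aS] /setD1P[_ bS]; exact: cS.
  apply/cnbP=> z /setD1P[zw zS]; have := cS _ _ zS wS zw.
  have wv : w != v by apply: contraNneq vS => <-.
  have zv : z != v by apply: contraNneq vS => <-.
  move: nwv; rewrite /mp_rel wv zv zw /= negb_or negbK => /andP[_ /eqP ->].
  by [].
exists w0; split=> //; first by left.
rewrite (is_clique_setU1 (mp_sym c)) //; apply/andP; split.
  by apply/is_cliqueP=> a b /setD1P[_ aS] /setD1P[_ bS]; exact: cS.
by apply/cnbP=> z /setD1P[_ zS]; have := h z; rewrite zS /= negbK.
Qed.

Section Radius.
Variables (R : realType) (m : nat).
Hypothesis m0 : (0 < m)%N.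
Local Notation s := m.+1.
Local Notation rho G := (clique_spectral_radius R s G).

Section OneColouring.
Variable c : V -> option 'I_r.
Hypothesis rho0 : 0 < rho (mp c).
Variable y : V -> R.
Hypothesis py : @perron R m (mp c) y.

Let y0 v : 0 <= y v. Proof. by case: py. Qed.

Lemma mp_pos_clique : exists2 S, clique_in (mp_rel c) s [set: V] S & {in S, forall v, 0 < y v}.
Proof.
have [_ p0] := perron_psum py; have [_ _ eqy _] := py.
have : 0 < cl (mp_rel c) y s [set: V].
  by have := mulr_gt0 rho0 p0; rewrite -eqy pmulr_rgt0.
have [/existsP[S /andP[cS pS]] _|/existsPn h] :=
   boolP [exists S, clique_in (mp_rel c) s [set: V] S && (0 < \prod_(v in S) y v)].
  exists S => // v vS; rewrite lt_neqAle y0 andbT eq_sym.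
  by apply: contraTneq pS => yv; rewrite (bigD1 v) //= yv mul0r ltxx.
rewrite ltNge; case/negP; apply: sumr_le0 => S cS.
by rewrite leNgt; have := h S; rewrite cS.
Qed.

(** Swapping [v] into a clique of positive weight shows that the clique sum at [v] is
    positive; so is the weight of [v], by the eigenvalue equation. *)
Lemma mp_pos v : 0 < y v.
Proof.
have [S /and3P[_ /eqP kS cS] pS] := mp_pos_clique.
case: (boolP (v \in S)) => [/pS//|vS].
have [w0 w0S] : exists w, w \in S by apply/set0Pn; rewrite -card_gt0 kS.
have [w [wS _ cw]] := mp_swap cS vS w0S.
have [_ _ _ eigy] := py; rewrite lt_neqAle y0 andbT eq_sym; apply/eqP=> yv.
have := eigy v; rewrite yv expr0n gtn_eqF // mulr0 => /eqP; apply/negP; rewrite gt_eqF //.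
apply: lt_le_trans (_ : \prod_(u in S :\ w) y u <= _).
  by apply: prodr_gt0 => u /setD1P[_ /pS].
have vSw : v \notin S :\ w by rewrite inE negb_and vS orbT.
have cQ : clique_in (mp_rel c) m (nb (mp_rel c) v) (S :\ w).
  have : clique_in (mp_rel c) s [set: V] (v |: S :\ w).
    rewrite /clique_in subsetT cw andbT cardsU1 vSw (cardsD1 w S) wS in kS *.
    by rewrite -kS eqxx.
  by rewrite (clique_in_setU1 (mp_sym c)) // setTI => /andP[].
rewrite /cl (bigD1 _ cQ) /= lerDl; apply: sumr_ge0 => Q _; exact: prodr_ge0.
Qed.

Lemma mp_edge_clique u v : mp_rel c u v ->
  exists S, [/\ clique_in (mp_rel c) s [set: V] S, u \in S & v \in S].
Proof.
move=> uv; have [S0 /and3P[_ /eqP kS0 cS0] _] := mp_pos_clique.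
have swapK S a w : w \in S -> a \notin S -> #|a |: S :\ w| = #|S|.
  by move=> wS aS; rewrite cardsU1 (cardsD1 w S) wS inE negb_and aS orbT.
have [S1 [kS1 cS1 uS1]] : exists S, [/\ #|S| = s, is_clique (mp_rel c) S & u \in S].
  case: (boolP (u \in S0)) => uS; first by exists S0.
  have [w0 w0S] : exists w, w \in S0 by apply/set0Pn; rewrite -card_gt0 kS0.
  have [w [wS _ cw]] := mp_swap cS0 uS w0S.
  by exists (u |: S0 :\ w); rewrite swapK // setU11.
case: (boolP (v \in S1)) => vS1.
  by exists S1; split=> //; rewrite /clique_in subsetT kS1 eqxx.
have [w0] : exists w, w \in S1 :\ u.
  apply/set0Pn; rewrite -card_gt0; have := cardsD1 u S1; rewrite uS1 kS1; lia.
case/setD1P=> w0u w0S.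
have [w [wS wE cw]] := mp_swap cS1 vS1 w0S.
have uw : u != w.
  by case: wE => [->|]; [rewrite eq_sym|apply: contraNneq => <-].
exists (v |: S1 :\ w); split; last by rewrite setU11.
  by rewrite /clique_in subsetT swapK // kS1 eqxx.
by rewrite !inE uw uS1 orbT.
Qed.

Lemma mp_part_const i u v : u \in part c i -> v \in part c i -> y u = y v.
Proof.
rewrite !inE => /eqP ui /eqP vi; have [_ _ _ eigy] := py.
have nbE : nb (mp_rel c) u = nb (mp_rel c) v.
  by apply/setP=> w; rewrite !inE (mp_relE _ ui) (mp_relE _ vi).
have : y u ^+ m = y v ^+ m.
  apply: (mulfI (lt0r_neq0 rho0)).
  by rewrite -[LHS](eigy u) -[RHS](eigy v) /= nbE.
by move/(pexpIrn m0); apply; rewrite nnegrE.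
Qed.
End OneColouring.

(** [a] and [b] are the weights in two parts with [n1] and [n2] vertices, and the
    equations are their eigenvalue equations: [Q] and [K] are the sums over the [m]- and
    [(m-1)]-cliques avoiding both parts. For positive [n2] they give [a <= b] and
    [n2 * b ^+ 2 <= n1 * a ^+ 2], hence
    [(n2 * b) ^+ 2 <= n1 * n2 * a ^+ 2 < ((n1 - 1) * a) ^+ 2]. *)
Lemma balance_ineq (rh Q K a b : R) (n1 n2 : nat) : 0 < rh -> 0 < K -> 0 <= Q -> 0 < a ->
  (n2 + 2 <= n1)%N -> rh * a ^+ m = Q + K * (n2%:R * b) ->
  ((0 < n2)%N -> 0 < b /\ rh * b ^+ m = Q + K * (n1%:R * a)) ->
  n2%:R * b < (n1%:R - 1) * a.
Proof.
move=> rh0 K0 Q0 a0 n12 ea hb.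
have n12R : n2%:R + 2 <= n1%:R :> R by rewrite -natrD ler_nat.
case: (posnP n2) => [z|/[dup] n20 /hb [b0 eb]].
  by rewrite z mul0r mulr_gt0 //; move: n12R; rewrite z; lra.
have n2R : 0 < n2%:R :> R by rewrite ltr0n.
have le_ba : n2%:R * b <= n1%:R * a.
  rewrite leNgt; apply/negP=> lt.
  have : rh * b ^+ m < rh * a ^+ m by rewrite ea eb ltrD2l ltr_pM2l.
  rewrite ltr_pM2l // ltr_pXn2r ?nnegrE ?ltW // => ba.
  have : n2%:R * b <= n2%:R * a by rewrite ler_pM2l // ltW.
  have : n2%:R * a <= n1%:R * a by rewrite ler_pM2r //; lra.
  lra.
have ab : a <= b.
  have : rh * a ^+ m <= rh * b ^+ m by rewrite ea eb lerD2l ler_pM2l.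
  by rewrite ler_pM2l // ler_pXn2r // nnegrE ltW.
have abm : a ^+ m <= b ^+ m by rewrite ler_pXn2r ?nnegrE ?(ltW a0) ?(ltW b0).
have am0 : 0 < a ^+ m by exact: exprn_gt0.
have h1 : n2%:R * (b * b ^+ m) <= n1%:R * (a * a ^+ m).
  have : b ^+ m * (rh * a ^+ m) = a ^+ m * (rh * b ^+ m) by ring.
  rewrite ea eb => h; rewrite -(ler_pM2l K0).
  have := ler_wpM2l Q0 abm; lra.
have h2 : n2%:R * b ^+ 2 <= n1%:R * a ^+ 2.
  rewrite -(ler_pM2r (exprn_gt0 m.-1 a0)).
  have mE : a ^+ m = a * a ^+ m.-1 by rewrite -exprS prednK.
  have mE' : b ^+ m = b * b ^+ m.-1 by rewrite -exprS prednK.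
  apply: le_trans (_ : n2%:R * b ^+ 2 * b ^+ m.-1 <= _).
    rewrite ler_pM2l ?mulr_gt0 ?exprn_gt0 //.
    by case: (m.-1) => // k; rewrite ler_pXn2r ?nnegrE ?(ltW a0) ?(ltW b0).
  by move: h1; rewrite mE mE' !expr2 !mulrA.
have lt : (n2%:R * b) ^+ 2 < ((n1%:R - 1) * a) ^+ 2.
  rewrite !exprMn; apply: le_lt_trans (_ : n2%:R * n1%:R * a ^+ 2 < _).
    by rewrite expr2 -!mulrA ler_pM2l.
  rewrite ltr_pM2r ?exprn_gt0 //.
  have : n2%:R * n1%:R <= (n1%:R - 2) * n1%:R :> R by rewrite ler_pM2r; lra.
  rewrite expr2; lra.
move: lt; rewrite ltr_pXn2r // nnegrE mulr_ge0 ?(ltW a0) ?(ltW b0) //.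
by lra.
Qed.

(** The old Perron weights are tested on the graph in which a vertex [u] of the larger
    part has moved to the smaller one. Then [u] sees the rest of its old part instead of
    its new one, and [balance_ineq] says that the former is heavier. *)
Lemma mp_move c i j : (0 < #|V|)%N -> 0 < rho (mp c) -> i != j ->
  (#|part c j| + 2 <= #|part c i|)%N ->
  exists2 c' : V -> option 'I_r, apexes c' = apexes c & rho (mp c) < rho (mp c').
Proof.
move=> V0 rho0 ij hij; have [y py] := perron_exists R m0 (G := mp c) V0.
have [y0 y1 eqy eigy] := py; have ypos := mp_pos rho0 py.
have [u ui] : exists u, u \in part c i by apply/card_gt0P; lia.
have ui' : c u = Some i by apply/eqP; rewrite inE in ui.
have [c' c'u c'E] : exists2 c' : V -> option 'I_r,
    c' u = Some j & forall w, w != u -> c' w = c w.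
  by exists (fun w => if w == u then Some j else c w) => [|w /negbTE ->//]; rewrite eqxx.
exists c'.
  apply/setP=> w; rewrite !inE; have [->|/c'E ->//] := eqVneq w u.
  by rewrite c'u ui'.
pose O := [set w | (c w != Some i) && (c w != Some j)].
have agree : {in [set: V] :\ u &, mp_rel c' =2 mp_rel c}.
  by move=> a b /setD1P[au _] /setD1P[bu _]; rewrite /mp_rel !c'E.
have indep k : {in part c k &, forall a b, ~~ mp_rel c a b}.
  by move=> a b; rewrite !inE /mp_rel => /eqP -> /eqP ->; rewrite eqxx orbF andbF.
have joined k : k \in [:: i; j] -> {in part c k & O, forall a b, mp_rel c a b}.
  move=> kij a b; rewrite !inE => /eqP ak /andP[bi bj]; rewrite (mp_relE _ ak).
  by move: kij; rewrite !inE => /orP[]/eqP ->.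
have dis k : k \in [:: i; j] -> [disjoint O & part c k].
  move=> kij; rewrite -setI_eq0; apply/eqP/setP=> w; rewrite !inE.
  by move: kij; rewrite !inE => /orP[]/eqP ->;
    case: (c w == Some i); case: (c w == Some j).
have nbi v : v \in part c i -> nb (mp_rel c) v = O :|: part c j.
  rewrite inE => /eqP vi; apply/setP=> w; rewrite !inE (mp_relE _ vi).
  have [wj|_] := eqVneq (c w) (Some j); last by rewrite andbT orbF.
  by rewrite orbT wj; apply: contraNneq ij => -[->].
have nbj v : v \in part c j -> nb (mp_rel c) v = O :|: part c i.
  rewrite inE => /eqP vj; apply/setP=> w; rewrite !inE (mp_relE _ vj).
  have [wi|_] := eqVneq (c w) (Some i); last by rewrite orbF.
  by rewrite orbT wi; apply: contraNneq ij => -[->].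
have ii : i \in [:: i; j] by rewrite inE eqxx.
have jj : j \in [:: i; j] by rewrite !inE eqxx orbT.
have sumi : wt y (part c i) = #|part c i|%:R * y u.
  rewrite /wt (eq_bigr (fun=> y u)) => [|v vi]; last exact: (mp_part_const rho0 py vi ui).
  by rewrite sumr_const -[LHS]mulr_natl.
pose m' := m.-1; have mE : m = m'.+1 by rewrite prednK.
set Q := cl (mp_rel c) y m'.+1 O; set K := cl (mp_rel c) y m' O.
have clj : cl (mp_rel c) y m (O :|: part c j) = Q + wt y (part c j) * K.
  by rewrite {1}mE (cl_join_indep y (mp_sym c) (mp_irr c) m' (dis j jj) (@indep j) (joined j jj)).
have cli : cl (mp_rel c) y m (O :|: part c i) = Q + wt y (part c i) * K.
  by rewrite {1}mE (cl_join_indep y (mp_sym c) (mp_irr c) m' (dis i ii) (@indep i) (joined i ii)).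
(* A clique of positive weight has at most one vertex in each of the two parts, hence at
   least [m - 1] vertices in [O]. *)
have K0 : 0 < K.
  have [S /and3P[_ /eqP kS cS] _] := mp_pos_clique rho0 py.
  have le1 k : (#|S :&: part c k| <= 1)%N.
    rewrite leqNgt; apply/negP=> /card_gt1P[a [b [/setIP[aS ak] /setIP[bS bk] ab]]].
    by have := indep k a b ak bk; move/is_cliqueP: cS => ->.
  have cO : (m' <= #|S :&: O|)%N.
    have : S \subset (S :&: O) :|: ((S :&: part c i) :|: (S :&: part c j)).
      apply/subsetP=> w wS; rewrite !inE wS /=.
      by case: (c w == Some i); case: (c w == Some j).
    move/subset_leq_card; rewrite kS => h.
    have h1 := (leq_card_setU (S :&: O) ((S :&: part c i) :|: (S :&: part c j))).1.
    have h2 := (leq_card_setU (S :&: part c i) (S :&: part c j)).1.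
    have := le1 i; have := le1 j; lia.
  have : (0 < #|[set B : {set V} | (B \subset S :&: O) && (#|B| == m')]|)%N.
    by rewrite cards_draws bin_gt0.
  case/card_gt0P=> B; rewrite inE subsetI => /andP[/andP[BS BO] kB].
  have cB : clique_in (mp_rel c) m' O B by rewrite /clique_in BO kB (is_cliqueS BS).
  rewrite /K /cl (bigD1 _ cB) /=; apply: ltr_pwDl; first exact: prodr_gt0.
  by apply: sumr_ge0 => S' _; exact: prodr_ge0.
have Q0 : 0 <= Q by exact: cl_ge0.
have key : wt y (part c j) < wt y (part c i) - y u.
  have eu := eigy u; rewrite [nb _ _](nbi _ ui) [LHS]clj in eu.
  have [j_e|[z zj]] := set_0Vmem (part c j).
    rewrite j_e /wt big_set0 -/(wt y _) sumi subr_gt0 -[ltLHS]mul1r ltr_pM2r //.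
    by rewrite ltr1n; lia.
  have ez := eigy z; rewrite [nb _ _](nbj _ zj) [LHS]cli in ez.
  have sumj : wt y (part c j) = #|part c j|%:R * y z.
    rewrite /wt (eq_bigr (fun=> y z)) => [|v vi]; last exact: (mp_part_const rho0 py vi zj).
    by rewrite sumr_const -[LHS]mulr_natl.
  rewrite sumi sumj in eu ez *.
  have -> : #|part c i|%:R * y u - y u = (#|part c i|%:R - 1) * y u by ring.
  apply: (balance_ineq rho0 K0 Q0 (ypos u) hij); first by rewrite -eu; ring.
  by move=> _; split=> //; rewrite -ez; ring.
have [_ p0] := perron_psum py.
rewrite -(ltr_pM2r p0) -eqy; apply: lt_le_trans (clique_radius_ub m0 (G := mp c') V0 y0).
rewrite ltr_pM2l //.
change (cl (mp_rel c) y s [set: V] < cl (mp_rel c') y s [set: V]).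
rewrite (clE_rem y (mp_sym c) (mp_irr c) m (in_setT u)).
rewrite (clE_rem y (mp_sym c') (mp_irr c') m (in_setT u)).
rewrite (cl_eq_rel _ _ agree) ltrD2l ltr_pM2l // !setTI.
rewrite [X in X < _](_ : _ = Q + wt y (part c j) * K); last by rewrite [nb _ _](nbi _ ui).
have nb' : nb (mp_rel c') u = O :|: (part c i :\ u).
  apply/setP=> w; rewrite !inE (mp_relE _ c'u).
  have [->|wu] := eqVneq w u; first by rewrite c'u ui' !eqxx.
  rewrite c'E //=; have [wi|_] := eqVneq (c w) (Some i); last by rewrite orbF.
  by rewrite orbT wi; apply: contraNneq ij => -[->].
rewrite [nb _ _]nb' {1}mE (@cl_eq_rel _ _ _ (mp_rel c') (mp_rel c)); last first.
  move=> a b aU bU; apply: agree; rewrite !inE andbT.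
    by apply: contraTneq aU => ->; rewrite !inE eqxx ui' eqxx.
  by apply: contraTneq bU => ->; rewrite !inE eqxx ui' eqxx.
rewrite (cl_join_indep y (mp_sym c) (mp_irr c)); first last.
- by move=> a b /setD1P[_]; exact: joined.
- by move=> a b /setD1P[_ ai] /setD1P[_ bi]; exact: indep bi.
- by apply: disjointWr (dis i ii); exact: subsetDl.
rewrite ltrD2l ltr_pM2r //; apply: lt_le_trans key _.
by rewrite lerBlDr addrC -(big_setD1 u ui).
Qed.
End Radius.
End Multipartite.

(** * Graphs that are multipartite up to few vertices *)

Section Fibres.

Lemma subset_of_card (T : finType) (A : {set T}) k : (k <= #|A|)%N ->
  exists2 B : {set T}, B \subset A & #|B| = k.
Proof.
move=> kA; have : (0 < #|[set B : {set T} | (B \subset A) && (#|B| == k)]|)%N.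
  by rewrite cards_draws bin_gt0.
by case/card_gt0P=> B; rewrite inE => /andP[sB /eqP kB]; exists B.
Qed.

Lemma fibre_bij (V V' : finType) (X : eqType) (h : V -> X) (h' : V' -> X) :
  (forall x, #|[set u | h u == x]| = #|[set u | h' u == x]|) ->
  exists2 f : V -> V', bijective f & forall u, h' (f u) = h u.
Proof.
move=> hh.
have cnt (U : finType) (g : U -> X) x : count_mem x (codom g) = #|[set u | g u == x]|.
  by rewrite count_map cardE -size_filter; congr size; rewrite enumT; apply: eq_filter => u; rewrite !inE.
have /tuple_permP[p pE] : perm_eq (codom h) (codom_tuple h').
  by apply/allP=> x _ /=; rewrite !cnt hh.
have sz : #|V| = #|V'|.
  by have := congr1 size pE; rewrite size_codom size_tuple.
exists (fun u => enum_val (p (cast_ord sz (enum_rank u)))).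
  apply: inj_card_bij; last by rewrite sz.
  by move=> u v /enum_val_inj/perm_inj/cast_ord_inj/enum_rank_inj.
move=> u; set i := cast_ord sz (enum_rank u).
have := congr1 (fun q => nth (h u) q i) pE.
rewrite -[X in nth _ (codom h) X]/(val (enum_rank u)) nth_codom enum_rankK => ->.
rewrite -tnth_nth tnth_mktuple (tnth_nth (h u)) /= nth_codom.
by [].
Qed.

(** A balanced function takes two consecutive values only; the smaller one is the
    quotient of its sum by [r], and the larger one is taken as often as the remainder
    says. *)
Lemma balanced_counts r (n n' : 'I_r -> nat) :
  (forall i j, n i <= n j + 1)%N -> (forall i j, n' i <= n' j + 1)%N ->
  (\sum_i n i = \sum_i n' i)%N ->
  forall a, #|[set i | n i == a]| = #|[set i | n' i == a]|.
Proof.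
case: r n n' => [|r] n n' bn bn' sn a; first by apply: eq_card => -[].
have key (g : 'I_r.+1 -> nat) : (forall i j, g i <= g j + 1)%N ->
    forall x, #|[set i | g i == x]| =
      (if x == (\sum_i g i) %/ r.+1 then r.+1 - (\sum_i g i) %% r.+1 else
       if x == ((\sum_i g i) %/ r.+1).+1 then (\sum_i g i) %% r.+1 else 0)%N.
  move=> bg; have [i0 _ i0min] := arg_minnP (P := predT) g (i0 := ord0) isT.
  pose b := #|[set i | g i == (g i0).+1]|.
  have gE i : g i = g i0 \/ g i = (g i0).+1.
    by have := i0min i isT; have := bg i i0; lia.
  have cb : (#|[set i | g i == g i0]| + b = r.+1)%N.
    rewrite /b -[RHS](card_ord r.+1) -(cardsC [set i | g i == g i0]); congr (_ + _)%N.
    by apply: eq_card => i; rewrite !inE; case: (gE i) => ->; lia.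
  have c0 : (0 < #|[set i | g i == g i0]|)%N by apply/card_gt0P; exists i0; rewrite inE.
  have sg : (\sum_i g i = g i0 * r.+1 + b)%N.
    transitivity (\sum_i (g i0 + (g i == (g i0).+1)))%N.
      by apply: eq_bigr => i _; case: (gE i) => ->; lia.
    rewrite big_split /= sum_nat_const card_ord mulnC; congr (_ + _)%N.
    by rewrite /b -sum1_card [RHS]big_mkcond /=; apply: eq_bigr => i _; rewrite inE; case: eqP.
  have br : (b < r.+1)%N by lia.
  have dv : ((\sum_i g i) %/ r.+1 = g i0)%N by rewrite sg divnMDl // divn_small ?addn0.
  have md : ((\sum_i g i) %% r.+1 = b)%N by rewrite sg modnMDl modn_small.
  move=> x; rewrite dv md; case: (x =P g i0) => [->|x1]; first by lia.
  case: (x =P (g i0).+1) => [->//|x2]; apply/eqP; rewrite cards_eq0; apply/eqP/setP=> i.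
  by rewrite !inE; apply/eqP; case: (gE i) => ->; lia.
by rewrite (key n) // (key n') // sn.
Qed.

End Fibres.

Section Balanced.
Variable r : nat.

Definition balanced (V : finType) (c : V -> option 'I_r) :=
  forall i j, (#|part c i| <= #|part c j| + 1)%N.

Lemma sum_parts (V : finType) (c : V -> option 'I_r) :
  (\sum_i #|part c i| + #|apexes c| = #|V|)%N.
Proof.
rewrite -(cardsC (apexes c)) addnC; congr (_ + _)%N.
under eq_bigr do rewrite -sum1_card big_mkcond /=.
rewrite exchange_big -sum1_card [RHS]big_mkcond /=; apply: eq_bigr => u _.
rewrite !inE; case cu: (c u) => [j|] /=.
  rewrite (bigD1 j) //= inE cu eqxx big1 // => i ij; rewrite inE cu.
  by case: eqP => // -[ji]; rewrite ji eqxx in ij.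
by rewrite big1 // => i _; rewrite inE cu.
Qed.

Lemma balanced_iso (V V' : finType) (c : V -> option 'I_r) (c' : V' -> option 'I_r) :
  #|V| = #|V'| -> #|apexes c| = #|apexes c'| -> balanced c -> balanced c' ->
  sg_iso (mp c) (mp c').
Proof.
move=> VV aa bc bc'.
have sE : (\sum_i #|part c i| = \sum_i #|part c' i|)%N.
  by have := sum_parts c; have := sum_parts c'; lia.
have [tau tau_bij tauE] := fibre_bij (balanced_counts bc bc' sE).
have [tau' tauK tauK'] := tau_bij.
have [|f f_bij fE] := @fibre_bij V V' _ (fun u => omap tau (c u)) c'.
  case=> [j|].
    have -> : [set u | c' u == Some j] = part c' (tau (tau' j)) by rewrite tauK'.
    rewrite (tauE (tau' j)); apply: eq_card => u; rewrite !inE.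
    case: (c u) => //= i; rewrite !(inj_eq Some_inj).
    by rewrite -[in LHS](tauK' j) (bij_eq tau_bij).
  by rewrite [RHS](esym aa); apply: eq_card => u; rewrite !inE; case: (c u).
exists f => // u v; rewrite /= /mp_rel !fE (bij_eq f_bij); congr (_ && _).
case: (c u) => [i|] //=; case: (c v) => [j|] //=.
by rewrite !(inj_eq Some_inj) (bij_eq tau_bij).
Qed.

Lemma count_residues i q : (i < r)%N ->
  (\sum_(u < q) (u %% r == i) = q %/ r + (i < q %% r))%N.
Proof.
move=> ir; have r0 : (0 < r)%N by lia.
elim: q => [|q IH]; first by rewrite big_ord0 div0n mod0n.
rewrite big_ord_recr /= IH divnS // modnS.
have qm := ltn_pmod q r0.
case: (boolP (r %| q.+1)%N) => dq; last by case: (ltngtP i (q %% r)); lia.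
have : (q %% r).+1 = r.
  have := modnS q r; rewrite dq => _; apply/eqP.
  have : (r %| (q %% r).+1)%N by rewrite -addn1 /dvdn modnDml addn1.
  by move/dvdn_leq => /(_ isT); lia.
by case: (ltngtP i (q %% r)); lia.
Qed.
End Balanced.

Definition turan_join r k q := join (complete k) (turan r q).

Lemma card_turan_join r k q : #|turan_join r k q| = (k + q)%N.
Proof. by rewrite /= card_sum !card_ord. Qed.

Lemma turan_join_mp r k q : (0 < r)%N ->
  exists c : turan_join r k q -> option 'I_r,
    [/\ #|apexes c| = k, balanced c & forall u v, sedge u v = mp_rel c u v].
Proof.
move=> r0.
pose c (u : 'I_k + 'I_q) : option 'I_r :=
  if u is inr b then Some (Ordinal (ltn_pmod b r0)) else None.
exists c; split.
- rewrite -[RHS](card_ord k) -(card_imset predT (@inl_inj 'I_k 'I_q)).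
  apply: eq_card => -[a|b]; rewrite !inE /=.
    by apply/esym/imsetP; exists a.
  by apply/esym/imsetP=> -[].
- have pE i : #|part c i| = (q %/ r + (i < q %% r))%N.
    rewrite -count_residues // -sum1_card big_mkcond /= big_sumType /= big1 ?add0n.
      by apply: eq_bigr => b _; rewrite inE /=.
    by move=> a _; rewrite inE.
  by move=> i j; rewrite !pE; do 2!case: (_ < _)%N; lia.
case=> [a|a] [b|b] //=; rewrite /mp_rel /= ?(inj_eq inl_inj) ?andbT //=.
have [->|] := eqVneq a b; rewrite ?eqxx //= => ab.
by apply/idP/andP=> [h|[]//]; split=> //; apply: contra ab => /eqP[->].
Qed.

Section ExtremalValue.
Variables (R : realType) (m r k q : nat).
Hypotheses (m0 : (0 < m)%N) (r0 : (0 < r)%N) (kq : (0 < k + q)%N).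
Local Notation s := m.+1.
Local Notation rho G := (clique_spectral_radius R s G).
Local Notation G0 := (turan_join r k q).
Hypothesis rho0 : 0 < rho G0.

Lemma sg_iso_trans (G H K : sgraph) : sg_iso G H -> sg_iso H K -> sg_iso G K.
Proof.
move=> [f fb fE] [g gb gE]; exists (g \o f); first exact: bij_comp.
by move=> u v; rewrite /= gE fE.
Qed.

Lemma mp_balanced_iso (V : finType) (c : V -> option 'I_r) :
  #|V| = (k + q)%N -> #|apexes c| = k -> balanced c -> sg_iso (mp c) G0.
Proof.
move=> Vkq ck bc; have [c0 [c0k bc0 c0E]] := turan_join_mp k q r0.
apply: (@sg_iso_trans _ (mp c0)).
  by apply: balanced_iso; rewrite ?ck ?c0k // Vkq card_turan_join.
by exists id => [|u v]; [exists id|rewrite c0E].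
Qed.

(** By [mp_move], a colouring of maximal radius is balanced. Colourings are coded by
    finite functions for the maximum to exist. *)
Lemma mp_radius_le (V : finType) (c : V -> option 'I_r) :
  #|V| = (k + q)%N -> #|apexes c| = k -> rho (mp c) <= rho G0.
Proof.
move=> Vkq ck; rewrite leNgt; apply/negP=> lt.
have V0 : (0 < #|V|)%N by rewrite Vkq.
pose P (d : {ffun V -> option 'I_r}) := (#|apexes d| == k) && (rho G0 < rho (mp d)).
have fE (c' : V -> option 'I_r) : apexes [ffun u => c' u] = apexes c' /\
    rho (mp [ffun u => c' u]) = rho (mp c').
  have cE : ([ffun u => c' u] : V -> option 'I_r) = c' by apply/funext=> u; rewrite ffunE.
  by rewrite cE.
have Pc : P [ffun u => c u] by rewrite /P; have [-> ->] := fE c; rewrite ck eqxx.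
have [d /andP[/eqP dk dlt] dmax] := arg_maxP (fun d : {ffun V -> option 'I_r} => rho (mp d)) Pc.
have rho_d : 0 < rho (mp d) by exact: lt_trans dlt.
have bd : balanced d.
  move=> i j; rewrite leqNgt; apply/negP=> hij.
  have ij : i != j by apply: contraTneq hij => ->; rewrite -leqNgt leq_addr.
  have [|c' c'k lt'] := mp_move m0 V0 rho_d ij; first by lia.
  have := dmax [ffun u => c' u]; rewrite /P; have [-> ->] := fE c'.
  rewrite c'k dk eqxx (lt_trans dlt lt') => /(_ isT) h.
  by have := lt_le_trans lt' h; rewrite ltxx.
by move: dlt; rewrite (radius_iso R m0 (G := mp d) V0 (mp_balanced_iso Vkq dk bd)) ltxx.
Qed.

Lemma mp_radius_eq (V : finType) (c : V -> option 'I_r) :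
  #|V| = (k + q)%N -> #|apexes c| = k -> rho (mp c) = rho G0 -> sg_iso (mp c) G0.
Proof.
move=> Vkq ck rE; have V0 : (0 < #|V|)%N by rewrite Vkq.
apply: mp_balanced_iso => // i j; rewrite leqNgt; apply/negP=> hij.
have ij : i != j by apply: contraTneq hij => ->; rewrite -leqNgt leq_addr.
have rho_c : 0 < rho (mp c) by rewrite rE.
have [|c' c'k lt'] := mp_move m0 V0 rho_c ij; first by lia.
have c'k' : #|apexes c'| = k by rewrite c'k.
by have := mp_radius_le Vkq c'k'; rewrite leNgt -rE lt'.
Qed.

(** [H] is a subgraph of a complete multipartite graph [mp c] with [k] apexes, and
    [mp_radius_le] applies to the latter. If the radii are equal, the Perron weights of
    [H] are optimal for [mp c] too, hence positive; so [H] cannot miss any clique of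
    [mp c], nor any edge, since each edge lies in a clique. *)
Lemma near_partite_radius (H : sgraph) (A : {set H}) (f : H -> 'I_r) :
  #|H| = (k + q)%N -> (#|A| <= k)%N ->
  {in ~: A &, forall u v, sedge u v -> f u != f v} ->
  rho H <= rho G0 /\ (rho H = rho G0 -> sg_iso H G0).
Proof.
move=> Hkq Ak fP; have H0 : (0 < #|H|)%N by rewrite Hkq.
have [B sB kB] : exists2 B : {set H}, B \subset ~: A & #|B| = (k - #|A|)%N.
  by apply: subset_of_card; have := cardsC A; rewrite Hkq; lia.
pose c u := if u \in A :|: B then None else Some (f u).
have ck : #|apexes c| = k.
  have -> : apexes c = A :|: B by apply/setP=> u; rewrite inE /c; case: ifP.
  rewrite cardsU kB disjoint_setI0 ?cards0; first by lia.
  by rewrite disjoints_subset -setCS setCK.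
have sub u v : sedge u v -> mp_rel c u v.
  move=> uv; apply/andP; split.
    by apply: contraTneq uv => ->; rewrite sedge_irrefl.
  rewrite /c; case: ifP => //= uA; case: ifP => // vA.
  rewrite (inj_eq Some_inj); apply: fP => //; rewrite inE.
    by move/negbT: uA; rewrite inE negb_or => /andP[].
  by move/negbT: vA; rewrite inE negb_or => /andP[].
have le1 : rho H <= rho (mp c) by apply: (@radius_hom R m m0 H (mp c) id).
have le2 := mp_radius_le Hkq ck.
split; first exact: le_trans le2.
move=> rE; have rE1 : rho (mp c) = rho G0 by apply/le_anti; rewrite le2 -rE le1.
apply: sg_iso_trans (mp_radius_eq Hkq ck rE1).
exists id; first by exists id.
move=> u v; apply/idP/idP=> [uv|]; last exact: sub.
have [y py] := perron_exists R m0 H0; have [y0 y1 eqy eigy] := py.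
have cl_le : cl (@sedge H) y s [set: H] <= cl (mp_rel c) y s [set: H].
  have := @cl_hom R H H (@sedge H) (mp_rel c) id y (@inj_id H) y0 s [set: H] sub.
  by rewrite imset_id.
have cl_ge : cl (mp_rel c) y s [set: H] <= cl (@sedge H) y s [set: H].
  rewrite -(ler_pM2l (ltr0Sn R m)) eqy rE -rE1.
  exact: (clique_radius_ub m0 (G := mp c)).
have cl_eq : cl (mp_rel c) y s [set: H] = cl (@sedge H) y s [set: H].
  by apply/le_anti; rewrite cl_ge.
have rho_c : 0 < rho (mp c) by rewrite rE1.
have pyc : @perron R m (mp c) y.
  have eqc : s%:R * cl (@sedge (mp c)) y s [set: mp c] = rho (mp c) * psum s y.
    by rewrite -rE1 in rE; rewrite -rE -eqy; congr (_ * _).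
  by split=> //; exact: (clique_radius_eigen m0 (G := mp c)).
have ypos := mp_pos m0 rho_c pyc.
have [S [cS uS vS]] := mp_edge_clique m0 rho_c pyc uv.
apply: contraT => nuv; have : cl (@sedge H) y s [set: H] < cl (mp_rel c) y s [set: H].
  rewrite [ltRHS](bigD1 S cS) /=; apply: le_lt_trans (_ : \sum_(Q | clique_in (mp_rel c) s [set: H] Q && (Q != S)) \prod_(w in Q) y w < _).
    apply: ler_sum_subset => [Q /and3P[sQ kQ cQ]|Q _]; last exact: prodr_ge0.
    rewrite /clique_in sQ kQ /=; apply/andP; split.
      by apply/is_cliqueP=> a b aQ bQ ab; apply: sub; move/is_cliqueP: cQ; apply.
    apply: contraNneq nuv => QS; move/is_cliqueP: cQ; apply; rewrite ?QS //.
    by apply: contraTneq uv => ->; rewrite sedge_irrefl.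
  by rewrite ltrDr; exact: prodr_gt0.
by rewrite cl_eq ltxx.
Qed.
End ExtremalValue.

(** * Colour-critical graphs and gadgets *)

Lemma colorableP (G : sgraph) k :
  reflect (exists f : G -> 'I_k, forall u v, sedge u v -> f u != f v) (colorable G k).
Proof.
apply: (iffP existsP) => [[f /forallP fP]|[f fP]].
  by exists f => u v uv; have /forallP/(_ v)/implyP := fP u; exact.
exists [ffun u => f u]; apply/forallP=> u; apply/forallP=> v; apply/implyP=> uv.
by rewrite !ffunE fP.
Qed.

Lemma colorable_mono (G : sgraph) k l : (k <= l)%N -> colorable G k -> colorable G l.
Proof.
move=> kl /colorableP[f fP]; apply/colorableP; exists (widen_ord kl \o f) => u v /fP.
by apply: contraNneq => /= h; apply/eqP/val_inj; have /= := congr1 val h.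
Qed.

Lemma chi_colorable (G : sgraph) k : colorable G k = (chi G <= k)%N.
Proof.
rewrite /chi; case: ex_minnP => l cl lmin; apply/idP/idP; first exact: lmin.
by move=> lk; exact: colorable_mono lk cl.
Qed.

(** An [r]-colouring of [H] minus its critical edge gives the same colour to the ends of
    this edge, since [H] itself has no [r]-colouring. *)
Lemma critical_coloring (H : sgraph) r : color_critical H -> chi H = (r + 1)%N ->
  exists x y (g : H -> 'I_r), [/\ sedge x y, g x = g y &
    forall u v, sedge u v -> g u = g v -> [set u; v] = [set x; y]].
Proof.
move=> [x [y [xy lt]]] cH; exists x, y.
have /colorableP[g gP] : colorable (del_edge x y) r by rewrite chi_colorable; lia.
have gP' (u v : H) : sedge u v -> g u = g v -> [set u; v] = [set x; y].
  move=> uv guv; apply/eqP/negPn/negP=> h.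
  have duv : @sedge (del_edge x y) u v by apply/andP.
  by have := gP u v duv; rewrite guv eqxx.
exists g; split=> //; apply/eqP; apply: contraT => gxy.
have : colorable H r.
  apply/colorableP; exists g => u v uv; apply/eqP=> guv.
  have /setP sE := gP' u v uv guv; move/eqP: gxy; apply.
  have := sE x; have := sE y; rewrite !inE !eqxx orbT /= => /orP[]/eqP -> /orP[]/eqP -> //.
by rewrite chi_colorable cH; lia.
Qed.

Section Union.
Variables (t : nat) (F : 'I_t -> sgraph).

Lemma union_edge i (u v : F i) :
  @sedge (disjoint_union F) (Tagged (fun i => F i) u) (Tagged (fun i => F i) v) = sedge u v.
Proof. by rewrite /= /disjoint_union_rel /= eqxx tagged_asE. Qed.

(** Each [F i] must use an apex, since it is not [r]-colourable, and there are fewer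
    than [t] apexes. *)
Lemma turan_join_free r k q : (0 < r)%N -> (k < t)%N ->
  (forall i, ~~ colorable (F i) r) -> sg_free (disjoint_union F) (turan_join r k q).
Proof.
move=> r0 kt nc [f f_inj fE].
have apex i : exists a : 'I_k, exists u : F i, f (Tagged (fun i => F i) u) = inl a.
  have [/existsP[a /existsP[u /eqP fu]]|/existsPn h] :=
    boolP [exists a, exists u : F i, f (Tagged (fun i => F i) u) == inl a].
    by exists a, u.
  case/negP: (nc i); apply/colorableP.
  pose g (u : F i) : 'I_r := if f (Tagged (fun i => F i) u) is inr b
    then Ordinal (ltn_pmod b r0) else Ordinal r0.
  exists g => u v uv.
  have noa (w : F i) a : f (Tagged (fun i => F i) w) <> inl a.
    by move=> fw; have /existsPn/(_ w) := h a; rewrite fw eqxx.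
  have := fE (Tagged (fun i => F i) u) (Tagged (fun i => F i) v); rewrite union_edge => /(_ uv).
  rewrite /g; case fu: (f _) => [a|a]; first by case: (noa u a).
  by case fv: (f _) => [b|b]; first by case: (noa v b).
pose a i := sval (cid (apex i)).
have a_inj : injective a.
  move=> i j aij; have [u fu] := svalP (cid (apex i)); have [v fv] := svalP (cid (apex j)).
  have : f (Tagged (fun i => F i) u) = f (Tagged (fun i => F i) v).
    by rewrite fu fv -/(a i) -/(a j) aij.
  by move/f_inj/(congr1 tag).
by have := leq_card a a_inj; rewrite !card_ord leqNgt kt.
Qed.

Definition total_size := (\sum_i #|F i|)%N.

Lemma le_total_size i : (#|F i| <= total_size)%N.
Proof. by rewrite /total_size (bigD1 i) //= leq_addr. Qed.

(** The bound on [Z] leaves room for the images of all the [F i] and for [t] other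
    gadgets with at most two vertices, so that disjoint gadgets can be used one after
    the other. *)
Definition gadget (G : sgraph) (g : {set G}) :=
  forall i (Z : {set G}), (#|Z| <= total_size + 2 * t)%N -> [disjoint Z & g] ->
  exists f : F i -> G, [/\ injective f, forall u v, sedge u v -> sedge (f u) (f v) &
    forall u, f u \notin Z].

Lemma card_bigcup_le (T I : finType) (P : pred I) (B : I -> {set T}) :
  (#|\bigcup_(i | P i) B i| <= \sum_(i | P i) #|B i|)%N.
Proof.
elim/big_rec2: _ => [|i x U _ IH]; first by rewrite cards0.
by apply: leq_trans (leq_card_setU _ _).1 _; rewrite leq_add2l.
Qed.

(** The [F i] are embedded one by one, avoiding the vertices already used and the
    gadgets still to come. *)
Lemma gadgets_embed (G : sgraph) (g : 'I_t -> {set G}) :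
  (forall i, gadget (g i)) -> (forall i, #|g i| <= 2)%N ->
  (forall i j, i != j -> [disjoint g i & g j]) -> sg_contains G (disjoint_union F).
Proof.
move=> gad g2 gdis.
pose fam := forall i, F i -> G.
pose good (j : nat) (h : fam) := [/\ forall i : 'I_t, (i < j)%N -> injective (h i),
  forall i : 'I_t, (i < j)%N -> forall u v, sedge u v -> sedge (h i u) (h i v),
  forall (i i' : 'I_t) u v, (i < j)%N -> (i' < j)%N -> i != i' -> h i u != h i' v &
  forall (i i' : 'I_t) u, (i < j)%N -> (j <= i')%N -> h i u \notin g i'].
have h0 : exists h : fam, True.
  have ex i : exists f : F i -> G, True.
    have d0 : [disjoint (set0 : {set G}) & g i] by rewrite -setI_eq0 set0I.
    have c0 : (#|(set0 : {set G})| <= total_size + 2 * t)%N by rewrite cards0.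
    by have [f _] := gad i i set0 c0 d0; exists f.
  by exists (fun i => sval (cid (ex i))).
have step j : (j <= t)%N -> exists h : fam, good j h.
  elim: j => [_|j IH jt].
    by have [h _] := h0; exists h; split.
  have [h [hinj hhom hdis hg]] := IH (ltnW jt).
  pose jo := Ordinal jt.
  pose Z := (\bigcup_(i : 'I_t | (i < j)%N) [set h i u | u in [set: F i]])
     :|: \bigcup_(i : 'I_t | (j < i)%N) g i.
  have cZ : (#|Z| <= total_size + 2 * t)%N.
    apply: leq_trans (leq_card_setU _ _).1 _; apply: leq_add.
      apply: leq_trans (card_bigcup_le _ _) _; rewrite big_mkcond; apply: leq_sum => i _.
      by case: ifP => // _; rewrite -cardsT; exact: leq_imset_card.
    apply: leq_trans (card_bigcup_le _ _) _; rewrite big_mkcond.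
    apply: leq_trans (_ : \sum_(i < t) 2 <= _)%N.
      by apply: leq_sum => i _; case: ifP.
    by rewrite sum_nat_const card_ord mulnC.
  have dZ : [disjoint Z & g jo].
    rewrite -setI_eq0; apply/eqP/setP=> w; rewrite !inE; apply/negP=> /andP[/orP[]].
      case/bigcupP=> i ij /imsetP[u _ ->] => wg.
      by have := hg i jo u ij (leqnn j); rewrite wg.
    case/bigcupP=> i ij wi wj; have ji : i != jo by rewrite -val_eqE /= gtn_eqF.
    by have := gdis _ _ ji; rewrite disjoint_subset => /subsetP/(_ w wi); rewrite inE wj.
  have [f [finj fhom fZ]] := gad jo jo Z cZ dZ.
  have hfE : dfwith h f jo = f by exact: dfwith_in.
  have hE i : i != jo -> dfwith h f i = h i by move=> ij; apply: dfwith_out; rewrite eq_sym.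
  have lt (i : 'I_t) : (i < j.+1)%N -> i != jo -> (i < j)%N.
    by rewrite ltnS leq_eqVlt -val_eqE /= => /orP[->|].
  exists (dfwith h f); split.
  - move=> i ij; have [->|ne] := eqVneq i jo; first by rewrite hfE.
    by rewrite hE //; apply: hinj; exact: lt.
  - move=> i ij; have [->|ne] := eqVneq i jo; first by rewrite hfE.
    by rewrite hE //; apply: hhom; exact: lt.
  - have aux (i : 'I_t) u v : (i < j)%N -> h i u != f v.
      move=> ij; apply: contraNneq (fZ v) => <-; rewrite inE; apply/orP; left.
      by apply/bigcupP; exists i => //; apply: imset_f; rewrite inE.
    move=> i i' u v ij i'j ii'; move: u v.
    have [ei|ne] := eqVneq i jo; have [ei'|ne'] := eqVneq i' jo.
    + by rewrite ei ei' eqxx in ii'.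
    + by move: ei ij ii' => -> _ _ u v; rewrite hfE hE // eq_sym aux // lt.
    + by move: ei' i'j ii' => -> _ _ u v; rewrite hfE hE // aux // lt.
    + by move=> u v; rewrite !hE //; apply: hdis; rewrite ?lt.
  - move=> i i' u ij ji'; move: u; have [ei|ne] := eqVneq i jo.
      move: ei ij => -> _ u; rewrite hfE; apply: contra (fZ u) => ug.
      by rewrite inE; apply/orP; right; apply/bigcupP; exists i'.
    by move=> u; rewrite hE // hg //; [exact: lt|exact: ltnW].
have [h [hinj hhom hdis _]] := step t (leqnn t).
exists (fun p => h (tag p) (tagged p)).
  move=> [i u] [j v] /= huv; have [ij|ij] := eqVneq i j.
    by move: ij v huv => <- v /hinj -> .
  by have := hdis i j u v (ltn_ord i) (ltn_ord j) ij; rewrite huv eqxx.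
move=> [i u] [j v] /=; rewrite /disjoint_union_rel /= => /andP[/eqP ij].
by move: ij v => <- v; rewrite tagged_asE; apply: hhom.
Qed.

Lemma no_gadgets (G : sgraph) (ss : seq {set G}) : sg_free (disjoint_union F) G ->
  (t <= size ss)%N -> pairwise (fun a b : {set G} => [disjoint a & b]) ss ->
  {in ss, forall g, gadget g /\ (#|g| <= 2)%N} -> False.
Proof.
move=> free tss /(pairwiseP set0) dis gad; apply: free.
have mem (i : 'I_t) : nth set0 ss i \in ss.
  by apply: mem_nth; exact: leq_trans (ltn_ord i) tss.
apply: (@gadgets_embed _ (fun i => nth set0 ss i)) => [i|i|i j ij].
- by have [] := gad _ (mem i).
- by have [] := gad _ (mem i).
have lt (k : 'I_t) : (k < size ss)%N by exact: leq_trans (ltn_ord k) tss.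
case: (ltngtP i j) => [lij|lji|eij]; last by rewrite (val_inj eij) eqxx in ij.
  by apply: dis lij; rewrite inE; exact: lt.
by rewrite disjoint_sym; apply: dis lji; rewrite inE; exact: lt.
Qed.
End Union.

(** * Vertices and edges that are gadgets *)

Section Embeddings.
Variables (R : realFieldType) (t r : nat) (F : 'I_t -> sgraph).
Hypotheses (hcrit : forall i, color_critical (F i)) (hchi : forall i, chi (F i) = (r + 1)%N).
Local Notation total := (total_size F).

Lemma wt_const1 (T : finType) (U : {set T}) : wt (fun=> 1 : R) U = #|U|%:R.
Proof. by rewrite /wt sumr_const. Qed.

Section Weights.
Variables (G : sgraph) (y : G -> R) (kap eta : R) (U : 'I_r -> {set G}).
Hypotheses (y0 : forall v, 0 <= y v) (yk : forall v, y v <= kap) (eta0 : 0 <= eta).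
Hypothesis missU : forall i j u, i != j -> u \in U i ->
  wt y (U j :\: nb (@sedge G) u) <= eta.

Let budget := eta *+ total + kap *+ (3 * total + 2 * t).

Let small i (Z : {set G}) (v0 : G) : (#|Z| <= total + 2 * t)%N ->
  eta *+ #|F i| + kap *+ (#|Z| + #|F i|) <= budget.
Proof.
move=> Zs; have kap0 : 0 <= kap by apply: le_trans (y0 v0) (yk v0).
have Fi := le_total_size F i; apply: lerD; apply: ler_wpMn2l => //; lia.
Qed.

(** [v] plays the role of one end of the critical edge. Without this end the colouring
    of [F i] is proper, and the other vertices are placed greedily in the traces of the
    parts on the neighbourhood of [v]. *)
Lemma apex_gadget v : (forall i, budget < wt y (nb (@sedge G) v :&: U i)) ->
  gadget F [set v].
Proof.
move=> big i Z Zs dZ.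
have vZ : v \notin Z.
  by apply: contraTN dZ => vZ; rewrite -setI_eq0; apply/set0Pn; exists v; rewrite !inE vZ eqxx.
have [x [x' [g [xx' gx gP]]]] := critical_coloring (hcrit i) (hchi i).
have colP p q : p != x -> q != x -> sedge p q -> g p != g q.
  move=> px qx pq; apply/eqP=> gpq; have /setP/(_ x) := gP p q pq gpq.
  by rewrite !inE eqxx [x == p]eq_sym [x == q]eq_sym (negbTE px) (negbTE qx).
have [||||||||f [finj fhom f_x fU]] := @greedy_embed R (F i) G (@sedge (F i)) (@sedge G)
  (@sedge_sym _) (@sedge_irrefl _) (@sedge_sym _) y kap eta r g
  (fun j => nb (@sedge G) v :&: U j) Z [set x] (fun=> v).
- by [].
- by [].
- by [].
- by move=> p q /set1P -> /set1P ->; rewrite eqxx.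
- by move=> p q; rewrite !inE => px qx; exact: colP.
- move=> j k u jk /setIP[_ uU]; apply: le_trans (missU jk uU); apply: wt_sub => //.
  by apply: setSD; exact: subsetIr.
- move=> p z _ _ _; rewrite (_ : _ :\: _ = set0) ?/wt ?big_set0 //.
  by apply/setP=> w; rewrite !inE; case: (sedge v w).
- by move=> j; apply: le_lt_trans (big j); exact: small.
exists f; split=> // u; have [->|ux] := eqVneq u x; first by rewrite f_x ?inE.
by have := fU u; rewrite !inE ux => /(_ isT) /andP[].
Qed.

(** [u] and [v] play the roles of the ends of the critical edge. The colours are
    permuted to give them the colour [j], and the other vertices are placed greedily in
    the parts. *)
Lemma edge_gadget u v j : sedge u v ->
  (forall k, k != j -> wt y (U k :\: nb (@sedge G) u) <= eta) ->
  (forall k, k != j -> wt y (U k :\: nb (@sedge G) v) <= eta) ->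
  (forall k, budget < wt y (U k)) -> gadget F [set u; v].
Proof.
move=> uv mu mv big i Z Zs dZ.
have uvZ w : w \in [set u; v] -> w \notin Z.
  move=> wuv; apply: contraTN dZ => wZ; rewrite -setI_eq0; apply/set0Pn; exists w.
  by rewrite inE wZ.
have [x [x' [g [xx' gx gP]]]] := critical_coloring (hcrit i) (hchi i).
have nxx' : x' != x by apply: contraTneq xx' => ->; rewrite sedge_irrefl.
pose g' p := tperm (g x) j (g p).
have colP p q : p \notin [set x; x'] -> sedge p q -> g' p != g' q.
  move=> pX pq; rewrite (inj_eq perm_inj); apply/eqP=> gpq.
  have /setP/(_ p) := gP p q pq gpq; rewrite (negbTE pX) !inE eqxx //.
have [||||||||f [finj fhom f_x fU]] := @greedy_embed R (F i) G (@sedge (F i)) (@sedge G)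
  (@sedge_sym _) (@sedge_irrefl _) (@sedge_sym _) y kap eta r g' U Z [set x; x']
  (fun p => if p == x then u else v).
- by [].
- by [].
- by [].
- move=> p q /set2P[->|->] /set2P[->|->]; rewrite ?eqxx // (negbTE nxx') => _; split=> //.
  + by apply: contraTneq uv => ->; rewrite sedge_irrefl.
  + by rewrite eq_sym; apply: contraTneq uv => ->; rewrite sedge_irrefl.
  + by rewrite [sedge v u]sedge_sym.
- by move=> p q; rewrite !(in_setC) => pX _; exact: colP.
- exact: missU.
- move=> p z pX; rewrite in_setC => zX pz.
  have gz : g' z != j.
    have -> : j = g' p.
      by rewrite /g'; case/set2P: pX => ->; rewrite -?gx tpermL.
    by apply: colP => //; rewrite sedge_sym.
  by case: ifP => _; [exact: mu|exact: mv].
- by move=> k; apply: le_lt_trans (big k); exact: small.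
exists f; split=> // w; case: (boolP (w \in [set x; x'])) => wX.
  by rewrite f_x //; case: ifP => _; apply: uvZ; rewrite !inE eqxx ?orbT.
by have := fU w; rewrite !in_setC in_setD => /(_ wX) /andP[].
Qed.
End Weights.

(** The case of [apex_gadget] where all the weights are 1, the parts are the classes of
    the blow-up and [eta] is 0. *)
Lemma blowup_apex (G : sgraph) (v : G) :
  has_blowup (@sedge G) (nb (@sedge G) v) r (3 * total + 2 * t).+1 -> gadget F [set v].
Proof.
move=> [W [cW sW eW]].
apply: (@apex_gadget G (fun=> 1) 1 0 W) => // [i j u ij uW|i].
  rewrite (_ : _ :\: _ = set0) ?/wt ?big_set0 //.
  apply/setP=> w; rewrite !inE; apply/negP=> /andP[nuw wW].
  by rewrite (eW i j ij u w uW wW) in nuw.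
rewrite (setIidPr (sW i)) mul0rn add0r wt_const1 cW.
by rewrite ltr_nat.
Qed.

Lemma blowup_contains (G : sgraph) :
  has_blowup (@sedge G) [set: G] r.+1 (#|disjoint_union F|).+1 ->
  sg_contains G (disjoint_union F).
Proof.
move=> [W [cW sW eW]].
have colF i : exists g : F i -> 'I_r.+1, forall u v, sedge u v -> g u != g v.
  by apply/colorableP; rewrite chi_colorable hchi addn1.
pose g (p : disjoint_union F) := sval (cid (colF (tag p))) (tagged p).
have gP p q : sedge p q -> g p != g q.
  move: p q => [i u] [j v] /=; rewrite /disjoint_union_rel /= => /andP[/eqP ij].
  move: ij v => <- v; rewrite tagged_asE /g /=; exact: (svalP (cid (colF i))).
have [w0 _] : exists w, w \in W ord0 by apply/card_gt0P; rewrite cW.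
have [||||||||f [finj fhom _ _]] := @greedy_embed R (disjoint_union F) G
  (@sedge (disjoint_union F)) (@sedge G)
  (@sedge_sym _) (@sedge_irrefl _) (@sedge_sym _) (fun=> 1) 1 0 r.+1 g W set0 set0 (fun=> w0).
- by [].
- by [].
- by [].
- by move=> p q; rewrite inE.
- by move=> p q _ _; exact: gP.
- move=> i j u ij uW; rewrite (_ : _ :\: _ = set0) ?/wt ?big_set0 //.
  apply/setP=> w; rewrite !inE; apply/negP=> /andP[nuw wW].
  by rewrite (eW i j ij u w uW wW) in nuw.
- by move=> p z; rewrite inE.
- move=> j; rewrite mul0rn add0r wt_const1 cW cards0 add0n.
  by rewrite ltr_nat.
by exists f.
Qed.

(** Many cliques on [r+1] vertices would yield a large blow-up of the complete graph on
    [r+1] vertices, which contains every [(r+1)]-colourable graph of bounded order. *)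
Lemma few_cliques del : 0 < del -> exists2 kap, 0 < kap &
  forall (G : sgraph) (y : G -> R), sg_free (disjoint_union F) G ->
    (forall v, 0 <= y v) -> (forall v, y v <= kap) -> wt y [set: G] <= 1 ->
    ocl (@sedge G) y r.+1 [set: G] < del.
Proof.
move=> del0; have [kap kap0 H] := blowup_exists r.+1 (ltn0Sn #|disjoint_union F|) del0.
exists kap => // G y free y0 yk y1; rewrite ltNge; apply/negP=> h; apply: free.
by apply: blowup_contains; apply: (H G (@sedge G) y) => //; [exact: sedge_sym|exact: sedge_irrefl].
Qed.

Lemma few_cliques_nb del : 0 < del -> exists2 kap, 0 < kap &
  forall (G : sgraph) (y : G -> R) (v : G), ~ gadget F [set v] ->
    (forall v, 0 <= y v) -> (forall v, y v <= kap) -> wt y [set: G] <= 1 ->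
    ocl (@sedge G) y r (nb (@sedge G) v) < del.
Proof.
move=> del0; have [kap kap0 H] := blowup_exists r (ltn0Sn (3 * total + 2 * t)) del0.
exists kap => // G y v ng y0 yk y1; rewrite ltNge; apply/negP=> h; apply: ng.
apply: blowup_apex; apply: (H G (@sedge G) y) => //; [exact: sedge_sym|exact: sedge_irrefl|].
by apply: le_trans (wt_sub y0 (subsetT _)) y1.
Qed.
End Embeddings.

(** * Large degrees, matchings, and the parts of a clique *)

Section Degree.
Variable R : realFieldType.

Lemma turan_density_rec r m : (2 <= r)%N ->
  turan_density R r m.+1 = turan_density R r.-1 m * (1 - r%:R^-1) ^+ m.
Proof.
move=> r2; have rR : r%:R != 0 :> R by rewrite pnatr_eq0; lia.
have rR' : r.-1%:R != 0 :> R by rewrite pnatr_eq0; lia.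
rewrite /turan_density -(big_mkord xpredT (fun i => 1 - i%:R / r%:R)) big_nat_recl //.
rewrite big_mkord mul0r subr0 mul1r -[m in _ ^+ m]card_ord -prodr_const.
rewrite -big_split /=; apply: eq_bigr => i _.
have -> : r%:R = r.-1%:R + 1 :> R by rewrite natr1 prednK //; lia.
rewrite -natr1; field.
by rewrite natr1 prednK ?rR ?rR' //; lia.
Qed.

(** With few [r]-cliques in the neighbourhood of [v], [clique_density_upper] bounds its
    [m]-clique sum by the density of the [(r-1)]-partite Turan graph times the [m]-th
    power of its weight. This reaches the prescribed value only if the weight is nearly
    [1 - 1 / r]. *)
Lemma degree_lower r m (ep1 : R) : (2 <= r)%N -> (0 < m)%N -> (m < r)%N -> 0 < ep1 ->
  exists del eps, [/\ 0 < del, 0 < eps & forall (T : finType) (e : rel T) (y : T -> R) v,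
    symmetric e -> irreflexive e -> (forall v, 0 <= y v) -> wt y [set: T] = 1 ->
    ocl e y r (nb e v) <= del ->
    turan_density R r m.+1 - eps <= ocl e y m (nb e v) ->
    wt y ([set: T] :\: nb e v) <= r%:R^-1 + ep1].
Proof.
move=> r2 m0 mr ep0; pose a : R := 1 - r%:R^-1.
have rR : 0 < r%:R :> R by rewrite ltr0n; lia.
have a0 : 0 < a by rewrite subr_gt0 invf_lt1 // ltr1n.
pose p := turan_density R r.-1 m.
have p0 : 0 < p by apply: turan_density_gt0; lia.
pose gap := p * (a ^+ m.-1 * ep1).
have gap0 : 0 < gap by rewrite !mulr_gt0 ?exprn_gt0.
have [||| del del0 H] := @clique_density_upper R r.-1 m (gap / 4); try lia.
  by rewrite divr_gt0.
exists del, (gap / 4); split=> //; first by rewrite divr_gt0.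
move=> T e y v e_sym e_irr y0 y1 few many.
have W1 : wt y (nb e v) <= 1 by rewrite -y1 wt_sub ?subsetT.
have W0 : 0 <= wt y (nb e v) by exact: wt_ge0.
have up : ocl e y m (nb e v) <= p * wt y (nb e v) ^+ m + gap / 4.
  by apply: H => //; rewrite prednK //; lia.
rewrite turan_density_rec // -/p -/a in many.
have -> : wt y ([set: T] :\: nb e v) = 1 - wt y (nb e v).
  by rewrite -y1 (wtI y setT (nb e v)) setTI addrC addKr.
rewrite leNgt; apply/negP=> lt.
have Wa : wt y (nb e v) <= a - ep1 by rewrite /a; lra.
have ae0 : 0 <= a - ep1 by exact: le_trans Wa.
have : wt y (nb e v) ^+ m <= (a - ep1) * a ^+ m.-1.
  apply: le_trans (_ : (a - ep1) ^+ m <= _).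
    by rewrite lerXn2r // nnegrE.
  rewrite -{1}(prednK m0) exprS ler_wpM2l // lerXn2r ?nnegrE //; first exact: ltW.
  by rewrite gerBl ltW.
move=> /(ler_wpM2l (ltW p0)).
have mE : a ^+ m = a * a ^+ m.-1 by rewrite -exprS prednK.
rewrite mE in many; rewrite /gap in many up gap0; lra.
Qed.
End Degree.

Section Matching.
Variables (T : finType) (q : rel T).
Hypothesis q_irr : irreflexive q.

(** The vertices of a maximal matching cover all the edges. *)
Lemma matching_cover k :
  (exists ss : seq {set T}, [/\ size ss = k, pairwise (fun a b : {set T} => [disjoint a & b]) ss &
     {in ss, forall g, exists u v, q u v /\ g = [set u; v]}]) \/
  exists2 D : {set T}, (#|D| <= 2 * k)%N & forall u v, q u v -> u \in D \/ v \in D.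
Proof.
elim: k => [|k [[ss [sz dis pr]]|[D cD covD]]]; first by left; exists [::].
  pose D := \bigcup_(g <- ss) g.
  have cD : (#|D| <= 2 * k)%N.
    rewrite -sz /D; elim: ss {sz dis D} pr => [|g ss IH] pr; first by rewrite big_nil cards0.
    rewrite big_cons; apply: leq_trans (leq_card_setU _ _).1 _; rewrite mulnS leq_add //.
      by have [u [v [_ ->]]] := pr g (mem_head _ _); rewrite cards2; case: (_ != _).
    by apply: IH => g' g's; apply: pr; rewrite inE g's orbT.
  have [/existsP[u /existsP[v /and3P[uv uD vD]]]|/existsPn h] :=
     boolP [exists u, exists v, [&& q u v, u \notin D & v \notin D]].
    left; exists ([set u; v] :: ss); split; first by rewrite /= sz.
      rewrite pairwise_cons dis andbT; apply/allP=> g gs.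
      rewrite disjoint_sym -setI_eq0; apply/eqP/setP=> w; rewrite !inE; apply/negP=> /andP[wg].
      have wD : w \in D by rewrite /D bigcup_seq; apply/bigcupP; exists g.
      by case/orP=> /eqP wE; rewrite -wE wD in uD vD.
    by move=> g /predU1P[->|/pr//]; exists u, v.
  right; exists D; first by apply: leq_trans cD _; rewrite leq_mul2l leqnSn orbT.
  move=> u v uv; have /existsPn/(_ v) := h u; rewrite uv /= negb_and !negbK.
  by case/orP; [left|right].
right; exists D => //; apply: leq_trans cD _; rewrite leq_mul2l leqnSn orbT //.
Qed.
End Matching.

Section Partition.
Variables (R : realFieldType) (T : finType) (e : rel T) (y : T -> R) (r : nat).
Hypotheses (e_sym : symmetric e) (e_irr : irreflexive e).
Hypotheses (y0 : forall v, 0 <= y v) (y1 : wt y [set: T] = 1) (r0 : (0 < r)%N).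
Variables (A S : {set T}) (w : 'I_r -> T) (ep1 beta th1 al : R).
Hypotheses (ep0 : 0 <= ep1) (beta0 : 0 <= beta) (th0 : 0 < th1) (hA : wt y A <= al).
Hypothesis hdeg : forall u, u \notin A -> wt y ([set: T] :\: nb e u) <= r%:R^-1 + ep1.
Hypotheses (w_inj : injective w) (wS : S = [set w i | i in [set: 'I_r]]).
Hypothesis (wA : forall i, w i \notin A).
Hypotheses (hS : wt y (cnb e S) <= beta).
Hypotheses (hE : forall i, edge_ext e y (S :\ w i) <= beta).

(** The vertices that may replace [w i] in the clique [S], without being adjacent to it:
    a first approximation of the part of [w i]. *)
Definition raw_part i := cnb e (S :\ w i) :\: nb e (w i).
(** The vertices with many neighbours in their own raw part are few, since [edge_ext] is
    small; once they are removed, a vertex sees almost all of the other parts. *)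
Definition good_part i :=
  [set z in raw_part i :\: A | wt y (raw_part i :&: nb e z) < th1].

Let rR : 0 < r%:R :> R. Proof. by rewrite ltr0n. Qed.

Lemma wt_setC U : wt y U = 1 - wt y (~: U).
Proof. by rewrite -y1 (wtI y setT U) setTI setTD; ring. Qed.

(** Each of the other [r - 1] vertices of [S] excludes at most [1 / r + ep1], and the
    vertices adjacent to all of [S] weigh at most [beta]. *)
Lemma raw_part_ge i : r%:R^-1 - r%:R * ep1 - beta <= wt y (raw_part i).
Proof.
have wiS : w i \in S by rewrite wS imset_f ?inE.
have h1 : wt y (~: cnb e (S :\ w i)) <= (r%:R - 1) * (r%:R^-1 + ep1).
  apply: le_trans (_ : wt y (\bigcup_(j | j != i) ([set: T] :\: nb e (w j))) <= _).
    apply: wt_sub => //; apply/subsetP=> z; rewrite !inE => /forall_inPn[v /setD1P[vi vS] nvz].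
    move: vS vi nvz; rewrite wS => /imsetP[j _ ->] ji njz.
    by apply/bigcupP; exists j; rewrite ?inE ?njz //; apply: contraNneq ji => ->.
  apply: le_trans (wt_bigcup _ _ y0) _.
  apply: le_trans (_ : \sum_(j < r | j != i) (r%:R^-1 + ep1) <= _).
    by apply: ler_sum => j _; exact: hdeg.
  rewrite sumr_const -[leLHS]mulr_natl ler_wpM2r ?addr_ge0 ?invr_ge0 //.
  by rewrite cardC1 card_ord -subn1 natrB.
have h2 : wt y (cnb e (S :\ w i) :&: nb e (w i)) <= beta.
  apply: le_trans hS; apply: wt_sub => //; apply/subsetP=> z; rewrite inE in_nb.
  case/andP=> /cnbP hz wz; apply/cnbP=> v vS.
  by have [->//|vi] := eqVneq v (w i); apply: hz; rewrite !inE vi.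
have := wt_setC (cnb e (S :\ w i)); rewrite (wtI y _ (nb e (w i))) -/(raw_part i).
have h1E : (r%:R - 1) * (r%:R^-1 + ep1) = 1 - r%:R^-1 + (r%:R - 1) * ep1.
  by rewrite mulrDr mulrBl mulfV ?gt_eqF // mul1r.
rewrite h1E in h1; move: h1 h2 ep0; set a := wt y _; set b := wt y _; set c := wt y _.
set x := r%:R; set x' := x^-1; lra.
Qed.

Lemma good_part_ge i :
  r%:R^-1 - r%:R * ep1 - beta - beta / th1 - al <= wt y (good_part i).
Proof.
pose bad := [set z in raw_part i | th1 <= wt y (raw_part i :&: nb e z)].
have hbad : wt y bad <= beta / th1.
  rewrite ler_pdivlMr //; apply: le_trans (hE i).
  rewrite /wt mulr_suml; apply: le_trans (_ : \sum_(z in bad) y z * wt y (raw_part i :&: nb e z) <= _).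
    by apply: ler_sum => z; rewrite inE => /andP[_ hz]; rewrite ler_wpM2l.
  have sub : raw_part i \subset cnb e (S :\ w i) by exact: subsetDl.
  apply: le_trans (_ : \sum_(z in bad) y z * wt y (cnb e (S :\ w i) :&: nb e z) <= _).
    by apply: ler_sum => z _; rewrite ler_wpM2l // wt_sub // setSI.
  apply: ler_sum_subset => [z|z _]; last by rewrite mulr_ge0 ?wt_ge0.
  by rewrite inE => /andP[/(subsetP sub)].
have : raw_part i \subset (good_part i :|: bad) :|: A.
  apply/subsetP=> z zr; rewrite 2!in_setU.
  case: (boolP (z \in A)) => zA; rewrite ?orbT // orbF.
  case: (ltP (wt y (raw_part i :&: nb e z)) th1) => hz.
    by apply/orP; left; rewrite in_set in_setD zA zr.
  by apply/orP; right; rewrite in_set zr.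
move/(wt_sub y0) => h; have h1 := wtU y0 (good_part i :|: bad) A.
have h2 := wtU y0 (good_part i) bad; have := raw_part_ge i; move: hA hbad h h1 h2.
set c := beta / th1; set a := wt y _; set b := wt y _; set d := wt y _; lra.
Qed.

(** [u] misses at most [1 / r + ep1] in all, and its own part uses up almost all of
    this. *)
Lemma good_part_miss i j u : i != j -> u \in good_part i ->
  wt y (good_part j :\: nb e u) <= (r%:R + 1) * ep1 + beta + th1.
Proof.
move=> ij; rewrite !inE => /andP[/andP[uA uV] hu].
have dis : [disjoint raw_part j & raw_part i].
  rewrite -setI_eq0; apply/eqP/setP=> z; rewrite !inE; apply/negP=> /andP[/andP[nj _] /andP[_ hi]].
  move/forall_inP: hi => /(_ (w j)); rewrite !inE (inj_eq w_inj) eq_sym ij wS imset_f ?inE //.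
  by move=> /(_ isT); rewrite (negbTE nj).
have sub : good_part j :\: nb e u \subset ([set: T] :\: nb e u) :\: (raw_part i :\: nb e u).
  apply/subsetP=> z /setDP[]; rewrite inE => /andP[/setDP[zV _] _] znu.
  apply/setDP; split; first by rewrite in_setD znu in_setT.
  by rewrite in_setD (disjointFr dis zV) andbF.
apply: le_trans (wt_sub y0 sub) _.
have h := wtI y ([set: T] :\: nb e u) (raw_part i :\: nb e u).
have hI : ([set: T] :\: nb e u) :&: (raw_part i :\: nb e u) = raw_part i :\: nb e u.
  by apply/setIidPr; apply: setSD; exact: subsetT.
rewrite hI in h; have h2 := wtI y (raw_part i) (nb e u).
have := hdeg uA; have := raw_part_ge i; move: h h2 hu; rewrite -/(raw_part i).
set a := wt y _; set b := wt y _; set c := wt y _; set d := wt y _; set x := wt y (_ :&: _).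
lra.
Qed.

Lemma good_part_disjoint i j : i != j -> [disjoint good_part i & good_part j].
Proof.
move=> ij; rewrite -setI_eq0; apply/eqP/setP=> z; rewrite !inE; apply/negP.
case/andP=> /andP[/andP[_ /andP[ni _]] _] /andP[/andP[_ /andP[_ hj]] _].
move/forall_inP: hj => /(_ (w i)); rewrite !inE (inj_eq w_inj) ij wS imset_f ?inE //.
by move=> /(_ isT); rewrite (negbTE ni).
Qed.

Lemma good_part_notA i u : u \in good_part i -> u \notin A.
Proof. by rewrite !inE => /andP[/andP[]]. Qed.
End Partition.

(** * Structure under nearly uniform weights *)

Section Structure.
Variables (R : realType) (t r m : nat) (F : 'I_t -> sgraph).
Hypotheses (hcrit : forall i, color_critical (F i)) (hchi : forall i, chi (F i) = (r + 1)%N).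
Hypotheses (r2 : (2 <= r)%N) (m0 : (0 < m)%N) (mr : (m < r)%N).
Local Notation total := (total_size F).

Lemma gadget_count (G : sgraph) (A : {set G}) (ss : seq {set G}) :
  sg_free (disjoint_union F) G -> {in A, forall a, gadget F [set a]} ->
  pairwise (fun a b : {set G} => [disjoint a & b]) ss ->
  {in ss, forall g, [/\ gadget F g, (#|g| <= 2)%N & [disjoint A & g]]} ->
  (#|A| + size ss < t)%N.
Proof.
move=> free hA dis hss; rewrite ltnNge; apply/negP=> tA.
apply: (@no_gadgets t F G ([seq [set a] | a <- enum A] ++ ss) free).
- by rewrite size_cat size_map -cardE.
- rewrite pairwise_cat dis andbT; apply/andP; split.
    apply/allrelP=> g g' /mapP[a aA ->] g's; have [_ _ dA] := hss g' g's.
    rewrite -setI_eq0; apply/eqP/setP=> v; rewrite !inE; apply/negP=> /andP[/eqP -> ag].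
    by rewrite mem_enum in aA; rewrite (disjointFr dA aA) in ag.
  rewrite pairwise_map; have := enum_uniq (mem A); rewrite uniq_pairwise.
  apply: sub_pairwise => a b ab; rewrite /= -setI_eq0; apply/eqP/setP=> v; rewrite !inE.
  by apply/negP=> /andP[/eqP -> /eqP eab]; move: ab; rewrite /= eab eqxx.
move=> g; rewrite mem_cat => /orP[/mapP[a aA ->]|gs]; last by have [? ? _] := hss g gs.
by rewrite cards1; split=> //; apply: hA; rewrite mem_enum in aA.
Qed.

Definition colour_class (G : sgraph) (A : {set G}) (f : G -> 'I_r) i : {set G} :=
  [set v | (v \notin A) && (f v == i)].

(** [A] consists of the vertices that are gadgets by themselves. The faces of a good
    [r]-clique define [r] parts. A vertex outside [A] with many neighbours in every part
    would be a gadget by [apex_gadget]; so it has few neighbours in some part, its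
    colour [f], and as its degree is about [1 - 1 / r] by [degree_lower], it sees almost
    all of the other parts. Hence an edge inside a colour class is a gadget by
    [edge_gadget]; such edges contain no matching of size [t - #|A|], which gives the
    cover [D], and there are none if [#|A| = t - 1]. *)
Lemma near_uniform_structure (th : R) : 0 < th ->
  exists eps kap, [/\ 0 < eps, 0 < kap &
  forall (G : sgraph) (y : G -> R), sg_free (disjoint_union F) G ->
    (forall v, 0 <= y v) -> wt y [set: G] = 1 -> (forall v, y v <= kap) ->
    (forall v, turan_density R r m.+1 - eps <= ocl (@sedge G) y m (nb (@sedge G) v)) ->
    exists (A D : {set G}) (f : G -> 'I_r),
    [/\ (#|A| < t)%N, (#|D| <= 2 * t)%N,
      forall u v, u \notin A -> v \notin A -> sedge u v -> f u = f v ->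
         (#|A|.+1 < t)%N /\ (u \in D \/ v \in D),
      forall u, u \notin A -> wt y (nb (@sedge G) u :&: colour_class A f (f u)) <= th &
      forall i, r%:R^-1 - th <= wt y (colour_class A f i) <= r%:R^-1 + th]].
Proof.
move=> th_gt0; set x : R := r%:R^-1.
have r0 : (0 < r)%N by lia.
have rR : 0 < r%:R :> R by rewrite ltr0n.
have rR2 : 2 <= r%:R :> R by rewrite ler_nat.
have x0 : 0 < x by rewrite invr_gt0.
have rx : r%:R * x = 1 by rewrite mulfV ?gt_eqF.
(* Greedy embeddings have fewer than [q] steps. [T / 2] is the weight of neighbours that
   a vertex may have in its own part; the errors [tau] and [th1] are small compared with
   [T] even when multiplied by [q], and so is [r%:R * tau]. *)
pose q : R := total%:R + 1.
have q1 : 1 <= q by rewrite lerDr.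
have q0 : 0 < q by lra.
have Nq : total%:R <= q by rewrite /q lerDl.
pose T := Num.min th (x / (8 * q)).
have T0 : 0 < T by rewrite lt_min th_gt0 divr_gt0 // mulr_gt0.
have T_th : T <= th by rewrite /T ge_min lexx.
have qT : 8 * (q * T) <= x.
  rewrite mulrA -ler_pdivlMl ?mulr_gt0 // mulrC /T ge_min; apply/orP; right; exact: lexx.
have T8 : 8 * T <= x by apply: le_trans qT; rewrite ler_pM2l // ler_peMl // ltW.
have x1 : x <= 1 by rewrite invf_le1 // ler1n.
pose tau := T / (16 * (q * r%:R)).
have qr0 : 0 < q * r%:R by rewrite mulr_gt0.
have tau0 : 0 < tau by rewrite divr_gt0 // mulr_gt0.
have tauE : 16 * (q * r%:R * tau) = T.
  by rewrite mulrA mulrC /tau divfK // gt_eqF // mulr_gt0.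
have qtau : 32 * (q * tau) <= T.
  by have := ler_wpM2r (ltW (mulr_gt0 q0 tau0)) rR2; lra.
have rtau : 16 * (r%:R * tau) <= T.
  by have := ler_wpM2r (ltW (mulr_gt0 rR tau0)) q1; lra.
have tau_T : 32 * tau <= T.
  by have := ler_wpM2r (ltW tau0) q1; lra.
pose th1 := T / (8 * q).
have th1_0 : 0 < th1 by rewrite divr_gt0 // mulr_gt0.
have qth1 : q * th1 = T / 8 by rewrite /th1; field; rewrite gt_eqF.
have th1_T : 8 * th1 <= T.
  by have := ler_wpM2r (ltW th1_0) q1; lra.
(* The vertices rejected from a raw part weigh at most [beta / th1]. *)
pose beta := tau * th1.
have beta0 : 0 < beta by rewrite mulr_gt0.
have beta_th1 : beta / th1 = tau by rewrite /beta mulfK // gt_eqF.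
have beta_tau : beta <= tau.
  by rewrite /beta ler_piMr ?(ltW tau0) //; lra.
pose ep1 := tau / (r%:R + 1).
have ep1_0 : 0 < ep1 by rewrite divr_gt0 // addr_gt0.
have ep1_r : (r%:R + 1) * ep1 = tau by rewrite mulrC divfK // gt_eqF // addr_gt0.
have rep1 : 0 < r%:R * ep1 by rewrite mulr_gt0.
have [del1 [eps1 [del1_0 eps1_0 hdegree]]] := degree_lower r2 m0 mr ep1_0.
have [kap1 kap1_0 hfew_nb] := few_cliques_nb hcrit hchi del1_0.
have [|kapL [epsL [kapL_0 epsL_0 hmany]]] := @clique_density_lower R r m.+1 _ mr.
  by rewrite ltnS.
have fact0 : 0 < r`!%:R :> R by rewrite ltr0n fact_gt0.
pose kL := kapL / r`!%:R.
have kL0 : 0 < kL by rewrite divr_gt0.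
pose del2 := beta * (kL / 2) / (r.+1%:R ^+ 2).
have r12 : 0 < r.+1%:R ^+ 2 :> R by rewrite exprn_gt0.
have del2_0 : 0 < del2 by rewrite !divr_gt0 // mulr_gt0 // divr_gt0.
have [kap2 kap2_0 hfew] := few_cliques hchi del2_0.
have [M0 M0_gt leM0] : exists2 M0 : nat, (0 < M0)%N &
    forall k, (k <= 3 * total + 3 * t)%N -> (k <= M0)%N.
  by exists (3 * total + 3 * t).+1 => // k /leqW.
(* In weights at most [kap], sets of bounded size are negligible against both [tau] and
   the weight [kL] of the [r]-cliques. *)
pose kap := Num.min (Num.min kap1 kap2) (Num.min (tau / M0%:R) (kL / 2 / M0%:R)).
have M0R : 0 < M0%:R :> R by rewrite ltr0n.
have kap0 : 0 < kap.
  by rewrite !lt_min kap1_0 kap2_0 (divr_gt0 tau0 M0R) (divr_gt0 (divr_gt0 kL0 _) M0R).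
have kap_k1 : kap <= kap1 by rewrite /kap !ge_min lexx.
have kap_k2 : kap <= kap2 by rewrite /kap !ge_min lexx orbT.
have kapM k : (k <= 3 * total + 3 * t)%N -> kap *+ k <= tau /\ kap *+ k <= kL / 2.
  move=> hk; have kM : k%:R <= M0%:R :> R by rewrite ler_nat leM0.
  have hkap : kap *+ k <= kap * M0%:R by rewrite -[leLHS]mulr_natr ler_pM2l.
  split; apply: le_trans hkap _; rewrite -ler_pdivlMr //.
    by rewrite /kap !ge_min lexx !orbT.
  by rewrite /kap !ge_min lexx !orbT.
exists (Num.min eps1 epsL), kap; split=> //; first by rewrite lt_min eps1_0 epsL_0.
move=> G y free y0 y1 yk hv.
pose e := @sedge G; have e_sym : symmetric e := @sedge_sym G.
have e_irr : irreflexive e := @sedge_irrefl G.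
have y1' : wt y [set: G] <= 1 by rewrite y1.
pose A := [set v : G | `[< gadget F [set v] >]].
have AP v : v \in A -> gadget F [set v] by rewrite inE => /asboolP.
have cA : (#|A| < t)%N.
  by have := @gadget_count G A [::] free AP isT; rewrite addn0; apply=> g.
have hdeg u : u \notin A -> wt y ([set: G] :\: nb e u) <= x + ep1.
  rewrite inE => /asboolP nu; apply: hdegree => //.
    by apply/ltW/hfew_nb => // v; exact: le_trans kap_k1.
  by apply: le_trans (hv u); rewrite lerD2l lerN2 ge_min lexx.
have wtA : wt y A <= kap *+ t.
  by apply: le_trans (wt_card_le _ yk) _; apply: ler_wpMn2l; [exact: ltW|exact: ltnW].
have [wtA_tau wtA_kL] : kap *+ t <= tau /\ kap *+ t <= kL / 2.
  by apply: kapM; apply: leq_trans (leq_addl _ _); rewrite leq_pmull.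
have dens : kapL <= ocl e y r [set: G].
  apply: hmany => //; rewrite (oclSE y e_sym e_irr).
  have hc : turan_density R r m.+1 - epsL <= turan_density R r m.+1 - Num.min eps1 epsL.
    by rewrite lerD2l lerN2 ge_min lexx orbT.
  apply: le_trans hc _; rewrite -[leLHS]mul1r -y1 /wt mulr_suml.
  by apply: ler_sum => u _; rewrite setTI ler_wpM2l // hv.
have rE : r = r.-1.+1 by rewrite prednK.
have [S [cS dSA hS hE]] : exists S : {set G}, [/\ clique_in e r [set: G] S,
    [disjoint S & A], wt y (cnb e S) <= beta &
    {in S, forall v, edge_ext e y (S :\ v) <= beta}].
  have := @good_clique R G e y e_sym e_irr y0 y1' r.-1 A beta beta0; rewrite -rE; apply.
  have p1 : cl e y r.+1 [set: G] < del2.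
    apply: le_lt_trans (cl_le_ocl e y0 r.+1 _) _; apply: hfew => // v.
    exact: le_trans kap_k2.
  have p2 : kL <= cl e y r [set: G].
    by rewrite /kL ler_pdivrMr // mulrC.
  apply: lt_le_trans (_ : r.+1%:R ^+ 2 * del2 <= _); first by rewrite ltr_pM2l.
  rewrite /del2 mulrC divfK ?gt_eqF // ler_pM2l //; lra.
have cardS : #|S| = r by case/and3P: cS => _ /eqP.
pose w (i : 'I_r) : G := enum_val (cast_ord (esym cardS) i).
have w_inj : injective w by move=> i j /enum_val_inj/cast_ord_inj.
have wS : S = [set w i | i in [set: 'I_r]].
  apply/setP=> v; apply/idP/imsetP=> [vS|[i _ ->]]; last exact: enum_valP.
  exists (cast_ord cardS (enum_rank_in vS v)); rewrite ?inE // /w cast_ord_comp cast_ord_id.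
  by rewrite enum_rankK_in.
have wiS i : w i \in S by exact: enum_valP.
have wiA i : w i \notin A by rewrite (disjointFr dSA (wiS i)).
have hEi i : edge_ext e y (S :\ w i) <= beta by exact: hE.
pose U := good_part e y A S w th1.
have U_ge i : x - 4 * tau <= wt y (U i).
  have := good_part_ge y0 y1 r0 (ltW ep1_0) th1_0 wtA hdeg wS wiA hS hEi i.
  rewrite -/U beta_th1 -/x => h; apply: le_trans h.
  by clear -ep1_r ep1_0 beta_tau wtA_tau; lra.
have missU i j u : i != j -> u \in U i -> wt y (U j :\: nb e u) <= 2 * tau + th1.
  move=> ij uU; apply: le_trans (good_part_miss y0 y1 r0 (ltW ep1_0) hdeg w_inj wS wiA hS ij uU) _.
  by rewrite ep1_r; clear -beta_tau; lra.
have Udis i j : i != j -> [disjoint U i & U j] by exact: good_part_disjoint.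
have UA i u : u \in U i -> u \notin A by exact: good_part_notA.
have NM (eta : R) : 0 <= eta ->
    eta *+ total + kap *+ (3 * total + 2 * t) <= q * eta + tau.
  move=> eta0; apply: lerD; first by rewrite -mulr_natl ler_wpM2r.
  have [|//] := kapM (3 * total + 2 * t)%N.
  by rewrite leq_add2l leq_mul2r orbT.
have hpi u : u \notin A -> exists i, wt y (nb e u :&: U i) < T / 2.
  move=> uA; apply/existsP; apply: contraT => /existsPn h.
  move: uA; rewrite inE => /asboolP; case.
  have eta0 : 0 <= 2 * tau + th1 by clear -tau0 th1_0; lra.
  apply: (apex_gadget hcrit hchi y0 yk eta0 missU) => i.
  apply: le_lt_trans (NM _ eta0) _; have := h i; rewrite -leNgt; apply: lt_le_trans.
  by rewrite mulrDr qth1; clear -qtau tau_T tau0 T0; lra.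
pose f (u : G) : 'I_r :=
  if [pick i | wt y (nb e u :&: U i) < T / 2] is Some i then i else Ordinal r0.
have fP u : u \notin A -> wt y (nb e u :&: U (f u)) < T / 2.
  rewrite /f => uA; case: pickP => [//|h]; have [i hi] := hpi u uA.
  by rewrite (h i : (_ < _) = false) in hi.
have missf u j : u \notin A -> j != f u -> wt y (U j :\: nb e u) <= 5 * tau + T / 2.
  move=> uA jf; have h1 := hdeg u uA.
  have h2 : wt y (U j :\: nb e u) + wt y (U (f u) :\: nb e u) <= wt y ([set: G] :\: nb e u).
    rewrite (wtI y ([set: G] :\: nb e u) (U j)); apply: lerD; apply: wt_sub => //.
      apply/subsetP=> z /setDP[zU zn]; apply/setIP; split=> //.
      by apply/setDP; split=> //; exact: in_setT.
    apply/subsetP=> z /setDP[zU zn]; apply/setDP; split.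
      by apply/setDP; split=> //; exact: in_setT.
    by rewrite (disjointFl (Udis _ _ jf) zU).
  have h3 := fP u uA; have h4 := wtI y (U (f u)) (nb e u); rewrite setIC in h3.
  have h5 := U_ge (f u).
  by clear -h1 h2 h3 h4 h5 ep1_r rep1; lra.
have inner u v : u \notin A -> v \notin A -> e u v -> f u = f v -> gadget F [set u; v].
  move=> uA vA uv fuv.
  have eta0 : 0 <= 5 * tau + T / 2 by clear -tau0 T0; lra.
  apply: (edge_gadget hcrit hchi (j := f u) y0 yk eta0 _ uv) => [i j z ij zU|k|k|k].
  - by apply: le_trans (missU i j z ij zU) _; clear -tau0 T0 th1_T; lra.
  - exact: missf.
  - by rewrite fuv; exact: missf.
  - apply: le_lt_trans (NM _ eta0) _; apply: lt_le_trans (U_ge k).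
    by rewrite mulrDr; clear -qT qtau T8 T0 tau_T; lra.
pose P := colour_class A f.
have UP i : U i \subset P i.
  apply/subsetP=> z zU; have zA := UA i z zU; rewrite inE zA /=; apply: contraT => fi.
  have h1 := fP z zA; have ifz : i != f z by rewrite eq_sym.
  have h2 := missU i (f z) z ifz zU; have h3 := wtI y (U (f z)) (nb e z).
  have h4 := U_ge (f z); rewrite setIC in h1.
  by clear -h1 h2 h3 h4 T8 T0 tau_T th1_T; lra.
have wtP_ge i : x - 4 * tau <= wt y (P i).
  by apply: le_trans (U_ge i) _; exact: wt_sub.
have wtP_sum : \sum_i wt y (P i) <= 1.
  rewrite -y1 /wt; under eq_bigr do rewrite big_mkcond.
  rewrite exchange_big [leRHS]big_mkcond /=; apply: ler_sum => z _; rewrite in_setT.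
  rewrite (bigD1 (f z)) //= big1 ?addr0 => [|i ifz]; first by case: ifP.
  by rewrite inE [f z == i]eq_sym (negbTE ifz) andbF.
have wtP_le i : wt y (P i) <= x + 4 * (r%:R * tau).
  move: wtP_sum; rewrite (bigD1 i) //=.
  have : \sum_(j < r | j != i) (x - 4 * tau) <= \sum_(j < r | j != i) wt y (P j).
    by apply: ler_sum => j _.
  rewrite sumr_const cardC1 card_ord -[X in X <= _]mulr_natl.
  have -> : r.-1%:R = r%:R - 1 :> R by rewrite -subn1 natrB.
  have -> : (r%:R - 1) * (x - 4 * tau) = 1 - x - (r%:R - 1) * (4 * tau).
    by rewrite mulrBr mulrBl rx mul1r.
  by clear -tau0; lra.
pose inn u v := [&& u \notin A, v \notin A, e u v & f u == f v].
have inn_gad u v : inn u v ->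
    [/\ gadget F [set u; v], (#|[set u; v]| <= 2)%N & [disjoint A & [set u; v]]].
  case/and4P=> uA vA uv /eqP fuv; split; first exact: inner.
    by rewrite cards2; case: (_ != _).
  rewrite disjoint_sym -setI_eq0; apply/eqP/setP=> z; rewrite !inE.
  by apply/negP=> /andP[/orP[]/eqP ->] zA; [move: uA|move: vA]; rewrite inE zA.
have [D cD covD] : exists2 D : {set G}, (#|D| <= 2 * (t - #|A|))%N &
     forall u v, inn u v -> u \in D \/ v \in D.
  have inn_irr : irreflexive inn by move=> u; rewrite /inn e_irr !andbF.
  case: (matching_cover inn (t - #|A|)) => [[ss [sz dis hss]]|//].
  have : (#|A| + size ss < t)%N.
    by apply: gadget_count => // g /hss[u [v [uv ->]]]; exact: inn_gad.
  by rewrite sz subnKC ?ltnn // ltnW.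
exists A, D, f; split=> //.
- by apply: leq_trans cD _; rewrite leq_mul2l leq_subr orbT.
- move=> u v uA vA uv fuv; have iuv : inn u v by rewrite /inn uA vA fuv eqxx andbT.
  split; last exact: covD.
  have : (#|A| + size [:: [set u; v]] < t)%N.
    by apply: gadget_count => // g; rewrite inE => /eqP ->; exact: inn_gad.
  by rewrite addn1.
- move=> u uA; have sub : nb e u :&: P (f u) \subset (nb e u :&: U (f u)) :|: (P (f u) :\: U (f u)).
    apply/subsetP=> z /setIP[zn zP]; rewrite in_setU in_setI in_setD zn zP andbT /=.
    by case: (z \in U _).
  apply: le_trans (wt_sub y0 sub) _; apply: le_trans (wtU y0 _ _) _.
  have hI := wtI y (P (f u)) (U (f u)); rewrite (setIidPr (UP (f u))) in hI.
  have h1 := fP u uA; have h2 := wtP_le (f u); have h3 := U_ge (f u).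
  by clear -hI h1 h2 h3 T0 T_th rtau tau_T; lra.
- move=> i; rewrite -/P; have h1 := wtP_ge i; have h2 := wtP_le i.
  by clear -h1 h2 T_th rtau tau_T tau0 T0; apply/andP; split; lra.
Qed.
End Structure.

(** * Lost edges and asymptotic values *)

Section Loss.
Variables (R : realFieldType) (T : finType) (y : T -> R).
Variables (e e' : rel T).
Hypotheses (e_sym : symmetric e) (e_irr : irreflexive e) (e'_sym : symmetric e').
Hypotheses (y0 : forall v, 0 <= y v) (y1 : wt y [set: T] <= 1).

Lemma sum_cliques_edge k (U : {set T}) u v : u \in U -> u != v ->
  \sum_(S | clique_in e k.+2 U S && ((u \in S) && (v \in S))) \prod_(w in S) y w <= y u * y v.
Proof.
move=> uU uv.
rewrite (eq_bigl (fun S : {set T} => (clique_in e k.+2 U S && (u \in S)) && (v \in S))); last first.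
  by move=> S; rewrite andbA.
rewrite big_mkcondr (link_sum e_sym e_irr) //=.
apply: le_trans (_ : \sum_(Q | clique_in e k.+1 (U :&: nb e u) Q && (v \in Q))
    y u * \prod_(w in Q) y w <= _).
  rewrite [leRHS]big_mkcondr /=; apply: ler_sum => Q cQ.
  rewrite in_setU1 eq_sym (negbTE uv) /= prod_setU1 //.
  exact: (clique_in_notin e_irr cQ).
rewrite -big_distrr /= ler_wpM2l //.
have [vU|vU] := boolP (v \in U :&: nb e u); last first.
  rewrite big_pred0 // => Q; apply/negbTE; apply: contra vU => /andP[/and3P[/subsetP sQ _ _]].
  exact: sQ.
rewrite (link_sum e_sym e_irr) //.
apply: le_trans (_ : y v * cl e y k (U :&: nb e u :&: nb e v) <= _); last first.
  by rewrite ler_piMr // cl_le1.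
rewrite /cl big_distrr /=; apply: ler_sum => Q cQ.
by rewrite prod_setU1 // (clique_in_notin e_irr cQ).
Qed.

(** A lost clique contains a lost edge, and the cliques through an edge weigh at most as
    much as the edge. *)
Lemma cl_loss k U (D : {set T}) :
  (forall u v, e u v -> ~~ e' u v -> u \in D \/ v \in D) ->
  cl e y k.+2 U <= cl e' y k.+2 U
     + \sum_(u in D) y u * wt y [set v | e u v && ~~ e' u v].
Proof.
move=> cov; rewrite {1}/cl (bigID (fun S : {set T} => is_clique e' S)) /=; apply: lerD.
  apply: ler_sum_subset => [S /andP[/and3P[sS kS _] cS]|S _]; last exact: prodr_ge0.
  by apply/and3P.
apply: le_trans (_ : \sum_(u in D) \sum_(v in [set v | e u v && ~~ e' u v])
   \sum_(S | clique_in e k.+2 U S && ((u \in S) && (v \in S))) \prod_(w in S) y w <= _).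
  rewrite (pair_big_dep (mem D) (fun u v => v \in [set v | e u v && ~~ e' u v])) /=.
  rewrite (exchange_big_dep (clique_in e k.+2 U)) /=; last by move=> p S _ /andP[].
  rewrite big_mkcondr /=; apply: ler_sum => S cS; case: ifP => [nS|_]; last first.
    by apply: sumr_ge0 => p _; exact: prodr_ge0.
  have [u [v [uS vS uD euv ne]]] : exists u v,
      [/\ u \in S, v \in S, u \in D, e u v & ~~ e' u v].
    move: nS => /negP/negP; rewrite /is_clique => /forall_inPn[a aS] /forall_inPn[b bS].
    rewrite negb_imply => /andP[ab nab].
    have eab : e a b by case/and3P: cS => _ _ /is_cliqueP; apply.
    by case: (cov a b eab nab) => [aD|bD]; [exists a, b|exists b, a; rewrite e_sym e'_sym].
  rewrite (bigD1 (u, v)) /=; last by rewrite !inE uD euv ne cS uS vS.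
  by rewrite lerDl sumr_ge0 // => p _; exact: prodr_ge0.
apply: ler_sum => u uD; rewrite /wt big_distrr /=; apply: ler_sum => v; rewrite inE => /andP[euv _].
have [uU|uU] := boolP (u \in U).
  by apply: sum_cliques_edge => //; apply: contraTneq euv => ->; rewrite e_irr.
rewrite big_pred0 ?mulr_ge0 // => S; apply/negbTE; apply: contra uU.
by case/and3P=> /and3P[/subsetP sS _ _] uS _; exact: sS.
Qed.
End Loss.

Lemma nat_large (R : realType) (K a : R) : 0 < a -> exists N : nat, forall n, (N <= n)%N ->
  (0 < n)%N /\ K / n%:R <= a.
Proof.
move=> a0; have h := archi_boundP (normr_ge0 (K / a)).
exists (Num.bound `|K / a|).+1 => n hn; have n0 : (0 < n)%N by lia.
split=> //; rewrite ler_pdivrMr ?ltr0n // mulrC -ler_pdivrMr //.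
apply: le_trans (ler_norm _) _; apply: le_trans (ltW h) _; rewrite ler_nat; exact: ltnW.
Qed.

Section Asymptotics.
Variables (R : realType) (t r m : nat) (F : 'I_t -> sgraph).
Hypothesis hchi : forall i, chi (F i) = (r + 1)%N.
Hypotheses (r2 : (2 <= r)%N) (m0 : (0 < m)%N) (mr : (m < r)%N).
Local Notation s := m.+1.
Local Notation rho G := (clique_spectral_radius R s G).

(** The limit of the radius of the Turan graph on [n] vertices divided by [n ^+ m]. *)
Definition radius_density : R := turan_density R r s / m`!%:R.
Local Notation c := radius_density.

Lemma fact_gt0R k : 0 < k`!%:R :> R. Proof. by rewrite ltr0n fact_gt0. Qed.

Lemma radius_density_gt0 : 0 < c.
Proof. by rewrite divr_gt0 ?fact_gt0R // turan_density_gt0. Qed.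

(** In the eigenvalue equation at [v], the clique sum is at most 1. The bound is
    [c'^-1 + 1] rather than an [m]-th root of [c'^-1], which it exceeds. *)
Lemma perron_le (G : sgraph) y (c' : R) v : @perron R m G y -> 0 < c' ->
  c' * #|G|%:R ^+ m <= rho G -> #|G|%:R * y v <= c'^-1 + 1.
Proof.
move=> [y0 y1 _ eigy] c0 hc; have y1' : wt y [set: G] <= 1 by rewrite y1.
have h1 : rho G * y v ^+ m <= 1.
  by rewrite -eigy; apply: (cl_le1 (@sedge_sym G) (@sedge_irrefl G) y0 y1').
have h2 : (#|G|%:R * y v) ^+ m <= c'^-1.
  rewrite exprMn -[leRHS]mul1r ler_pdivlMr // mulrC mulrA.
  by apply: le_trans h1; rewrite ler_wpM2r // exprn_ge0.
have z0 : 0 <= #|G|%:R * y v by rewrite mulr_ge0.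
rewrite leNgt; apply/negP=> lt; move: h2; apply/negP; rewrite -ltNge.
have ci : 0 < c'^-1 by rewrite invr_gt0.
have z1 : 1 <= #|G|%:R * y v by lra.
apply: lt_le_trans (_ : #|G|%:R * y v <= _); first by lra.
by rewrite -[leLHS]expr1 ler_weXn2l.
Qed.

(** Uniform weights are tested, and [ocl_greedy] counts the cliques. *)
Lemma turan_radius_lower k (eps : R) : 0 < eps ->
  exists N : nat, forall q, (N <= k + q)%N ->
    (c - eps) * (k + q)%:R ^+ m <= rho (turan_join r k q).
Proof.
move=> eps0; have [N1 hN1] := nat_large (s%:R ^+ 2 / m`!%:R) eps0.
exists (maxn N1 (r * r)) => q; rewrite geq_max => /andP[hn1 hn2].
set n := (k + q)%N in hn1 hn2 *; have [n0 hK] := hN1 n hn1.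
have r0 : (0 < r)%N by lia.
have rR : 0 < r%:R :> R by rewrite ltr0n.
have nR : 0 < n%:R :> R by rewrite ltr0n.
have [col [colk bal colE]] := turan_join_mp k q r0.
set G := turan_join r k q in col colk bal colE *.
have cG : #|G| = n by rewrite card_turan_join.
pose e := @sedge G; have e_sym : symmetric e := @sedge_sym G.
have e_irr : irreflexive e := @sedge_irrefl G.
pose y (_ : G) : R := n%:R^-1.
have y0 v : 0 <= y v by rewrite invr_ge0.
have wtE (U : {set G}) : wt y U = #|U|%:R / n%:R.
  by rewrite /wt sumr_const -[LHS]mulr_natl.
have wt1 : wt y [set: G] = 1 by rewrite wtE cardsT cG divff // gt_eqF.
pose eta : R := r%:R^-1 + n%:R^-1.
have eta0 : 0 <= eta by rewrite addr_ge0 ?invr_ge0.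
have part_le i : (#|part col i| * r <= n + r)%N.
  have := sum_parts col; rewrite colk cG => sE.
  have : (\sum_(j < r) #|part col i| <= \sum_(j < r) (#|part col j| + 1))%N.
    by apply: leq_sum => j _; exact: bal.
  rewrite big_split /= !sum_nat_const !card_ord muln1 => h.
  by rewrite mulnC; apply: leq_trans h _; rewrite leq_add2r -sE leq_addr.
have miss u : u \in [set: G] -> wt y ([set: G] :\: nb e u) <= eta.
  move=> _; rewrite wtE ler_pdivrMr // /eta mulrDl mulVf ?gt_eqF //.
  case cu: (col u) => [i|].
    have -> : [set: G] :\: nb e u = part col i.
      by apply/setP=> v; rewrite !inE /e colE (mp_relE _ cu) negbK andbT.
    rewrite mulrC -(ler_pM2r rR) mulrDl mul1r divfK ?gt_eqF //.
    by rewrite -natrM -natrD ler_nat.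
  have -> : [set: G] :\: nb e u = [set u].
    by apply/setP=> v; rewrite !inE /e colE /mp_rel cu /= andbT andbT negbK eq_sym.
  by rewrite cards1 lerDr mulr_ge0 ?invr_ge0.
have rn : r%:R * n%:R^-1 <= r%:R^-1 :> R.
  rewrite ler_pdivrMr // -ler_pdivrMl ?invr_gt0 // invrK -natrM ler_nat //.
have etaI i : (i < s)%N -> 0 <= 1 - i%:R * eta.
  move=> is_; have ir : i%:R + 1 <= r%:R :> R by rewrite natr1 ler_nat; lia.
  have : i%:R * eta <= (r%:R - 1) * eta by rewrite ler_wpM2r //; lra.
  have : (r%:R - 1) * eta = 1 - r%:R^-1 + (r%:R * n%:R^-1 - n%:R^-1).
    by rewrite /eta mulrDr !mulrBl mulfV ?gt_eqF // !mul1r.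
  have : 0 <= n%:R^-1 :> R by rewrite invr_ge0.
  lra.
have low : turan_density R r s - s%:R ^+ 2 / n%:R <= ocl e y s [set: G].
  have h := @ocl_greedy _ _ e y e_sym e_irr y0 s eta [set: G] eta0 miss.
  rewrite wt1 in h; apply: le_trans (h etaI).
  rewrite lerBlDr; apply: le_trans (ler_prod_perturb (a := fun i => 1 - i%:R * eta)
     (b := fun i => 1 - i%:R / r%:R) _) _.
    move=> i is_; split; first exact: etaI.
      by rewrite lerD2l lerN2 ler_wpM2l // /eta lerDl invr_ge0.
    by rewrite gerBl divr_ge0.
  rewrite lerD2l; apply: le_trans (_ : \sum_(i < s) s%:R / n%:R <= _).
    apply: ler_sum => i _; rewrite [leLHS](_ : _ = i%:R / n%:R); last by rewrite /eta; ring.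
    by rewrite ler_wpM2r ?invr_ge0 // ler_nat ltnW.
  by rewrite sumr_const card_ord -[leLHS]mulr_natl expr2 mulrA.
have G_0 : (0 < #|G|)%N by rewrite cG.
have := clique_radius_ub m0 G_0 y0.
have -> : psum s y = (n%:R ^+ m)^-1.
  rewrite /psum (eq_bigr (fun=> n%:R^-1 ^+ s)) // sumr_const cG -[LHS]mulr_natl exprVn exprS invfM mulrA mulfV ?gt_eqF //.
  by rewrite mul1r.
have nm : 0 < n%:R ^+ m :> R by rewrite exprn_gt0.
rewrite ler_pdivlMr //; apply: le_trans; rewrite ler_pM2r //.
have -> : s%:R * cl (@sedge G) y s [set: G] = ocl e y s [set: G] / m`!%:R.
  rewrite /ocl factS natrM; field; rewrite gt_eqF ?fact_gt0R //.
rewrite ler_pdivlMr ?fact_gt0R //; apply: le_trans low.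
rewrite mulrBl /c divfK ?gt_eqF ?fact_gt0R // lerD2l lerN2.
by rewrite -ler_pdivrMr ?fact_gt0R // mulrAC.
Qed.

(** Unless the bound holds already with [eps = 0], the Perron weights are small by
    [perron_le]; then there are few [(r+1)]-cliques by [few_cliques], and
    [clique_density_upper] bounds the clique sum. *)
Lemma radius_upper (eps : R) : 0 < eps ->
  exists N : nat, forall G : sgraph, (N <= #|G|)%N -> sg_free (disjoint_union F) G ->
    rho G <= (c + eps) * #|G|%:R ^+ m.
Proof.
move=> eps0; have c0 := radius_density_gt0.
have r0 : (0 < r)%N by lia.
have [del del0 hdel] := clique_density_upper (R := R) r0 mr (mulr_gt0 eps0 (fact_gt0R m)).
have [kap kap0 hfew] := few_cliques hchi del0.
have [N hN] := nat_large (c^-1 + 1) kap0.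
exists N => G hn free; have [n0 hK] := hN _ hn.
have nR : 0 < #|G|%:R :> R by rewrite ltr0n.
have nm : 0 < #|G|%:R ^+ m :> R by rewrite exprn_gt0.
have [le|lt] := leP (rho G) (c * #|G|%:R ^+ m).
  by apply: le_trans le _; rewrite ler_pM2r // lerDl ltW.
have [y py] := perron_exists R m0 n0; have [y0 y1 eqy _] := py.
have [p1 p0] := perron_psum py.
have yk v : y v <= kap.
  apply: le_trans hK; rewrite ler_pdivlMr // mulrC.
  exact: perron_le py c0 (ltW lt).
have y1' : wt y [set: G] <= 1 by rewrite y1.
have few := hfew G y free y0 yk y1'.
have up := hdel G (@sedge G) y [set: G] (@sedge_sym G) (@sedge_irrefl G) y0 y1' (ltW few).
rewrite y1 expr1n mulr1 in up.
apply: le_trans (_ : rho G * (#|G|%:R ^+ m * psum s y) <= _).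
  by rewrite ler_peMr // clique_radius_ge0.
rewrite mulrCA -eqy mulrC ler_pM2r //.
have -> : s%:R * cl (@sedge G) y s [set: G] = ocl (@sedge G) y s [set: G] / m`!%:R.
  rewrite /ocl factS natrM; field; rewrite gt_eqF ?fact_gt0R //.
rewrite ler_pdivrMr ?fact_gt0R // mulrDl /c divfK ?gt_eqF ?fact_gt0R //.
Qed.
End Asymptotics.

(** * One more apex *)

Section OneMoreApex.
Variables (R : realType) (V : finType) (r m : nat) (y : V -> R).
Hypotheses (m0 : (0 < m)%N) (mr : (m < r)%N).
Hypotheses (y0 : forall v, 0 <= y v) (y1 : wt y [set: V] = 1).
Local Notation s := m.+1.

Definition cone_colour (A : {set V}) (f : V -> 'I_r) v := if v \in A then None else Some (f v).

(** The new cliques are those with [w] and another vertex of its part; they are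
    completed greedily in the other parts, a step costing at most [1 / r + th]. *)
Lemma cone_gain (A : {set V}) (f : V -> 'I_r) w (th : R) :
  let P := [set v | (v \notin A) && (f v == f w)] in
  w \notin A -> 0 <= th -> r%:R * th <= r%:R^-1 ->
  (forall i, wt y [set v | (v \notin A) && (f v == i)] <= r%:R^-1 + th) ->
  (forall v, y v <= r%:R^-1) ->
  cl (mp_rel (cone_colour A f)) y s [set: V]
    + y w * ((wt y P - y w) * ((r%:R^-1) ^+ m.-1 / (m.-1)`!%:R))
  <= cl (mp_rel (cone_colour (w |: A) f)) y s [set: V].
Proof.
move=> P wA th0 rth wtP ysm; set c := cone_colour A f; set c' := cone_colour (w |: A) f.
have r0 : (0 < r)%N by lia.
have rR : 0 < r%:R :> R by rewrite ltr0n.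
set x : R := r%:R^-1 in rth wtP ysm *.
have x0 : 0 < x by rewrite invr_gt0.
have rx : r%:R * x = 1 by rewrite mulfV ?gt_eqF.
have cw : c w = Some (f w) by rewrite /c /cone_colour (negbTE wA).
have c'w : c' w = None by rewrite /c' /cone_colour setU11.
have wP : w \in P by rewrite inE wA eqxx.
have cP v : (c v == Some (f w)) = (v \in P).
  by rewrite inE /c /cone_colour; case: (v \in A).
have agree : {in [set: V] :\ w &, mp_rel c' =2 mp_rel c}.
  move=> a b /setD1P[aw _] /setD1P[bw _].
  by rewrite /mp_rel /c' /c /cone_colour !in_setU1 (negbTE aw) (negbTE bw).
rewrite (clE_rem y (mp_sym c) (mp_irr c) m (in_setT w)).
rewrite (clE_rem y (mp_sym c') (mp_irr c') m (in_setT w)).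
rewrite (cl_eq_rel _ _ agree) -addrA lerD2l -mulrDr ler_wpM2l //.
pose O := ~: P; pose I := P :\ w.
have -> : [set: V] :&: nb (mp_rel c) w = O.
  by apply/setP=> v; rewrite setTI in_nb (mp_relE _ cw) cP in_setC.
have nbw : [set: V] :&: nb (mp_rel c') w = O :|: I.
  apply/setP=> v; rewrite setTI in_nb in_setU in_setC in_setD1 /mp_rel c'w eqxx /= andbT eq_sym.
  by case: (boolP (v \in P)) => vP; rewrite ?andbT //=; apply: contraNneq vP => ->.
rewrite nbw.
have -> : cl (mp_rel c') y m (O :|: I) = cl (mp_rel c) y m (O :|: I).
  apply: cl_eq_rel => a b aX bX; apply: agree; rewrite in_setD1 in_setT andbT.
    by apply: contraTneq aX => ->; rewrite in_setU in_setC in_setD1 wP eqxx.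
  by apply: contraTneq bX => ->; rewrite in_setU in_setC in_setD1 wP eqxx.
rewrite -(prednK m0) (cl_join_indep y (mp_sym c) (mp_irr c)) /=; first last.
- move=> a b /setD1P[_]; rewrite -cP => /eqP ca; rewrite in_setC -cP => cb.
  by rewrite (mp_relE _ ca).
- move=> a b /setD1P[_]; rewrite -cP => /eqP ca /setD1P[_]; rewrite -cP => cb.
  by rewrite (mp_relE _ ca) negbK.
- rewrite -setI_eq0; apply/eqP/setP=> v; rewrite in_setI in_setC in_setD1 in_set0.
  by case: (v \in P); rewrite ?andbF.
have -> : wt y I = wt y P - y w by rewrite /wt [in RHS](big_setD1 w) //= addrAC subrr add0r.
have wtI0 : 0 <= wt y P - y w.
  by rewrite subr_ge0 /wt (big_setD1 w) //= lerDl sumr_ge0.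
rewrite lerD2l ler_wpM2l //.
rewrite ler_pdivrMr ?ltr0n ?fact_gt0 // mulrC -/(ocl _ _ _ _).
have wtO : 1 - x - th <= wt y O.
  have := wtI y [set: V] P; rewrite setTI setTD y1 -/O => h.
  by have := wtP (f w); rewrite -/P; lra.
have eta0 : 0 <= x + th by lra.
apply: le_trans (ocl_greedy (mp_sym c) (mp_irr c) y0 eta0 _ _).
- rewrite -[in X in X <= _](card_ord m.-1) -prodr_const; apply: ler_prod => i _.
  rewrite (ltW x0) /=; have im : i%:R + 3 <= r%:R :> R.
    by rewrite -natrD ler_nat; have := ltn_ord i; lia.
  have : (i%:R + 1) * (x + th) <= (r%:R - 2) * (x + th) by rewrite ler_wpM2r //; lra.
  have -> : (r%:R - 2) * (x + th) = 1 - 2 * x + r%:R * th - 2 * th.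
    by rewrite mulrDr !mulrBl rx; ring.
  by lra.
- move=> u uO; case cu: (c u) => [i|].
    apply: le_trans (wtP i); apply: wt_sub => //; apply/subsetP=> v /setDP[_].
    rewrite in_nb (mp_relE _ cu) negbK inE /c /cone_colour.
    by case: (v \in A).
  apply: le_trans (_ : wt y [set u] <= _); last first.
    by rewrite /wt big_set1; have := ysm u; lra.
  apply: wt_sub => //; apply/subsetP=> v /setDP[_].
  by rewrite in_nb in_set1 /mp_rel cu eqxx /= andbT negbK eq_sym.
move=> i im; have imR : i%:R + 3 <= r%:R :> R by rewrite -natrD ler_nat; lia.
have : (i%:R + 1) * (x + th) <= (r%:R - 2) * (x + th) by rewrite ler_wpM2r //; lra.
have -> : (r%:R - 2) * (x + th) = 1 - 2 * x + r%:R * th - 2 * th.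
  by rewrite mulrDr !mulrBl rx; ring.
by lra.
Qed.
End OneMoreApex.

Section NearUniform.
Variables (R : realType) (t r m k : nat) (F : 'I_t -> sgraph).
Hypotheses (hcrit : forall i, color_critical (F i)) (hchi : forall i, chi (F i) = (r + 1)%N).
Hypotheses (r2 : (2 <= r)%N) (m0 : (0 < m)%N) (mr : (m < r)%N) (kt : k.+1 = t).
Local Notation s := m.+1.
Local Notation rho G := (clique_spectral_radius R s G).
Local Notation c := (radius_density R r m).

Lemma bernoulli_lower (a : R) : 0 <= a -> a <= 1 -> 1 - m%:R * a <= (1 - a) ^+ m.
Proof.
move=> a0 a1; rewrite -(prednK m0).
have := @exprn_tangent R (1 - a) 1 m.-1 _ ler01; rewrite !expr1n mulr1 subr_ge0 => /(_ a1).
by apply: le_trans; lra.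
Qed.

(** If the structure theorem leaves fewer than [k] apexes, joining one more vertex to
    everything gains a fixed multiple of [1 / n] in the clique sum; the edges inside the
    classes, covered by [2 * t] vertices of inner degree at most [th], weigh only a
    small multiple of [1 / n]. So the graph with one more apex and without these edges
    would have a larger radius than [turan_join r k q], against [near_partite_radius]. *)
Lemma near_uniform_partite : exists eps (N : nat), 0 < eps /\
  forall q (G : sgraph) (y : G -> R), (N <= k + q)%N -> #|G| = (k + q)%N ->
    sg_free (disjoint_union F) G -> rho (turan_join r k q) <= rho G ->
    @perron R m G y -> (forall v, (1 - eps) * psum s y <= (k + q)%:R * y v ^+ s) ->
    exists (A : {set G}) (f : G -> 'I_r), (#|A| <= k)%N /\
      {in ~: A &, forall u v, sedge u v -> f u != f v}.
Proof.
have c0 : 0 < c by exact: radius_density_gt0.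
have r0 : (0 < r)%N by lia.
have rR : 0 < r%:R :> R by rewrite ltr0n.
have tR : 0 < t%:R :> R by rewrite ltr0n -kt.
set x : R := r%:R^-1.
have x0 : 0 < x by rewrite invr_gt0.
have x4 : x / 4 <= x by lra.
(* [K] bounds [n * y v] by [perron_le], and [k0] is the gain for one pair of vertices in
   [cone_gain]. *)
pose K := (c / 2)^-1 + 1.
have K0 : 0 < K by rewrite addr_gt0 // invr_gt0 divr_gt0.
pose k0 : R := x ^+ m.-1 / (m.-1)`!%:R.
have k00 : 0 < k0 by rewrite divr_gt0 ?exprn_gt0 // ltr0n fact_gt0.
pose th := Num.min (x / (4 * r%:R)) (x * k0 / (16 * t%:R * K)).
have xk0 : 0 < x * k0 by exact: mulr_gt0.
have r4 : 0 < 4 * r%:R :> R by exact: mulr_gt0.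
have tK : 0 < 16 * t%:R * K by apply: mulr_gt0 => //; exact: mulr_gt0.
have th0 : 0 < th by rewrite lt_min (divr_gt0 x0 r4) (divr_gt0 xk0 tK).
have rth : 4 * (r%:R * th) <= x.
  by rewrite mulrA mulrC -ler_pdivlMr // /th ge_min lexx.
have th_x : 4 * th <= x.
  by apply: le_trans rth; rewrite ler_pM2l // ler_peMl ?(ltW th0) // ler1n.
have thK : 16 * (t%:R * K * th) <= x * k0.
  have -> : 16 * (t%:R * K * th) = th * (16 * t%:R * K) by ring.
  by rewrite -ler_pdivlMr // /th ge_min lexx orbT.
have tKth : 2 * (t%:R * K * th) < x * k0 / 4.
  have : 0 < t%:R * K * th by rewrite !mulr_gt0.
  by lra.
have [epsS [kapS [epsS0 kapS0 hS]]] := near_uniform_structure hcrit hchi r2 m0 mr th0.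
have fm : 0 < m`!%:R :> R by exact: fact_gt0R.
pose eps2 := Num.min (c / 2) (epsS / (2 * m`!%:R)).
have fm2 : 0 < 2 * m`!%:R :> R by exact: mulr_gt0.
have eps2_0 : 0 < eps2 by rewrite lt_min (divr_gt0 c0 (ltr0Sn R 1)) (divr_gt0 epsS0 fm2).
have eps2_c : eps2 <= c / 2 by rewrite /eps2 ge_min lexx.
have eps2_S : m`!%:R * eps2 <= epsS / 2.
  rewrite mulrC -ler_pdivlMr //; apply: le_trans (_ : epsS / (2 * m`!%:R) <= _).
    by rewrite /eps2 ge_min lexx orbT.
  by rewrite invfM mulrA.
have mR : 0 < m%:R :> R by rewrite ltr0n.
pose eps := Num.min (1 / 2) (epsS / (2 * (m%:R * (m`!%:R * c)))).
have mfc : 0 < 2 * (m%:R * (m`!%:R * c)).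
  by apply: mulr_gt0 => //; apply: mulr_gt0 => //; exact: mulr_gt0.
have eps0 : 0 < eps by rewrite lt_min (divr_gt0 ltr01 (ltr0Sn R 1)) (divr_gt0 epsS0 mfc).
have eps_half : eps <= 1 / 2 by rewrite /eps ge_min lexx.
have eps1 : 0 <= 1 - eps by lra.
have ce_gt0 : 0 < c - eps2 by lra.
have ce0 := ltW ce_gt0.
have eps_S : m%:R * (m`!%:R * c) * eps <= epsS / 2.
  have : eps * (2 * (m%:R * (m`!%:R * c))) <= epsS.
    by rewrite -ler_pdivlMr // /eps ge_min lexx orbT.
  by move: (m%:R * _) => X; lra.
have [N1 hN1] := turan_radius_lower r2 m0 mr k eps2_0.
have [N2 hN2] := nat_large K kapS0.
have [N3 hN3] := nat_large K (divr_gt0 x0 (ltr0Sn R 3)).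
exists eps, (maxn N1 (maxn N2 N3)); split=> // q G y.
rewrite !geq_max => /and3P[hn1 hn2 hn3] cG free hrho py hy.
set n := (k + q)%N in hn1 hn2 hn3 cG hy *.
have [n0 Kkap] := hN2 n hn2; have [_ Kx] := hN3 n hn3.
have nR : 0 < n%:R :> R by rewrite ltr0n.
have nm : 0 < n%:R ^+ m :> R by rewrite exprn_gt0.
have rho_low : (c - eps2) * n%:R ^+ m <= rho G by apply: le_trans hrho; exact: hN1.
have rho_low2 : c / 2 * #|G|%:R ^+ m <= rho G.
  by apply: le_trans rho_low; rewrite cG ler_pM2r //; lra.
have [y0 y1 eqy eigy] := py.
have [p1 p0] := perron_psum py; rewrite cG in p1.
have y_up v : y v <= K / n%:R.
  rewrite ler_pdivlMr // mulrC -cG.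
  by apply: perron_le py _ rho_low2 => //; exact: divr_gt0.
have y_low v : 1 - eps <= n%:R * y v.
  rewrite leNgt; apply/negP=> lt.
  have : 1 - eps <= (n%:R * y v) ^+ s.
    rewrite exprMn exprSr -mulrA; apply: le_trans (ler_wpM2l (ltW nm) (hy v)).
    by rewrite mulrCA ler_peMr.
  have ny1 : n%:R * y v <= 1 by clear -lt eps0; lra.
  apply/negP; rewrite -ltNge; apply: le_lt_trans lt.
  by rewrite exprS ler_piMr ?mulr_ge0 // exprn_ile1 ?mulr_ge0.
have hv v : turan_density R r s - epsS <= ocl (@sedge G) y m (nb (@sedge G) v).
  have cE : m`!%:R * c = turan_density R r s by rewrite mulrC divfK // gt_eqF.
  rewrite /ocl eigy -cE.
  have h1 : (c - eps2) * (1 - m%:R * eps) <= rho G * y v ^+ m.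
    apply: le_trans (_ : (c - eps2) * (1 - eps) ^+ m <= _).
      rewrite ler_wpM2l //; apply: bernoulli_lower; first exact: ltW.
      by rewrite -subr_ge0.
    apply: le_trans (_ : (c - eps2) * (n%:R * y v) ^+ m <= _).
      by rewrite ler_wpM2l // lerXn2r // ?nnegrE ?mulr_ge0.
    by rewrite exprMn mulrA ler_wpM2r // exprn_ge0.
  have h2 := ler_wpM2l (ltW fm) h1; apply: le_trans h2.
  have : 0 <= m`!%:R * eps2 * (m%:R * eps) by rewrite !mulr_ge0 // ltW.
  by lra.
have yS v : y v <= kapS by apply: le_trans (y_up v) Kkap.
have [A [D [f [cA cD inner deg_in cls]]]] := hS G y free y0 y1 yS hv.
have [Ak|kA] := boolP (k <= #|A|)%N.
  exists A, f; split; first by rewrite -ltnS kt.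
  move=> u v; rewrite !inE => uA vA uv; apply/eqP=> fuv.
  by have [] := inner u v uA vA uv fuv; rewrite -kt ltnS ltnNge Ak.
exfalso; rewrite -ltnNge in kA.
have [w wA] : exists w, w \notin A.
  apply/existsP; apply: contraT => /existsPn h.
  have : A = [set: G] by apply/setP=> v; rewrite in_setT; have := h v; rewrite negbK.
  by move=> AT; move: kA; rewrite AT cardsT cG ltnNge leq_addr.
pose P := [set v | (v \notin A) && (f v == f w)].
have gain : cl (mp_rel (cone_colour A f)) y s [set: G] + y w * ((wt y P - y w) * k0)
    <= cl (mp_rel (cone_colour (w |: A) f)) y s [set: G].
  apply: (cone_gain m0 mr y0 y1 wA (ltW th0)).
  - by rewrite -/x; apply: le_trans rth; rewrite ler_peMl ?mulr_ge0 ?ler1n ?(ltW th0).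
  - by move=> i; have /andP[] := cls i.
  - by move=> v; exact: le_trans (le_trans (y_up v) Kx) x4.
have bad u v : sedge u v -> ~~ mp_rel (cone_colour A f) u v ->
    [/\ u \notin A, v \notin A & f u = f v].
  move=> uv; have nuv : u != v by apply: contraTneq uv => ->; rewrite sedge_irrefl.
  rewrite /mp_rel nuv /cone_colour /=; case: (boolP (u \in A)) => //= uA.
  by case: (boolP (v \in A)) => //= vA; rewrite negbK => /eqP[].
have y1' : wt y [set: G] <= 1 by rewrite y1.
have loss : cl (@sedge G) y s [set: G] <= cl (mp_rel (cone_colour A f)) y s [set: G]
     + K / n%:R * th * (2 * t%:R).
  case: m m0 => // m' _.
  apply: le_trans (cl_loss (e' := mp_rel (cone_colour A f)) (D := D) _ _ _ y0 y1' m' [set: G] _) _.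
  - exact: sedge_sym.
  - exact: sedge_irrefl.
  - exact: mp_sym.
  - by move=> u v uv nuv; have [uA vA fuv] := bad u v uv nuv; have [] := inner u v uA vA uv fuv.
  rewrite lerD2l; apply: le_trans (_ : \sum_(u in D) K / n%:R * th <= _).
    apply: ler_sum => u _; apply: ler_pM => //; first exact: wt_ge0.
    have [uA|uA] := boolP (u \in A).
      rewrite (_ : [set v | _] = set0) /wt ?big_set0 ?(ltW th0) //.
      apply/setP=> v; rewrite inE in_set0; apply/negP=> /andP[uv nuv].
      by have [] := bad u v uv nuv; rewrite uA.
    apply: le_trans (deg_in u uA); apply: wt_sub => //; apply/subsetP=> v.
    rewrite inE => /andP[uv nuv]; have [_ vA fuv] := bad u v uv nuv.
    by rewrite in_setI in_nb uv inE vA fuv eqxx.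
  rewrite sumr_const -[leLHS]mulr_natr; apply: ler_wpM2l.
    by apply: mulr_ge0 (ltW th0); apply: divr_ge0 (ltW K0) _.
  by rewrite -natrM ler_nat.
have strict : cl (@sedge G) y s [set: G] < cl (mp_rel (cone_colour (w |: A) f)) y s [set: G].
  apply: le_lt_trans loss _; apply: lt_le_trans gain; rewrite ltrD2l.
  have yw : 1 / (2 * n%:R) <= y w.
    rewrite ler_pdivrMr ?mulr_gt0 //; have := y_low w; clear -eps_half; lra.
  have wtPw : x / 2 <= wt y P - y w.
    have /andP[h1 _] := cls (f w); have := y_up w; rewrite -/P in h1.
    have yx := le_trans (y_up w) Kx; rewrite -/x in h1.
    by clear -h1 yx th_x; lra.
  apply: lt_le_trans (_ : 1 / (2 * n%:R) * (x / 2 * k0) <= _); last first.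
    have a1 : 0 <= 1 / (2 * n%:R) :> R by rewrite divr_ge0 // mulr_ge0.
    have a2 : 0 <= x / 2 * k0 by rewrite ltW // mulr_gt0 // divr_gt0.
    by apply: ler_pM a1 a2 yw _; rewrite ler_pM2r.
  have -> : 1 / (2 * n%:R) * (x / 2 * k0) = x * k0 / 4 / n%:R.
    by field; rewrite gt_eqF.
  have -> : K / n%:R * th * (2 * t%:R) = 2 * (t%:R * K * th) / n%:R.
    by field; rewrite gt_eqF.
  by rewrite ltr_pM2r ?invr_gt0.
have G_0 : (0 < #|G|)%N by rewrite cG.
have rhoT0 : 0 < rho (turan_join r k q).
  by apply: lt_le_trans (hN1 q hn1); rewrite mulr_gt0.
pose H := mp (cone_colour (w |: A) f).
have [le_H _] : rho H <= rho (turan_join r k q) /\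
    (rho H = rho (turan_join r k q) -> sg_iso H (turan_join r k q)).
  apply: (@near_partite_radius R m r k q m0 r0 n0 rhoT0 H (w |: A) f cG).
    by rewrite cardsU1 wA add1n.
  move=> u v; rewrite !in_setC => uA vA /andP[_]; rewrite /cone_colour (negbTE uA) (negbTE vA).
  by rewrite (inj_eq Some_inj).
have : rho G * psum s y < rho H * psum s y.
  rewrite -eqy; apply: lt_le_trans (clique_radius_ub m0 (G := H) G_0 y0).
  by rewrite ltr_pM2l.
by rewrite ltr_pM2r // ltNge (le_trans le_H hrho).
Qed.
End NearUniform.

(** * Descent to nearly uniform weights *)

Lemma half_step k q N j : (k <= N)%N -> (N * 2 <= k + q)%N -> (j <= (k + q)./2)%N ->
  (N <= k + (q - j))%N /\ (j <= q)%N.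
Proof.
by move=> kN hN hj; have := odd_double_half (k + q); rewrite -muln2; split; lia.
Qed.

Lemma third_le_half n : (2 <= n)%N -> (n <= n./2 * 3)%N.
Proof.
by move=> n2; have := odd_double_half n; have := leq_b1 (odd n); rewrite -muln2; lia.
Qed.

Section Descent.
Variables (R : realType) (t r m k : nat) (F : 'I_t -> sgraph).
Hypotheses (hcrit : forall i, color_critical (F i)) (hchi : forall i, chi (F i) = (r + 1)%N).
Hypotheses (r2 : (2 <= r)%N) (m0 : (0 < m)%N) (mr : (m < r)%N) (kt : k.+1 = t).
Local Notation s := m.+1.
Local Notation rho G := (clique_spectral_radius R s G).
Local Notation c := (radius_density R r m).
Local Notation phi q := (rho (turan_join r k q)).

Definition near_partite (H : sgraph) := exists (A : {set H}) (f : H -> 'I_r),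
  (#|A| <= k)%N /\ {in ~: A &, forall u v, sedge u v -> f u != f v}.

Lemma near_partite_le q (H : sgraph) : (0 < k + q)%N -> 0 < phi q ->
  #|H| = (k + q)%N -> near_partite H -> rho H <= phi q /\ (rho H = phi q -> sg_iso H (turan_join r k q)).
Proof.
move=> kq phi0 cH [A [f [cA fP]]].
have r0 : (0 < r)%N by exact: ltnW.
exact: (near_partite_radius m0 r0 kq phi0 cH cA fP).
Qed.

Lemma phi_pos : exists N : nat, forall q, (N <= k + q)%N -> (0 < k + q)%N /\ 0 < phi q.
Proof.
have c0 : 0 < c by exact: radius_density_gt0.
have [N hN] := turan_radius_lower r2 m0 mr k (divr_gt0 c0 (ltr0Sn R 1)).
exists N.+1 => q hq; have n0 : (0 < k + q)%N by exact: leq_ltn_trans hq.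
split=> //; apply: lt_le_trans (hN q (ltnW hq)).
by rewrite mulr_gt0 ?exprn_gt0 ?ltr0n //; lra.
Qed.

(** Cloning a non-apex vertex keeps the graph [r]-partite up to [k] vertices. As the [k]
    apexes have weights at most [K / n], their share of the power sum is negligible, and
    some other vertex has an almost average [y v ^+ s]. *)
Lemma phi_growth (del : R) : 0 < del -> del <= 1 -> exists N : nat, forall q, (N <= k + q)%N ->
  exists2 u : R, 1 - del <= (k + q)%:R * u & phi q * (1 + s%:R * u) <= phi q.+1 * (1 + u).
Proof.
move=> del0 del1; have c0 : 0 < c by exact: radius_density_gt0.
have c2 : 0 < c / 2 by rewrite divr_gt0.
have [N1 hN1] := turan_radius_lower r2 m0 mr k c2.
pose K := (c / 2)^-1 + 1.
have K0 : 0 < K by rewrite addr_gt0 // invr_gt0.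
have [N2 hN2] := nat_large (k%:R * K ^+ s) (divr_gt0 del0 (ltr0Sn R 1)).
have [N3 hN3] := phi_pos.
exists (maxn N1 (maxn N2 N3)) => q; rewrite !geq_max => /and3P[hn1 hn2 hn3].
have [_ phi1] : (0 < k + q.+1)%N /\ 0 < phi q.+1.
  by apply: hN3; rewrite addnS; exact: leqW.
set G := turan_join r k q; have cG : #|G| = (k + q)%N by rewrite card_turan_join.
set n := (k + q)%N in hn1 hn2 cG *.
have [n0 hK] := hN2 n hn2.
have nR : 0 < n%:R :> R by rewrite ltr0n.
have G_0 : (0 < #|G|)%N by rewrite cG.
have [y py] := perron_exists R m0 G_0; have [y0 y1 eqy eigy] := py.
have [p1 p0] := perron_psum py; rewrite cG in p1.
have y_up v : n%:R * y v <= K.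
  rewrite -cG; apply: (perron_le m0 v py c2); rewrite cG.
  by apply: le_trans (hN1 q hn1); rewrite -/n; have -> : c - c / 2 = c / 2 by lra.
have r0 : (0 < r)%N by exact: ltnW.
have [col [colk _ colE]] := turan_join_mp k q r0.
have [v [vA hv]] : exists v : G, v \notin apexes col /\ (1 - del) * psum s y <= n%:R * y v ^+ s.
  have [/existsP[v /andP[h1 h2]]|/existsPn h] :=
    boolP [exists v : G, (v \notin apexes col) && ((1 - del) * psum s y <= n%:R * y v ^+ s)].
    by exists v.
  exfalso.
  have hap : n%:R * \sum_(v in apexes col) y v ^+ s <= del / 2 * (n%:R * psum s y).
    rewrite mulr_sumr; apply: le_trans (_ : \sum_(v in apexes col) (K ^+ s / n%:R ^+ m) <= _).
      apply: ler_sum => v _; rewrite ler_pdivlMr ?exprn_gt0 // mulrAC -exprS -exprMn.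
      by apply: lerXn2r; rewrite ?nnegrE ?mulr_ge0 ?(ltW K0).
    rewrite sumr_const colk -[leLHS]mulr_natl mulrA.
    have nm0 : 0 < n%:R ^+ m :> R by exact: exprn_gt0.
    rewrite ler_pdivrMr //; apply: le_trans (_ : del / 2 * n%:R <= _).
      by rewrite -ler_pdivrMr.
    have dn : 0 <= del / 2 * n%:R by rewrite ltW // mulr_gt0 // divr_gt0.
    rewrite [leRHS](_ : _ = del / 2 * n%:R * (n%:R ^+ m * psum s y)); last by ring.
    by rewrite ler_peMr.
  have hno : n%:R * \sum_(v in ~: apexes col) y v ^+ s <= n%:R * ((1 - del) * psum s y).
    have pos : 0 <= (1 - del) * psum s y by rewrite mulr_ge0 ?subr_ge0 // ltW.
    rewrite mulr_sumr; apply: le_trans (_ : \sum_(v in ~: apexes col) (1 - del) * psum s y <= _).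
      apply: ler_sum => v; rewrite in_setC => vA.
      by have := h v; rewrite vA /= -ltNge => /ltW.
    rewrite sumr_const -[leLHS]mulr_natl ler_wpM2r // ler_nat -cG; exact: max_card.
  have : n%:R * psum s y = n%:R * \sum_(v in apexes col) y v ^+ s + n%:R * \sum_(v in ~: apexes col) y v ^+ s.
    rewrite -mulrDr /psum (bigID (mem (apexes col))) /=; congr (_ * (_ + _)).
    by apply: eq_bigl => v; rewrite in_setC.
  have : 0 < del * (n%:R * psum s y) by rewrite !mulr_gt0.
  lra.
exists (y v ^+ s / psum s y); first by rewrite mulrA ler_pdivlMr.
have cl_card : #|clone v| = (k + q.+1)%N by rewrite card_clone cG addnS.
have npc : near_partite (clone v).
  pose fo (o : option 'I_r) : 'I_r := if o is Some i then i else Ordinal r0.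
  exists [set Some u | u in apexes col], (fun a : clone v => if a is Some u then fo (col u) else fo (col v)).
  split; first by rewrite card_imset ?colk // => a b [].
  have SA (u : G) : (Some u : clone v) \in ~: [set Some u | u in apexes col] -> u \notin apexes col.
    by rewrite in_setC; apply: contra => uA; apply: imset_f.
  have cold (a b : G) : a \notin apexes col -> b \notin apexes col -> sedge a b -> fo (col a) != fo (col b).
    rewrite !inE colE /mp_rel; case: (col a) => // i _; case: (col b) => // j _ /andP[_] /=.
    by rewrite (inj_eq Some_inj).
  move=> [a|] [b|] // hA hB.
  - by apply: cold; exact: SA.
  - by move=> /= va; rewrite eq_sym; apply: cold => //; exact: SA.
  - by move=> /= vb; apply: cold => //; exact: SA.
have [le _] := near_partite_le (ltn_addl k (ltn0Sn q)) phi1 cl_card npc.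
have := radius_clone m0 v py; rewrite -/G => h.
rewrite -(ler_pM2r p0) -!mulrA !mulrDl !mul1r -mulrA divfK ?gt_eqF //.
apply: le_trans h _; rewrite ler_wpM2r // addr_ge0 ?exprn_ge0 // ltW //.
Qed.

(** [u] is the share of the deleted vertex in the power sum, and [u'] that of the cloned
    one. Both inequalities are monotone in these shares, which may therefore be replaced
    by their bounds [a] and [b]. *)
Lemma ratio_gain (a b rH rH' p p' u u' lam ga : R) :
  a <= b -> 0 <= a -> a < 1 -> 0 < 1 - s%:R * a -> 0 <= u -> u <= a -> b <= u' ->
  0 <= rH -> 0 <= lam -> 0 <= ga -> 0 <= p' ->
  rH * (1 - s%:R * u) <= rH' * (1 - u) -> p' * (1 + s%:R * u') <= p * (1 + u') ->
  lam * p <= rH ->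
  (1 + ga) * ((1 - a) * (1 + b)) <= (1 + s%:R * b) * (1 - s%:R * a) ->
  lam * (1 + ga) * p' <= rH'.
Proof.
move=> ab a0 a1 sa0 u0 ua bu rH0 lam0 ga0 p'0 hH hp hl hab.
have s1 : 1 <= s%:R :> R by rewrite ler1n.
have b0 : 0 <= b by exact: le_trans ab.
have u1 : 0 < 1 - u by lra.
have u'1 : 0 < 1 + u' by lra.
have hH' : rH * (1 - s%:R * a) <= rH' * (1 - a).
  rewrite -(ler_pM2r u1).
  have h1 : rH * ((1 - s%:R * a) * (1 - u)) <= rH * ((1 - s%:R * u) * (1 - a)).
    rewrite ler_wpM2l // -subr_ge0 (_ : _ - _ = (s%:R - 1) * (a - u)); last by ring.
    by rewrite mulr_ge0 ?subr_ge0.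
  have a1' : 0 <= 1 - a by lra.
  have h2 := ler_wpM2r a1' hH; lra.
have hp' : p' * (1 + s%:R * b) <= p * (1 + b).
  rewrite -(ler_pM2r u'1).
  have h1 : p' * ((1 + s%:R * b) * (1 + u')) <= p' * ((1 + s%:R * u') * (1 + b)).
    rewrite ler_wpM2l // -subr_ge0 (_ : _ - _ = (s%:R - 1) * (u' - b)); last by ring.
    by rewrite mulr_ge0 ?subr_ge0.
  have b1' : 0 <= 1 + b by lra.
  have h2 := ler_wpM2r b1' hp; lra.
have ab0 : 0 < (1 - a) * (1 + b) by rewrite mulr_gt0; lra.
rewrite -(ler_pM2r ab0).
have lp0 : 0 <= lam * p' by exact: mulr_ge0.
have h1 := ler_wpM2l lp0 hab.
have h2 := ler_wpM2l (mulr_ge0 lam0 (ltW sa0)) hp'.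
have b1' : 0 <= 1 + b by lra.
have h3 := ler_wpM2r (mulr_ge0 (ltW sa0) b1') hl.
have h4 := ler_wpM2r b1' hH'.
lra.
Qed.

(** To first order in [h], the sides are [1 + 3 / 4 * ep * h] and [1 + s / 2 * ep * h],
    where [s >= 2]. *)
Lemma ratio_ineq (ep h : R) : 0 < ep -> ep <= 1 -> 0 <= h ->
  4 * (s%:R ^+ 2 + 1) * h <= ep ->
  (1 + ep / 4 * h) * ((1 - (1 - ep) * h) * (1 + (1 - ep / 2) * h))
  <= (1 + s%:R * ((1 - ep / 2) * h)) * (1 - s%:R * ((1 - ep) * h)).
Proof.
move=> ep0 ep1 h0 hh; set S := s%:R in hh *.
have S2 : 2 <= S by rewrite /S ler_nat.
pose uv := (1 - ep) * (1 - ep / 2).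
have uv0 : 0 <= uv by rewrite mulr_ge0; lra.
have uv1 : uv <= 1 by rewrite mulr_ile1; lra.
have epS : 2 * ep <= S * ep by rewrite ler_wpM2r // ltW.
have h1 : ep / 4 * (ep / 2) <= 1.
  have : ep * ep <= 1 * 1 by rewrite ler_pM // ltW.
  lra.
have h2 : 0 <= S ^+ 2 * (1 - uv) by rewrite mulr_ge0 ?sqr_ge0 ?subr_ge0.
have key : 0 <= S * ep / 2 - ep / 2 - ep / 4 - h * (S ^+ 2 * uv + ep / 4 * (ep / 2)).
  have : h * (S ^+ 2 * uv + ep / 4 * (ep / 2)) <= h * (S ^+ 2 + 1).
    by rewrite ler_wpM2l //; lra.
  lra.
have k2 := mulr_ge0 h0 key.
have k3 : 0 <= h ^+ 2 * uv by rewrite mulr_ge0 ?sqr_ge0.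
have k4 : 0 <= ep / 4 * h * (h ^+ 2 * uv) by rewrite !mulr_ge0 ?sqr_ge0 //; lra.
rewrite /uv in k2 k3 k4; lra.
Qed.

Lemma del_vertex_free (G : sgraph) (v : G) :
  sg_free (disjoint_union F) G -> sg_free (disjoint_union F) (del_vertex v).
Proof.
move=> free [f f_inj fE]; apply: free; exists (val \o f) => [a b|a b /fE //].
by move/val_inj/f_inj.
Qed.

(** By [near_uniform_partite], some vertex has a small Perron weight. Deleting it
    decreases the radius by a smaller factor, according to [radius_delete], than [phi]
    decreases with one vertex less, according to [phi_growth]. *)
Lemma descent_step : exists ga (N : nat), [/\ 0 < ga, ga <= 1 & forall q (H : sgraph) lam,
  (N <= k + q)%N -> #|H| = (k + q.+1)%N -> sg_free (disjoint_union F) H ->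
  ~ near_partite H -> 1 <= lam -> lam * phi q.+1 <= rho H ->
  exists H' : sgraph, [/\ #|H'| = (k + q)%N, sg_free (disjoint_union F) H' &
    lam * (1 + ga / (k + q.+1)%:R) * phi q <= rho H']].
Proof.
have [eps [N1 [eps0 hN1]]] := near_uniform_partite R hcrit hchi r2 m0 mr kt.
pose ep := Num.min eps 1.
have ep0 : 0 < ep by rewrite lt_min eps0 ltr01.
have ep1 : ep <= 1 by rewrite /ep ge_min lexx orbT.
have ep_eps : ep <= eps by rewrite /ep ge_min lexx.
have [|N2 hN2] := @phi_growth (ep / 2) (divr_gt0 ep0 (ltr0Sn R 1)); first by lra.
have [N3 hN3] := phi_pos.
have [N4 hN4] := nat_large (4 * (s%:R ^+ 2 + 1)) ep0.
exists (ep / 4), (maxn (maxn N1 N2) (maxn (maxn N3 N4) 1)); split; [lra|lra|].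
move=> q H lam; rewrite !geq_max => /andP[/andP[hn1 hn2] /andP[/andP[hn3 hn4] hn5]].
move=> cH free np lam1 hlam.
have lt_q : (k + q < k + q.+1)%N by rewrite addnS.
have [n0 phi0] := hN3 q hn3.
have [n0' phi0'] := hN3 q.+1 (leq_trans hn3 (ltnW lt_q)).
set n := (k + q.+1)%N in cH lt_q n0' *.
have nR : 0 < n%:R :> R by rewrite ltr0n.
have [_ hh] := hN4 n (leq_trans hn4 (ltnW lt_q)).
have H_0 : (0 < #|H|)%N by rewrite cH.
have [y py] := perron_exists R m0 H_0; have [y0 y1 eqy eigy] := py.
have [p1 p0] := perron_psum py.
have hrho : phi q.+1 <= rho H.
  by apply: le_trans hlam; rewrite ler_peMl // ltW.
have [v hv] : exists v, n%:R * y v ^+ s < (1 - ep) * psum s y.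
  have [/existsP[v hv]|/existsPn h] :=
    boolP [exists v, n%:R * y v ^+ s < (1 - ep) * psum s y]; first by exists v.
  case: np; apply: (hN1 q.+1 H y _ cH free hrho py).
    exact: leq_trans hn1 (ltnW lt_q).
  move=> v; have := h v; rewrite -leNgt; apply: le_trans.
  by rewrite ler_wpM2r ?(ltW p0) // lerD2l lerN2.
have [u' hu' hphi] := hN2 q hn2.
exists (del_vertex v); split.
- by rewrite card_del_vertex cH /n addnS.
- exact: del_vertex_free.
have H_1 : (1 < #|H|)%N by rewrite cH; apply: leq_ltn_trans lt_q.
have hdel := radius_delete m0 v H_1 py.
pose u := y v ^+ s / psum s y; pose h := n%:R^-1 : R.
have h0 : 0 <= h by rewrite invr_ge0.
have h_gt : 0 < h by rewrite invr_gt0.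
have ys : y v ^+ s = u * psum s y by rewrite /u divfK // gt_eqF.
have hS : 4 * (s%:R ^+ 2 + 1) * h <= ep by exact: hh.
have S2 : 2 <= s%:R :> R by rewrite ler_nat.
have SS : s%:R * 2 <= s%:R ^+ 2 :> R by rewrite expr2 ler_wpM2l.
have Sh : s%:R * h <= 1 / 8.
  have : s%:R * 2 * h <= s%:R ^+ 2 * h by rewrite ler_wpM2r.
  by move: hS; lra.
have u'h : (1 - ep / 2) * h <= u'.
  have knR : 0 < (k + q)%:R :> R by rewrite ltr0n.
  have u'0 : 0 <= u' by rewrite -(pmulr_rge0 _ knR); apply: le_trans hu'; lra.
  rewrite ler_pdivrMr //; apply: le_trans hu' _.
  by rewrite mulrC ler_wpM2l ?ler_nat ?(ltnW lt_q).
have h_S : h <= s%:R * h by rewrite ler_peMl //; lra.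
have mul_le (d : R) : 0 <= d -> d <= 1 -> d * h <= h by move=> d0 d1; rewrite ler_piMl.
have SSh (d : R) : 0 <= d -> d <= 1 -> s%:R * (d * h) <= 1 / 8.
  by move=> d0 d1; apply: le_trans Sh; rewrite ler_wpM2l // mul_le.
have d0 : 0 <= 1 - ep by rewrite subr_ge0.
have d1 : 1 - ep <= 1 by rewrite gerBl ltW.
apply: (@ratio_gain ((1 - ep) * h) ((1 - ep / 2) * h) (rho H) _ (phi q.+1) _ u u').
- by rewrite ler_wpM2r //; lra.
- exact: mulr_ge0.
- by have := mul_le _ d0 d1; lra.
- by have := SSh _ d0 d1; lra.
- by rewrite divr_ge0 ?exprn_ge0 // ltW.
- rewrite ler_pdivrMr // mulrAC ler_pdivlMr // mulrC; exact: ltW.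
- exact: u'h.
- exact: clique_radius_ge0.
- by lra.
- by rewrite !divr_ge0 // ltW.
- exact: ltW.
- rewrite -(ler_pM2r p0).
  rewrite [leLHS](_ : _ = rho H * (psum s y - s%:R * (u * psum s y))); last by ring.
  rewrite [leRHS](_ : _ = rho (del_vertex v) * (psum s y - u * psum s y)); last by ring.
  by rewrite -ys.
- exact: hphi.
- exact: hlam.
- exact: ratio_ineq.
Qed.

(** Otherwise [descent_step] applies again and again: the ratio to [phi] rises above 1,
    so that the smaller graphs are not near-partite either. Once half of the vertices
    are deleted, the ratio is at least [1 + ga / 3], against the asymptotic values
    [radius_upper] and [turan_radius_lower]. *)
Lemma extremal_near_partite : exists N : nat, forall q (G : sgraph), (N <= k + q)%N ->
  #|G| = (k + q)%N -> sg_free (disjoint_union F) G -> phi q <= rho G -> near_partite G.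
Proof.
have [ga [N1 [ga0 ga1 step]]] := descent_step.
have c0 : 0 < c by exact: radius_density_gt0.
have e0 : 0 < c * ga / 12 by rewrite divr_gt0 // mulr_gt0.
have [N2 hN2] := radius_upper hchi r2 m0 mr e0.
have [N3 hN3] := turan_radius_lower r2 m0 mr k e0.
have [N4 hN4] := phi_pos.
have [N0 [[N0_1 N0_2 N0_3 N0_4] N0_k N0_0]] : exists N0 : nat,
    [/\ [/\ N1 <= N0, N2 <= N0, N3 <= N0 & N4 <= N0], k <= N0 & 2 <= N0]%N.
  by exists (N1 + N2 + N3 + N4 + k + 2)%N; split; [split|..]; lia.
exists (N0 * 2)%N => q G hq cG free hphi; apply: contrapT => np.
have nR : 0 < (k + q)%:R :> R.
  by rewrite ltr0n; apply: leq_trans hq; rewrite muln_gt0 (leq_trans _ N0_0).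
have descend j : (j <= (k + q)./2)%N -> exists H : sgraph,
   [/\ #|H| = (k + (q - j))%N, sg_free (disjoint_union F) H,
     (1 + j%:R * (ga / (k + q)%:R)) * phi (q - j) <= rho H & ~ near_partite H].
  elim: j => [_|j IH jn]; first by exists G; rewrite subn0 mul0r addr0 mul1r.
  have [H [cH freeH hH npH]] := IH (ltnW jn).
  have [small _] := half_step N0_k hq (ltnW jn).
  have [small' jq] := half_step N0_k hq jn.
  have qE : (q - j = (q - j.+1).+1)%N by rewrite subnSK.
  rewrite qE in cH hH.
  have d0 : 0 < ga / (k + q)%:R by rewrite divr_gt0.
  have lam1 : 1 <= 1 + j%:R * (ga / (k + q)%:R) by rewrite lerDl mulr_ge0 // ltW.
  have [H' [cH' freeH' hH']] :=
    step _ H _ (leq_trans N0_1 small') cH freeH npH lam1 hH.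
  have [n0 phi0] := hN4 _ (leq_trans N0_4 small').
  have hH2 : (1 + j.+1%:R * (ga / (k + q)%:R)) * phi (q - j.+1) <= rho H'.
    apply: le_trans hH'; rewrite ler_pM2r // -natr1.
    have : ga / (k + q)%:R <= ga / (k + (q - j.+1).+1)%:R.
      have a2 : 0 < (k + (q - j.+1).+1)%:R :> R by rewrite ltr0n addnS.
      by rewrite ler_pM2l // lef_pV2 // ler_nat leq_add2l -qE leq_subr.
    have : 0 <= j%:R * (ga / (k + q)%:R) * (ga / (k + (q - j.+1).+1)%:R).
      by rewrite !mulr_ge0 ?invr_ge0 ?(ltW ga0) ?(ltW d0).
    by lra.
  exists H'; split=> // npH'.
  have [le _] := near_partite_le n0 phi0 cH' npH'.
  have : phi (q - j.+1) < (1 + j.+1%:R * (ga / (k + q)%:R)) * phi (q - j.+1).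
    by rewrite ltr_pMl // ltrDl mulr_gt0.
  by rewrite ltNge (le_trans hH2 le).
have [H [cH freeH hH _]] := descend _ (leqnn _).
have [small jq] := half_step N0_k hq (leqnn _).
set j := (k + q)./2 in cH hH small jq *.
have up : rho H <= (c + c * ga / 12) * (k + (q - j))%:R ^+ m.
  by rewrite -cH; apply: hN2 => //; rewrite cH; exact: leq_trans small.
have low := hN3 (q - j)%N (leq_trans N0_3 small).
have n0 : (0 < k + (q - j))%N by apply: leq_trans small; exact: leq_trans N0_0.
have nm : 0 < (k + (q - j))%:R ^+ m :> R by rewrite exprn_gt0 // ltr0n.
have j3 : ga / 3 <= j%:R * (ga / (k + q)%:R).
  rewrite mulrCA ler_pM2l // ler_pdivlMr // mulrC ler_pdivrMr // -natrM ler_nat.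
  apply: third_le_half; apply: leq_trans hq; apply: leq_trans N0_0 _.
  exact: leq_pmulr.
have h1 : (1 + ga / 3) * ((c - c * ga / 12) * (k + (q - j))%:R ^+ m)
    <= (c + c * ga / 12) * (k + (q - j))%:R ^+ m.
  apply: le_trans up; apply: le_trans hH; apply: ler_pM => //.
  - by rewrite addr_ge0 // divr_ge0 // ltW.
  - rewrite mulr_ge0 ?(ltW nm) // subr_ge0 -mulrA ler_piMr ?(ltW c0) //; lra.
  - by rewrite lerD2l.
move: h1; rewrite mulrA ler_pM2r //; apply/negP; rewrite -ltNge.
have : 0 < c * ga by rewrite mulr_gt0.
have : c * ga * ga <= c * ga * 1 by rewrite ler_pM2l // mulr_gt0.
by lra.
Qed.
End Descent.

Theorem theorem1p4 (R : realType) (s r t : nat) (F : 'I_t -> sgraph)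
  (hs : (2 <= s)%N) (hsr : (s <= r)%N) (ht : (2 <= t)%N)
  (hcrit : forall i, color_critical (F i))
  (hchi : forall i, chi (F i) = (r + 1)%N) :
  exists N : nat, forall n : nat, (N <= n)%N ->
    let G0 := join (complete (t - 1)) (turan r (n - t + 1)) in
    [/\ #|G0| = n,
        sg_free (disjoint_union F) G0 &
        forall G : sgraph, #|G| = n -> sg_free (disjoint_union F) G ->
          clique_spectral_radius R s G <= clique_spectral_radius R s G0 /\
          (clique_spectral_radius R s G = clique_spectral_radius R s G0 ->
           sg_iso G G0)].
Proof.
case: s hs hsr => [//|m] m0 mr; rewrite ltnS in m0.
have r2 : (2 <= r)%N by exact: leq_ltn_trans mr.
have kt : (t - 1).+1 = t by lia.
have [N1 hN1] := extremal_near_partite R hcrit hchi r2 m0 mr kt.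
have [N2 hN2] := phi_pos R (t - 1) r2 m0 mr.
exists (N1 + N2 + t)%N => n hn G0.
have nE : (t - 1 + (n - t + 1) = n)%N by lia.
have [n0 phi0] := hN2 (n - t + 1)%N ltac:(lia).
have G0E : G0 = turan_join r (t - 1) (n - t + 1) by [].
split.
- by rewrite G0E card_turan_join nE.
- apply: turan_join_free; [exact: ltnW|by lia|].
  by move=> i; rewrite chi_colorable hchi addn1 -ltnNge.
move=> G cG free; rewrite G0E.
have cG' : #|G| = (t - 1 + (n - t + 1))%N by rewrite nE.
pose rho H := clique_spectral_radius R m.+1 H.
have main : rho (turan_join r (t - 1) (n - t + 1)) <= rho G ->
    rho G <= rho (turan_join r (t - 1) (n - t + 1)) /\
    (rho G = rho (turan_join r (t - 1) (n - t + 1)) ->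
       sg_iso G (turan_join r (t - 1) (n - t + 1))).
  move=> le; have np : near_partite r (t - 1) G.
    by apply: (hN1 (n - t + 1)%N) => //; lia.
  exact: near_partite_le np.
split; first by case: (leP (rho (turan_join r (t - 1) (n - t + 1))) (rho G)) => [/main[]|/ltW].
by move=> E; have [|_] := main; [rewrite /rho E|apply].
Qed.
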